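(* For positive numbers $r_1,r_2,r_3$ with $r_1^2+r_2^2+r_3^2=1$, let $\Sigma_{r_1,r_2,r_3}\subset\mathbb{C}P^2$ be the homogeneous Lagrangian torus which is the image under the Hopf projection $\mathcal{H}:S^5\to\mathbb{C}P^2$ of the 3-torus $\{(r_1e^{i\varphi_1},r_2e^{i\varphi_2},r_3e^{i\varphi_3}):\varphi_j\in\mathbb{R}\}\subset S^5$. Then $$E(\Sigma_{r_1,r_2,r_3})=\frac{\pi^2(1-r_1^2)(1-r_2^2)(1-r_3^2)}{2r_1r_2r_3}.$$ Among Lagrangian homogeneous tori in $\mathbb{C}P^2$ the Clifford torus $\Sigma_{Cl}=\Sigma_{\frac1{\sqrt3},\frac1{\sqrt3},\frac1{\sqrt3}}$ attains the minimum of the energy functional $E$, and $$E(\Sigma_{Cl})=\mathrm{Area}(\Sigma_{Cl})=\frac{4\pi^2}{3\sqrt3}.$$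
   Context: $\mathbb{C}P^2$ carries the Fubini–Study metric for which the Hopf projection $\mathcal{H}:S^5\to\mathbb{C}P^2$ from the unit sphere $S^5\subset\mathbb{C}^3$ is a Riemannian submersion. $\langle\cdot,\cdot\rangle$ is the Hermitian inner product of $\mathbb{C}^3$. Any homogeneous torus in $\mathbb{C}P^2$ is, up to automorphisms (holomorphic isometries) of $\mathbb{C}P^2$, one of the tori $\Sigma_{r_1,r_2,r_3}$. Energy of a Lagrangian torus. A Lagrangian torus $\Sigma$ is described by a map $r:\mathbb{R}^2\to S^5$ in global conformal coordinates $(x,y)$ on the universal cover, which is a horizontal lift: the immersion is $\mathcal{H}\circ r$, doubly periodic with respect to a lattice $\Lambda\subset\mathbb{R}^2$ (so $\Sigma=\mathbb{R}^2/\Lambda$ as domain), the induced metric is $ds^2=2e^{v(x,y)}(dx^2+dy^2)$, and $$\langle r,r\rangle=1,\quad \langle r_x,r\rangle=\langle r_y,r\rangle=\langle r_x,r_y\rangle=0,\quad \langle r_x,r_x\rangle=\langle r_y,r_y\rangle=2e^{v}.$$ The matrix $\tilde R$ with rows $r,\ r_x/|r_x|,\ r_y/|r_y|$ lies in $\mathrm{U}(3)$, and the Lagrangian angle $\beta$ is the real function defined by $e^{i\beta}=\det\tilde R$ (defined up to constants). The potential of the Schrödinger operator associated with $\Sigma$ is the $\Lambda$-periodic function $$V=4e^v+\tfrac14(\beta_x^2+\beta_y^2)+\tfrac{i}{2}\Delta\beta,\qquad \Delta=\partial_x^2+\partial_y^2,$$ and the energy of $\Sigma$ is $E(\Sigma)=\frac12\int_{\Sigma}V\,dx\wedge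 dy$, the integral being over a fundamental domain of $\Lambda$. The tori $\Sigma_{r_1,r_2,r_3}$ are embedded, and $\Lambda$ is taken to be the full lattice of periods of $\mathcal{H}\circ r$. *)

(* Defs.v *)
From Stdlib Require Export Reals.
From mathcomp Require Export all_boot all_order all_algebra.
From mathcomp Require Export complex spectral Rstruct.
From Coquelicot Require Export Coquelicot.

Set Implicit Arguments.
Unset Strict Implicit.
Unset Printing Implicit Defensive.

(* The reals are the standard library's [R], and [complex R] is the numClosedFieldType
   built on them.  As %R is MathComp's ring_scope, the standard library's real
   operations are written with %coqR. *)
Delimit Scope R_scope with coqR.

Notation Cplx := (complex R).
Notation C3 := 'rV[complex R]_3.
Notation cR x := (@Complex R x%coqR 0%coqR).
Definition expi (t : R) : Cplx := Complex (cos t) (sin t).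

Local Open Scope ring_scope.

Definition Dx (f : R -> R -> R) (x y : R) : R := Derive (fun t => f t y) x.
Definition Dy (f : R -> R -> R) (x y : R) : R := Derive (fun t => f x t) y.

Fixpoint Ck (k : nat) (f : R -> R -> R) : Prop :=
  (forall x y, continuity_2d_pt f x y) /\
  if k is k'.+1 then
    [/\ forall x y, ex_derive (fun t => f t y) x /\ ex_derive (fun t => f x t) y,
        Ck k' (Dx f) & Ck k' (Dy f)]
  else True.

Definition smooth (f : R -> R -> R) : Prop := forall k, Ck k f.

Definition smooth3 (r : R -> R -> C3) : Prop :=
  forall j : 'I_3, smooth (fun x y => complex.Re (r x y 0 j)) /\
                   smooth (fun x y => complex.Im (r x y 0 j)).

(* Vector-valued partial derivatives, along either of the operators above. *)
Definition D3 (D : (R -> R -> R) -> R -> R -> R) (r : R -> R -> C3)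
    (x y : R) : C3 :=
  \row_j Complex (D (fun s t => complex.Re (r s t 0 j)) x y)
                 (D (fun s t => complex.Im (r s t 0 j)) x y).

(* [dotmx] is the Hermitian product, linear in its first argument. *)
Definition norm3 (u : C3) : R := sqrt (complex.Re (dotmx u u)).

(* A point of CP^2 is a complex line of C^3; the Hopf projection sends a unit
   vector to the line it spans.  Subsets of CP^2 are predicates on lines. *)
Definition hopf (u : C3) : {vspace C3} := <[u]>%VS.

(* The action on lines of the linear map u |-> u *m U.  For U unitary these are the
   holomorphic isometries of the Fubini-Study metric, i.e. PU(3). *)
Definition move (U : 'M[Cplx]_3) (L : {vspace C3}) : {vspace C3} :=
  (linfun (mulmxr U : C3 -> C3) @: L)%VS.

(* [lift] is r, [conf] is v, [angle] is beta; (w11, w12) and (w21, w22) are a basis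
   of the lattice Lambda. *)
Record torus_data := TorusData {
  lift : R -> R -> C3;
  conf : R -> R -> R;
  angle : R -> R -> R;
  w11 : R; w12 : R; w21 : R; w22 : R
}.

Section TorusData.
Variable T : torus_data.
Let r := lift T.
Let v := conf T.
Let beta := angle T.
Let rx := D3 Dx r.
Let ry := D3 Dy r.

Definition covol : R := Rabs (w11 T * w22 T - w12 T * w21 T)%coqR.

Definition in_lattice (a b : R) : Prop :=
  exists m n : Z, (a = IZR m * w11 T + IZR n * w21 T)%coqR /\
                  (b = IZR m * w12 T + IZR n * w22 T)%coqR.

Definition frame (x y : R) : 'M[Cplx]_3 :=
  \matrix_(i < 3) nth 0 [:: r x y;
                            cR (/ norm3 (rx x y)) *: rx x y;
                            cR (/ norm3 (ry x y)) *: ry x y] i.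

Definition lagrangian_torus : Prop :=
  [/\ smooth3 r /\ smooth beta,
      covol <> 0%coqR,
      forall x y a b, in_lattice a b ->
        hopf (r (x + a)%coqR (y + b)%coqR) = hopf (r x y),
      forall x y,
        [/\ dotmx (r x y) (r x y) = 1,
            [/\ dotmx (rx x y) (r x y) = 0, dotmx (ry x y) (r x y) = 0
              & dotmx (rx x y) (ry x y) = 0],
            dotmx (rx x y) (rx x y) = cR (2 * exp (v x y))
          & dotmx (ry x y) (ry x y) = cR (2 * exp (v x y))]
    & forall x y, expi (beta x y) = \det (frame x y)].

Definition potential (x y : R) : Cplx :=
  Complex (4 * exp (v x y) + / 4 * (Dx beta x y ^ 2 + Dy beta x y ^ 2))%coqR
          (/ 2 * (Dx (Dx beta) x y + Dy (Dy beta) x y))%coqR.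

(* Integral over the period parallelogram, the image of the unit square under
   (s, t) |-> s (w11, w12) + t (w21, w22), whose Jacobian is [covol]. *)
Definition integral (f : R -> R -> R) : R :=
  (covol * RInt (fun s => RInt (fun t =>
     f (s * w11 T + t * w21 T) (s * w12 T + t * w22 T)) 0 1) 0 1)%coqR.

Definition energy : Cplx :=
  Complex (/ 2 * integral (fun x y => complex.Re (potential x y)))%coqR
          (/ 2 * integral (fun x y => complex.Im (potential x y)))%coqR.

Definition area : R := integral (fun x y => 2 * exp (v x y))%coqR.

(* The immersion hopf o r induces a bijection from R^2 / Lambda onto the subset S
   of CP^2; in particular Lambda is the full lattice of periods of hopf o r. *)
Definition parametrizes (S : {vspace C3} -> Prop) : Prop :=
  [/\ lagrangian_torus,
      forall L, S L <-> exists x y, L = hopf (r x y)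
    & forall x y x' y', hopf (r x y) = hopf (r x' y') ->
        in_lattice (x - x')%coqR (y - y')%coqR].

End TorusData.

(* Well-definedness is part of the assertion: the energy (area) of S is the common
   value over all parametrizations of S, of which there must be one. *)
Definition has_energy (S : {vspace C3} -> Prop) (e : Cplx) : Prop :=
  (exists T, parametrizes T S) /\ forall T, parametrizes T S -> energy T = e.

Definition has_area (S : {vspace C3} -> Prop) (a : R) : Prop :=
  (exists T, parametrizes T S) /\ forall T, parametrizes T S -> area T = a.

(* The holomorphic isometries of CP^2 that preserve S act transitively on S. *)
Definition homogeneous (S : {vspace C3} -> Prop) : Prop :=
  forall P Q, S P -> S Q ->
    exists U : 'M[Cplx]_3, [/\ U \is unitarymx,
      forall L, S L <-> S (move U L) & move U P = Q].

Definition homogeneous_lagrangian_torus (S : {vspace C3} -> Prop) : Prop :=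
  (exists T, parametrizes T S) /\ homogeneous S.

Definition Sigma (r1 r2 r3 : R) (L : {vspace C3}) : Prop :=
  exists p1 p2 p3 : R,
    L = hopf (\row_j nth 0 [:: cR r1 * expi p1; cR r2 * expi p2; cR r3 * expi p3] j).

Definition Clifford : {vspace C3} -> Prop :=
  Sigma (/ sqrt 3)%coqR (/ sqrt 3)%coqR (/ sqrt 3)%coqR.

(* Main.v *)
(* Two parametrizations of the same torus by conformal coordinates differ by a map of the
   plane that is locally a conformal lift; its Jacobian matrix is doubly periodic, and
   curl free because it is a gradient.  Conformality makes it divergence free as well, so
   the Cauchy-Riemann equations and an integration by parts over a period show that it is
   constant: the change of parameters is affine.  Hence the energy, whose density is
   constant for the linear parametrization of Sigma_{r1,r2,r3}, is the same for every
   parametrization, and it can be computed on the linear one.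

   For a homogeneous torus S, each isometry of S is therefore an affine conformal map of
   the universal cover preserving the lattice.  Only finitely many linear parts occur, and
   R^2 is divisible, so every translation of R^2 is induced by a unitary matrix.  These
   matrices commute; in a common eigenbasis the coordinates of the lift are characters
   times constants, so S is congruent to some Sigma_{r1,r2,r3}, and the minimum follows
   from e2 >= sqrt (3 e1 e3) for the elementary symmetric functions of the r_j^2. *)

Require Import Defs.
From Stdlib Require Import Lra Psatz Lia Classical ClassicalEpsilon.
From Stdlib Require Import FunctionalExtensionality PropExtensionality.
From mathcomp Require Import zify.

Set Implicit Arguments.
Unset Strict Implicit.
Unset Printing Implicit Defensive.
Import GRing.Theory Num.Theory.

Local Open Scope ring_scope.
Local Open Scope R_scope.
Delimit Scope Z_scope with ZZ.

(** The obstacle is that the change of parameters is not given as a smooth map of the plane: choice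
    only yields, point by point, some parameter with the right image. No covering theory is used to
    repair this. Lines are embedded in R^18 as projection matrices, so a torus becomes a doubly
    periodic conformal map [P] into a Euclidean space, injective modulo its lattice. Near each point
    the chosen parameter is corrected by lattice vectors to a branch that is differentiable there,
    and the Jacobian, written with inner products of derivatives of [P] and [Q], ignores the choice
    of branch. Being built from lattice-periodic functions, it is smooth by induction on the order.
    The same rigidity theorem serves twice: for two parametrizations of one torus, and for a torus
    and its image under an isometry preserving it. It leaves the orientation open, so conformality
    is carried throughout by two relations between the columns of the Jacobian. Returning from CP^2
    to C^3 costs only a constant phase, because horizontal lifts of the same map differ by one. *)

Notation conjC := Num.Def.conjC.

(** * Smooth functions on the plane *)

Notation diff2 := differentiable_pt_lim.

(** One continuous partial is enough: an increment splits into a horizontal move near the point,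
    controlled by the mean value theorem, and a vertical move through the point itself. *)
Lemma diff2_of_partials (f fx fy : R -> R -> R) x y :
  (forall u v, is_derive (fun t => f t v) u (fx u v)) ->
  (forall u v, is_derive (fun t => f u t) v (fy u v)) ->
  continuity_2d_pt fx x y -> diff2 f x y (fx x y) (fy x y).
Proof.
move=> hx hy hc; apply/filterdiff_differentiable_pt_lim.
apply: (@is_derive_filterdiff f x y fx (fy x y)) => //.
- by apply: filter_forall => -[u v]; apply: hx.
- by apply/continuity_2d_pt_filterlim.
Qed.

Lemma diff2_Dx f x y a b : diff2 f x y a b -> Dx f x y = a.
Proof. by case/differentiable_pt_lim_unique. Qed.

Lemma diff2_Dy f x y a b : diff2 f x y a b -> Dy f x y = b.
Proof. by case/differentiable_pt_lim_unique. Qed.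

Lemma diff2_is_derive_x f x y a b :
  diff2 f x y a b -> is_derive (fun t => f t y) x a.
Proof.
move=> h; apply/is_derive_Reals.
have -> : a = a * 1 + b * 0 by ring.
apply: (@derivable_pt_lim_comp_2d f (fun t => t) (fun=> y)) => //.
- exact: derivable_pt_lim_id.
- exact: derivable_pt_lim_const.
Qed.

Lemma diff2_is_derive_y f x y a b :
  diff2 f x y a b -> is_derive (fun t => f x t) y b.
Proof.
move=> h; apply/is_derive_Reals.
have -> : b = a * 0 + b * 1 by ring.
apply: (@derivable_pt_lim_comp_2d f (fun=> x) (fun t => t)) => //.
- exact: derivable_pt_lim_const.
- exact: derivable_pt_lim_id.
Qed.

Lemma diff2_cont f x y a b : diff2 f x y a b -> continuity_2d_pt f x y.
Proof. by move=> h; apply: differentiable_continuity_pt; exists a, b. Qed.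

Lemma diff2_const c x y : diff2 (fun _ _ => c) x y 0 0.
Proof.
apply: (@diff2_of_partials _ (fun _ _ => 0) (fun _ _ => 0)).
- by move=> u v; apply: is_derive_const.
- by move=> u v; apply: is_derive_const.
- exact: continuity_2d_pt_const.
Qed.

Lemma diff2_fst x y : diff2 (fun u _ => u) x y 1 0.
Proof.
apply: (@diff2_of_partials _ (fun _ _ => 1) (fun _ _ => 0)).
- by move=> u v; apply: is_derive_id.
- by move=> u v; apply: is_derive_const.
- exact: continuity_2d_pt_const.
Qed.

Lemma diff2_snd x y : diff2 (fun _ v => v) x y 0 1.
Proof.
apply: (@diff2_of_partials _ (fun _ _ => 0) (fun _ _ => 1)).
- by move=> u v; apply: is_derive_const.
- by move=> u v; apply: is_derive_id.
- exact: continuity_2d_pt_const.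
Qed.

Lemma diff2_add f g x y a b c d : diff2 f x y a b -> diff2 g x y c d ->
  diff2 (fun u v => f u v + g u v) x y (a + c) (b + d).
Proof.
move=> hf hg.
have -> : a + c = 1 * a + 1 * c by ring.
have -> : b + d = 1 * b + 1 * d by ring.
apply: (@differentiable_pt_lim_comp Rplus f g) => //.
apply: (@diff2_of_partials _ (fun _ _ => 1) (fun _ _ => 1)).
- by move=> u v; auto_derive.
- by move=> u v; auto_derive.
- exact: continuity_2d_pt_const.
Qed.

Lemma diff2_mul f g x y a b c d : diff2 f x y a b -> diff2 g x y c d ->
  diff2 (fun u v => f u v * g u v) x y (a * g x y + f x y * c)
    (b * g x y + f x y * d).
Proof.
move=> hf hg.
have -> : a * g x y + f x y * c = g x y * a + f x y * c by ring.
have -> : b * g x y + f x y * d = g x y * b + f x y * d by ring.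
apply: (@differentiable_pt_lim_comp Rmult f g) => //.
apply: (@diff2_of_partials _ (fun _ v => v) (fun u _ => u)).
- by move=> u v; auto_derive => //; ring.
- by move=> u v; auto_derive => //; ring.
- exact: continuity_2d_pt_id2.
Qed.

Lemma diff2_comp1 (h : R -> R) f x y l a b :
  is_derive h (f x y) l -> diff2 f x y a b ->
  diff2 (fun u v => h (f u v)) x y (l * a) (l * b).
Proof.
move=> hh hf.
have -> : l * a = l * a + 0 * 0 by ring.
have -> : l * b = l * b + 0 * 0 by ring.
apply: (@differentiable_pt_lim_comp (fun u _ => h u) f (fun _ _ => 0)) => //.
- by apply: differentiable_pt_lim_proj1_0; apply/is_derive_Reals.
- exact: diff2_const.
Qed.

Lemma Ck_ext k f g : (forall x y, f x y = g x y) -> Ck k f -> Ck k g.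
Proof.
move=> e; suff -> : f = g by [].
by apply: functional_extensionality => x; apply: functional_extensionality => y.
Qed.

Lemma CkW k f : Ck k.+1 f -> Ck k f.
Proof.
elim: k f => [|k IH] f [hc [hd hx hy]]; first by split.
by split=> //; split=> //; apply: IH.
Qed.

Lemma Ck_cont k f x y : Ck k f -> continuity_2d_pt f x y.
Proof. by case: k => [|k] [hc _]. Qed.

Lemma Ck_diff k f x y : Ck k.+1 f -> diff2 f x y (Dx f x y) (Dy f x y).
Proof.
move=> [hc [hd hx hy]].
apply: diff2_of_partials => [u v|u v|].
- by apply: Derive_correct; apply: (hd u v).1.
- by apply: Derive_correct; apply: (hd u v).2.
- exact: Ck_cont hx.
Qed.

(** Induction step of all the closure properties below: explicit formulas for the derivatives
    replace [Dx f] and [Dy f], which agree with them by uniqueness of the differential. *)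
Lemma Ck_succ k f fx fy : (forall x y, diff2 f x y (fx x y) (fy x y)) ->
  Ck k fx -> Ck k fy -> Ck k.+1 f.
Proof.
move=> h hx hy; split; first by move=> x y; apply: diff2_cont (h x y).
split.
- move=> x y; split; first by eexists; apply: diff2_is_derive_x (h x y).
  by eexists; apply: diff2_is_derive_y (h x y).
- by apply: Ck_ext hx => x y; rewrite (diff2_Dx (h x y)).
- by apply: Ck_ext hy => x y; rewrite (diff2_Dy (h x y)).
Qed.

Lemma Ck_const k c : Ck k (fun _ _ => c).
Proof.
elim: k c => [|k IH] c.
  by split=> // x y; apply: continuity_2d_pt_const.
by apply: (@Ck_succ k _ (fun _ _ => 0) (fun _ _ => 0)) => // x y; apply: diff2_const.
Qed.

Lemma Ck_add k f g : Ck k f -> Ck k g -> Ck k (fun x y => f x y + g x y).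
Proof.
elim: k f g => [|k IH] f g hf hg.
  split=> // x y; apply: continuity_2d_pt_plus; exact: (@Ck_cont 0).
apply: (@Ck_succ k _ (fun x y => Dx f x y + Dx g x y)
                     (fun x y => Dy f x y + Dy g x y)).
- by move=> x y; apply: diff2_add; apply: Ck_diff; eassumption.
- by apply: IH; [case: hf => _ [] | case: hg => _ []].
- by apply: IH; [case: hf => _ [] | case: hg => _ []].
Qed.

Lemma Ck_mul k f g : Ck k f -> Ck k g -> Ck k (fun x y => f x y * g x y).
Proof.
elim: k f g => [|k IH] f g hf hg.
  split=> // x y; apply: continuity_2d_pt_mult; exact: (@Ck_cont 0).
have [_ [_ fx fy]] := hf; have [_ [_ gx gy]] := hg.
apply: (@Ck_succ k _ (fun x y => Dx f x y * g x y + f x y * Dx g x y)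
                     (fun x y => Dy f x y * g x y + f x y * Dy g x y)).
- by move=> x y; apply: diff2_mul; apply: Ck_diff; eassumption.
- by apply: Ck_add; apply: IH => //; apply: CkW.
- by apply: Ck_add; apply: IH => //; apply: CkW.
Qed.

Lemma Ck_inv k f : (forall x y, f x y <> 0) -> Ck k f -> Ck k (fun x y => / f x y).
Proof.
move=> nz; elim: k => [|k IH] hf.
  split=> // x y; apply: continuity_2d_pt_inv => //; exact: (@Ck_cont 0).
have [_ [_ fx fy]] := hf; have := IH (CkW hf) => hi.
have hm : Ck k (fun x y => - 1 * (/ f x y * / f x y)).
  by apply: Ck_mul; [exact: Ck_const | apply: Ck_mul].
apply: (@Ck_succ k _ (fun x y => (- 1 * (/ f x y * / f x y)) * Dx f x y)
                     (fun x y => (- 1 * (/ f x y * / f x y)) * Dy f x y)).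
- move=> x y; apply: (@diff2_comp1 Rinv f); last by apply: Ck_diff; eassumption.
  by auto_derive => //; field.
- exact: Ck_mul.
- exact: Ck_mul.
Qed.

Lemma Ck_cos_sin k f : Ck k f ->
  Ck k (fun x y => cos (f x y)) /\ Ck k (fun x y => sin (f x y)).
Proof.
elim: k => [|k IH] hf.
  split; split=> // x y; apply: (@continuity_1d_2d_pt_comp _ f);
    try exact: (@Ck_cont 0); exact: continuity_cos || exact: continuity_sin.
have [_ [_ fx fy]] := hf; have [hc hs] := IH (CkW hf).
have hm : Ck k (fun x y => - 1 * sin (f x y)).
  by apply: Ck_mul => //; exact: Ck_const.
split.
- apply: (@Ck_succ k _ (fun x y => (- 1 * sin (f x y)) * Dx f x y)
                     (fun x y => (- 1 * sin (f x y)) * Dy f x y)).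
  + move=> x y; apply: (@diff2_comp1 cos f); last by apply: Ck_diff; eassumption.
    by auto_derive => //; ring.
  + exact: Ck_mul.
  + exact: Ck_mul.
- apply: (@Ck_succ k _ (fun x y => cos (f x y) * Dx f x y)
                     (fun x y => cos (f x y) * Dy f x y)).
  + move=> x y; apply: (@diff2_comp1 sin f); last by apply: Ck_diff; eassumption.
    by auto_derive => //; ring.
  + exact: Ck_mul.
  + exact: Ck_mul.
Qed.

Lemma continuity_2d_comp f g h x y : continuity_2d_pt f (g x y) (h x y) ->
  continuity_2d_pt g x y -> continuity_2d_pt h x y ->
  continuity_2d_pt (fun u v => f (g u v) (h u v)) x y.
Proof.
move=> hf hg hh eps; case: (hf eps) => d1 H1.
case: (hg d1) => d2 H2; case: (hh d1) => d3 H3.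
have hd : 0 < Rmin d2 d3 by apply: Rmin_pos; apply: cond_pos.
exists (mkposreal _ hd) => u v /= hu hv; apply: H1.
- by apply: H2; apply: Rlt_le_trans (Rmin_l d2 d3).
- by apply: H3; apply: Rlt_le_trans (Rmin_r d2 d3).
Qed.

Lemma Ck_comp k f g h : Ck k f -> Ck k g -> Ck k h ->
  Ck k (fun x y => f (g x y) (h x y)).
Proof.
elim: k f => [|k IH] f hf hg hh.
  by split=> // x y; apply: continuity_2d_comp; exact: (@Ck_cont 0).
have [_ [_ fx fy]] := hf; have [_ [_ gx gy]] := hg; have [_ [_ hx hy]] := hh.
apply: (@Ck_succ k _
  (fun x y => Dx f (g x y) (h x y) * Dx g x y + Dy f (g x y) (h x y) * Dx h x y)
  (fun x y => Dx f (g x y) (h x y) * Dy g x y + Dy f (g x y) (h x y) * Dy h x y)).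
- by move=> x y; apply: differentiable_pt_lim_comp; apply: Ck_diff; eassumption.
- by apply: Ck_add; apply: Ck_mul => //; apply: IH => //; apply: CkW.
- by apply: Ck_add; apply: Ck_mul => //; apply: IH => //; apply: CkW.
Qed.

Lemma smooth_ext f g : (forall x y, f x y = g x y) -> smooth f -> smooth g.
Proof. by move=> e h k; apply: Ck_ext (h k). Qed.

Lemma smooth_const c : smooth (fun _ _ => c).
Proof. by move=> k; apply: Ck_const. Qed.

Lemma smooth_fst : smooth (fun x _ => x).
Proof.
case=> [|k]; first by split=> // x y; apply: continuity_2d_pt_id1.
apply: (@Ck_succ k _ (fun _ _ => 1) (fun _ _ => 0)) => [x y||].
- exact: diff2_fst.
- exact: Ck_const.
- exact: Ck_const.
Qed.

Lemma smooth_snd : smooth (fun _ y => y).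
Proof.
case=> [|k]; first by split=> // x y; apply: continuity_2d_pt_id2.
apply: (@Ck_succ k _ (fun _ _ => 0) (fun _ _ => 1)) => [x y||].
- exact: diff2_snd.
- exact: Ck_const.
- exact: Ck_const.
Qed.

Lemma smooth_add f g : smooth f -> smooth g -> smooth (fun x y => f x y + g x y).
Proof. by move=> hf hg k; apply: Ck_add. Qed.

Lemma smooth_mul f g : smooth f -> smooth g -> smooth (fun x y => f x y * g x y).
Proof. by move=> hf hg k; apply: Ck_mul. Qed.

Lemma smooth_opp f : smooth f -> smooth (fun x y => - f x y).
Proof.
move=> hf; apply: (@smooth_ext (fun x y => - 1 * f x y)) => [x y|]; first by ring.
by apply: smooth_mul => //; apply: smooth_const.
Qed.

Lemma smooth_sub f g : smooth f -> smooth g -> smooth (fun x y => f x y - g x y).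
Proof. by move=> hf hg; apply: smooth_add => //; apply: smooth_opp. Qed.

Lemma smooth_inv f : (forall x y, f x y <> 0) -> smooth f ->
  smooth (fun x y => / f x y).
Proof. by move=> nz hf k; apply: Ck_inv. Qed.

Lemma smooth_comp f g h : smooth f -> smooth g -> smooth h ->
  smooth (fun x y => f (g x y) (h x y)).
Proof. by move=> hf hg hh k; apply: Ck_comp. Qed.

Lemma smooth_cos f : smooth f -> smooth (fun x y => cos (f x y)).
Proof. by move=> hf k; apply: (Ck_cos_sin (hf k)).1. Qed.

Lemma smooth_sin f : smooth f -> smooth (fun x y => sin (f x y)).
Proof. by move=> hf k; apply: (Ck_cos_sin (hf k)).2. Qed.

Lemma smooth_Dx f : smooth f -> smooth (Dx f).
Proof. by move=> hf k; case: (hf k.+1) => _ []. Qed.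

Lemma smooth_Dy f : smooth f -> smooth (Dy f).
Proof. by move=> hf k; case: (hf k.+1) => _ []. Qed.

Lemma smooth_diff f x y : smooth f -> diff2 f x y (Dx f x y) (Dy f x y).
Proof. by move=> hf; apply: (@Ck_diff 0). Qed.

Lemma smooth_cont f x y : smooth f -> continuity_2d_pt f x y.
Proof. by move=> hf; apply: (@Ck_cont 0). Qed.

Lemma smooth_DxDy f x y : smooth f -> Dx (Dy f) x y = Dy (Dx f) x y.
Proof.
move=> hf; apply: Schwarz.
- exists (mkposreal 1 Rlt_0_1) => u v _ _.
  have [_ [h _ _]] := hf 1%N; have [_ [hx _ _]] := smooth_Dx hf 1%N.
  have [_ [hy _ _]] := smooth_Dy hf 1%N.
  by split; [|split; [|split]]; [apply: (h u v).1 | apply: (h u v).2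
    | apply: (hy u v).1 | apply: (hx u v).2].
- exact: (smooth_cont x y (smooth_Dx (smooth_Dy hf))).
- exact: (smooth_cont x y (smooth_Dy (smooth_Dx hf))).
Qed.

Lemma is_derive_0_const (f : R -> R) : (forall t, is_derive f t 0) ->
  forall a b, f a = f b.
Proof.
move=> h a b; case: (Rtotal_order a b) => [lt|[->//|lt]].
- by apply: eq_is_derive lt.
- by symmetry; apply: eq_is_derive lt.
Qed.

Lemma diff2_0_const f : (forall x y, diff2 f x y 0 0) ->
  forall x y x' y', f x y = f x' y'.
Proof.
move=> h x y x' y'.
rewrite (@is_derive_0_const (fun t => f t y) _ x x') => [|t].
  apply: (@is_derive_0_const (fun t => f x' t)) => t.
  exact: diff2_is_derive_y (h _ _).
exact: diff2_is_derive_x (h _ _).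
Qed.

(** Compactness of the square. The local radii become a gauge by choice, with dummy value 1 outside
    the square, and [mono] passes from them to one common lower bound. *)
Lemma compact_uniform (G : R -> R -> R -> Prop) a b :
  (forall d d' x y, d' <= d -> G d x y -> G d' x y) ->
  (forall u v, a <= u <= b -> a <= v <= b -> exists d, 0 < d /\
     forall x y, Rabs (x - u) < d -> Rabs (y - v) < d -> G d x y) ->
  exists d, 0 < d /\ forall x y, a <= x <= b -> a <= y <= b -> G d x y.
Proof.
move=> mono loc.
have loc' : forall u v, exists d : posreal, a <= u <= b -> a <= v <= b ->
    forall x y, Rabs (x - u) < d -> Rabs (y - v) < d -> G d x y.
  move=> u v; case: (classic (a <= u <= b /\ a <= v <= b)) => [[hu hv]|h].
    by have [d [hd H]] := loc u v hu hv; exists (mkposreal d hd).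
  by exists (mkposreal 1 Rlt_0_1) => hu hv; case: h.
pose delta u v := proj1_sig (constructive_indefinite_description _ (loc' u v)).
have hdelta u v := proj2_sig (constructive_indefinite_description _ (loc' u v)).
have [d hd] := compactness_value_2d a b a b delta.
exists d; split; first exact: cond_pos.
move=> x y hx hy; have [u [v [hu [hv [h1 [h2 h3]]]]]] := NNPP _ (hd x y hx hy).
by apply: mono h3 _; apply: hdelta.
Qed.

(** * Doubly periodic functions *)

(** The primitive from 0 vanishes on [0, 1], so its derivative vanishes at interior points. One such
    point suffices, since [periodic_liouville] centres its parallelogram at the point of
    interest. *)
Lemma RInt_eq0_mid (f : R -> R) : (forall x, continuous f x) ->
  (forall x, 0 <= f x) -> RInt f 0 1 = 0 -> f (/ 2) = 0.
Proof.
move=> hc h0 hI.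
have ex a b : ex_RInt f a b by apply: ex_RInt_continuous => z _.
have F0 x : 0 <= x <= 1 -> RInt f 0 x = 0.
  move=> hx.
  have h1 : 0 <= RInt f 0 x by apply: RInt_ge_0 => //; lra.
  have h2 : 0 <= RInt f x 1 by apply: RInt_ge_0 => //; lra.
  have h3 := RInt_Chasles f 0 x 1 (ex _ _) (ex _ _).
  rewrite /plus /= in h3; lra.
have hd : is_derive (fun x => RInt f 0 x) (/ 2) (f (/ 2)).
  apply: is_derive_RInt (hc _); apply: filter_forall => x.
  exact: RInt_correct.
have hd0 : is_derive (fun x => RInt f 0 x) (/ 2) 0.
  apply: (@is_derive_ext_loc _ _ (fun=> 0)); last exact: is_derive_const.
  exists (mkposreal (/ 2) ltac:(lra)) => y /= /Rabs_lt_between' hy.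
  by rewrite F0 //; rewrite /= in hy; lra.
by rewrite -(is_derive_unique _ _ _ hd) (is_derive_unique _ _ _ hd0).
Qed.

Lemma smooth_continuous_y f x y : smooth f -> continuous (fun t => f x t) y.
Proof.
by move=> hf; apply: ex_derive_continuous; eexists; apply: diff2_is_derive_y (smooth_diff _ _ hf).
Qed.

Lemma smooth_ex_RInt f x a b : smooth f -> ex_RInt (fun t => f x t) a b.
Proof. by move=> hf; apply: ex_RInt_continuous => z _; apply: smooth_continuous_y. Qed.

Lemma smooth_is_derive_RInt f x : smooth f ->
  is_derive (fun s => RInt (fun t => f s t) 0 1) x (RInt (fun t => Dx f x t) 0 1).
Proof.
move=> hf; apply: is_derive_RInt_param.
- apply: filter_forall => s t _; eexists.
  exact: diff2_is_derive_x (smooth_diff _ _ hf).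
- by move=> t _; apply: (smooth_cont _ _ (smooth_Dx hf)).
- by apply: filter_forall => s; apply: smooth_ex_RInt.
Qed.

Lemma smooth_continuous_RInt f x : smooth f ->
  continuous (fun s => RInt (fun t => f s t) 0 1) x.
Proof.
by move=> hf; apply: ex_derive_continuous; eexists; apply: smooth_is_derive_RInt.
Qed.

(** Divergence theorem on the torus. The inner integral of [Dx F] is the derivative in [s] of the
    inner integral of [F], so the order of integration is never exchanged. *)
Lemma RInt2_div_eq0 F G : smooth F -> smooth G ->
  (forall t, F 1 t = F 0 t) -> (forall s, G s 1 = G s 0) ->
  RInt (fun s => RInt (fun t => Dx F s t + Dy G s t) 0 1) 0 1 = 0.
Proof.
move=> hF hG pF pG.
have -> : RInt (fun s => RInt (fun t => Dx F s t + Dy G s t) 0 1) 0 1 =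
    RInt (fun s => RInt (fun t => Dx F s t) 0 1) 0 1.
  apply: RInt_ext => s _.
  have -> : RInt (fun t => Dx F s t + Dy G s t) 0 1 =
      RInt (fun t => Dx F s t) 0 1 + RInt (fun t => Dy G s t) 0 1.
    exact: (RInt_plus _ _ _ _ (smooth_ex_RInt s 0 1 (smooth_Dx hF)) (smooth_ex_RInt s 0 1 (smooth_Dy hG))).
  rewrite (@RInt_Derive (fun t => G s t) 0 1) => [|x _|x _].
  - by rewrite pG /=; ring.
  - by eexists; apply: diff2_is_derive_y (smooth_diff _ _ hG).
  - exact (smooth_continuous_y (smooth_Dy hG)).
have h : is_RInt (fun s => RInt (fun t => Dx F s t) 0 1) 0 1
    (minus (RInt (fun t => F 1 t) 0 1) (RInt (fun t => F 0 t) 0 1)).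
  apply: (is_RInt_derive (fun s => RInt (fun t => F s t) 0 1)) => x _.
  - exact: smooth_is_derive_RInt.
  - exact: (smooth_continuous_RInt (smooth_Dx hF)).
rewrite (is_RInt_unique _ _ _ _ h) (RInt_ext (fun t => F 1 t) (fun t => F 0 t)) => [|t _].
  exact: minus_eq_zero.
exact: pF.
Qed.

Section Lattice.
Variables a1 a2 b1 b2 : R.

(** Convertible to [in_lattice T] when (a1, a2) and (b1, b2) are the basis vectors of [T]; rigidity
    can thus be stated for bare numbers. *)
Definition lattice (x y : R) : Prop :=
  exists m n : Z, x = IZR m * a1 + IZR n * b1 /\ y = IZR m * a2 + IZR n * b2.

Definition periodic (f : R -> R -> R) : Prop :=
  forall a b, lattice a b -> forall x y, f (x + a) (y + b) = f x y.

Lemma lattice_fst : lattice a1 a2.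
Proof. by exists (Zpos xH), Z0; split; ring. Qed.

Lemma lattice_snd : lattice b1 b2.
Proof. by exists Z0, (Zpos xH); split; ring. Qed.

Lemma periodic_Dx f : smooth f -> periodic f -> periodic (Dx f).
Proof.
move=> hf pf a b hab x y; symmetry; apply: is_derive_unique.
apply: (is_derive_ext (fun t => f (t + a) (y + b))) => [t|]; first exact: (pf _ _ hab).
have -> : Dx f (x + a) (y + b) = scal 1 (Dx f (x + a) (y + b)) by rewrite /scal /= /mult /=; ring.
apply: (is_derive_comp (fun t => f t (y + b)) (fun t => t + a)).
  exact: diff2_is_derive_x (smooth_diff _ _ hf).
by auto_derive.
Qed.

Lemma periodic_Dy f : smooth f -> periodic f -> periodic (Dy f).
Proof.
move=> hf pf a b hab x y; symmetry; apply: is_derive_unique.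
apply: (is_derive_ext (fun t => f (x + a) (t + b))) => [t|]; first exact: (pf _ _ hab).
have -> : Dy f (x + a) (y + b) = scal 1 (Dy f (x + a) (y + b)) by rewrite /scal /= /mult /=; ring.
apply: (is_derive_comp (fun t => f (x + a) t) (fun t => t + b)).
  exact: diff2_is_derive_y (smooth_diff _ _ hf).
by auto_derive.
Qed.

(** By the two equations, |grad p|^2 = p_y q_x - p_x q_y, up to sign the Jacobian of (p, q). This is
    a divergence, so its integral over a period vanishes, and the integrand is nonnegative. *)
Lemma periodic_liouville p q : a1 * b2 - a2 * b1 <> 0 ->
  smooth p -> smooth q -> periodic p -> periodic q ->
  (forall x y, Dy p x y = Dx q x y) -> (forall x y, Dx p x y = - Dy q x y) ->
  forall x y, Dx p x y = 0 /\ Dy p x y = 0.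
Proof.
move=> nz sp sq pp pq e1 e2 x0 y0.
(* The period parallelogram is placed so that the parameter (1/2, 1/2) hits (x0, y0), where
   [RInt_eq0_mid] reads off the integrand. *)
pose X s t := x0 + ((s - / 2) * a1 + (t - / 2) * b1).
pose Y s t := y0 + ((s - / 2) * a2 + (t - / 2) * b2).
have dX s t : diff2 X s t a1 b1.
  apply: (@diff2_of_partials X (fun _ _ => a1) (fun _ _ => b1)).
  - by move=> u v; rewrite /X; auto_derive => //; ring.
  - by move=> u v; rewrite /X; auto_derive => //; ring.
  - exact: continuity_2d_pt_const.
have dY s t : diff2 Y s t a2 b2.
  apply: (@diff2_of_partials Y (fun _ _ => a2) (fun _ _ => b2)).
  - by move=> u v; rewrite /Y; auto_derive => //; ring.
  - by move=> u v; rewrite /Y; auto_derive => //; ring.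
  - exact: continuity_2d_pt_const.
have affine c d e : smooth (fun s t => c + ((s - / 2) * d + (t - / 2) * e)).
  apply: smooth_add; first exact: smooth_const.
  by apply: smooth_add; apply: smooth_mul; try exact: smooth_const;
    apply: smooth_sub; try exact: smooth_const; [exact: smooth_fst|exact: smooth_snd].
have sX : smooth X := affine _ _ _.
have sY : smooth Y := affine _ _ _.
have dc f s t : smooth f -> diff2 (fun s t => f (X s t) (Y s t)) s t
   (Dx f (X s t) (Y s t) * a1 + Dy f (X s t) (Y s t) * a2)
   (Dx f (X s t) (Y s t) * b1 + Dy f (X s t) (Y s t) * b2).
  move=> hf; apply: differentiable_pt_lim_comp (dX s t) (dY s t).
  exact: smooth_diff.
have sc f : smooth f -> smooth (fun s t => f (X s t) (Y s t)).
  by move=> hf; apply: smooth_comp.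
have per1 f t : periodic f -> f (X 1 t) (Y 1 t) = f (X 0 t) (Y 0 t).
  by move=> hf; rewrite -(hf _ _ lattice_fst (X 0 t)); congr f; rewrite /X /Y; ring.
have per2 f s : periodic f -> f (X s 1) (Y s 1) = f (X s 0) (Y s 0).
  by move=> hf; rewrite -(hf _ _ lattice_snd (X s 0)); congr f; rewrite /X /Y; ring.
pose P s t := p (X s t) (Y s t).
pose Q s t := q (X s t) (Y s t).
have sP : smooth P by apply: sc.
have sQ : smooth Q by apply: sc.
pose F s t := - P s t * Dy Q s t.
pose G s t := P s t * Dx Q s t.
have DxQ s t : Dx Q s t = Dx q (X s t) (Y s t) * a1 + Dy q (X s t) (Y s t) * a2.
  exact: diff2_Dx (dc q s t sq).
have DyQ s t : Dy Q s t = Dx q (X s t) (Y s t) * b1 + Dy q (X s t) (Y s t) * b2.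
  exact: diff2_Dy (dc q s t sq).
have DxP s t : Dx P s t = Dx p (X s t) (Y s t) * a1 + Dy p (X s t) (Y s t) * a2.
  exact: diff2_Dx (dc p s t sp).
have DyP s t : Dy P s t = Dx p (X s t) (Y s t) * b1 + Dy p (X s t) (Y s t) * b2.
  exact: diff2_Dy (dc p s t sp).
have sF : smooth F by apply: smooth_mul; [apply: smooth_opp | apply: smooth_Dy].
have sG : smooth G by apply: smooth_mul => //; apply: smooth_Dx.
pose K x y := Dx p x y * Dx p x y + Dy p x y * Dy p x y.
have sK : smooth K.
  by apply: smooth_add; apply: smooth_mul; (exact: smooth_Dx || exact: smooth_Dy).
have key s t : Dx F s t + Dy G s t = (a1 * b2 - a2 * b1) * K (X s t) (Y s t).
  have dF := diff2_Dx (diff2_mul (smooth_diff s t (smooth_opp sP)) (smooth_diff s t (smooth_Dy sQ))).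
  have dG := diff2_Dy (diff2_mul (smooth_diff s t sP) (smooth_diff s t (smooth_Dx sQ))).
  rewrite dF dG (smooth_DxDy _ _ sQ).
  have -> : Dx (fun x y => - P x y) s t = - Dx P s t.
    rewrite /Dx; exact: Derive_opp.
  rewrite DxQ DyQ DxP DyP /K -!e1.
  have -> : Dy q (X s t) (Y s t) = - Dx p (X s t) (Y s t) by rewrite e2; ring.
  ring.
have I0 : RInt (fun s => RInt (fun t => (a1 * b2 - a2 * b1) * K (X s t) (Y s t)) 0 1) 0 1 = 0.
  rewrite -[RHS](@RInt2_div_eq0 F G) //.
  - by apply: RInt_ext => s _; apply: RInt_ext => t _; rewrite key.
  - by move=> t; rewrite /F /P !DyQ !per1 //; [apply: periodic_Dy | apply: periodic_Dx].
  - by move=> t; rewrite /G /P !DxQ !per2 //; [apply: periodic_Dy | apply: periodic_Dx].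
have sKc : smooth (fun s t => K (X s t) (Y s t)) by apply: sc.
have I1 : RInt (fun s => RInt (fun t => K (X s t) (Y s t)) 0 1) 0 1 = 0.
  apply: (Rmult_eq_reg_l (a1 * b2 - a2 * b1)) => //; rewrite Rmult_0_r -[RHS]I0.
  symmetry; rewrite -[RHS](RInt_scal (fun s => RInt (fun t => K (X s t) (Y s t)) 0 1)).
    by apply: RInt_ext => s _; exact: (RInt_scal _ _ _ _ (smooth_ex_RInt s 0 1 sKc)).
  by apply: ex_RInt_continuous => z _; apply: smooth_continuous_RInt.
have Kpos u v : 0 <= K u v by rewrite /K; nra.
have I2 := RInt_eq0_mid (fun x => smooth_continuous_RInt sKc)
   (fun s => RInt_ge_0 _ 0 1 ltac:(lra) (smooth_ex_RInt s 0 1 sKc) (fun t _ => Kpos _ _)) I1.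
have := RInt_eq0_mid (fun t => smooth_continuous_y sKc) (fun t => Kpos _ _) I2.
have -> : X (/ 2) (/ 2) = x0 by rewrite /X; ring.
have -> : Y (/ 2) (/ 2) = y0 by rewrite /Y; ring.
rewrite /K => h; split; nra.
Qed.

End Lattice.

(** * Finite sums, and differentiability of a continuous inverse *)

Fixpoint rsum (n : nat) (F : nat -> R) : R :=
  if n is n'.+1 then rsum n' F + F n' else 0.

Lemma rsum_ext n F G : (forall i, F i = G i) -> rsum n F = rsum n G.
Proof. by move=> e; elim: n => //= n ->; rewrite e. Qed.

Lemma rsum_scal n c F : rsum n (fun i => c * F i) = c * rsum n F.
Proof. by elim: n => /= [|n ->]; ring. Qed.

Lemma rsum_0 n F : (forall i, F i = 0) -> rsum n F = 0.
Proof. by move=> h; elim: n => //= n ->; rewrite h; ring. Qed.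

Lemma rsum_ge0 n F : (forall i, 0 <= F i) -> 0 <= rsum n F.
Proof. by move=> h; elim: n => /= [|n IH]; [lra | have := h n; lra]. Qed.

Lemma rsum_eq0 n F : (forall i, 0 <= F i) -> rsum n F = 0 ->
  forall i, (i < n)%N -> F i = 0.
Proof.
move=> h; elim: n => //= n IH e i.
have h1 := rsum_ge0 n h; have h2 := h n.
by rewrite ltnS leq_eqVlt => /orP [/eqP ->|]; [lra | apply: IH; lra].
Qed.

Lemma Ck_rsum k n (F : nat -> R -> R -> R) : (forall i, Ck k (F i)) ->
  Ck k (fun x y => rsum n (fun i => F i x y)).
Proof. by move=> h; elim: n => /= [|n IH]; [exact: Ck_const | exact: Ck_add]. Qed.

Lemma smooth_rsum n (F : nat -> R -> R -> R) : (forall i, smooth (F i)) ->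
  smooth (fun x y => rsum n (fun i => F i x y)).
Proof. by move=> h k; apply: Ck_rsum => i; apply: h. Qed.

Lemma diff2_rsum n (F Fx Fy : nat -> R -> R -> R) x y :
  (forall i, diff2 (F i) x y (Fx i x y) (Fy i x y)) ->
  diff2 (fun x y => rsum n (fun i => F i x y)) x y
    (rsum n (fun i => Fx i x y)) (rsum n (fun i => Fy i x y)).
Proof. by move=> h; elim: n => /= [|n IH]; [exact: diff2_const | exact: diff2_add]. Qed.

Lemma Rmax_abs_ge0 a b : 0 <= Rmax (Rabs a) (Rabs b).
Proof. by apply: Rle_trans (Rabs_pos a) (Rmax_l _ _). Qed.

Lemma diff2_lipschitz f x0 y0 a b : diff2 f x0 y0 a b ->
  locally_2d (fun x y => Rabs (f x y - f x0 y0) <=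
    (Rabs a + Rabs b + 1) * Rmax (Rabs (x - x0)) (Rabs (y - y0))) x0 y0.
Proof.
move=> h; have [d hd] := h (mkposreal 1 Rlt_0_1); exists d => x y hx hy.
have := hd x y hx hy => /= {hd}.
set m := Rmax _ _ => hd.
have h1 : Rabs (a * (x - x0)) <= Rabs a * m.
  by rewrite Rabs_mult; apply: Rmult_le_compat_l; [apply: Rabs_pos | apply: Rmax_l].
have h2 : Rabs (b * (y - y0)) <= Rabs b * m.
  by rewrite Rabs_mult; apply: Rmult_le_compat_l; [apply: Rabs_pos | apply: Rmax_r].
move: hd h1 h2.
by do 3![case/Rabs_le_between => ? ?]; apply/Rabs_le_between; lra.
Qed.

(* The easy half of the inverse function theorem: a continuous right inverse of a map
   with invertible differential is automatically differentiable. *)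
Lemma diff2_of_inverse (g1 g2 h1 h2 k1 k2 : R -> R -> R) x0 y0 p1 q1 p2 q2 :
  continuity_2d_pt g1 x0 y0 -> continuity_2d_pt g2 x0 y0 ->
  diff2 h1 (g1 x0 y0) (g2 x0 y0) 1 0 -> diff2 h2 (g1 x0 y0) (g2 x0 y0) 0 1 ->
  diff2 k1 x0 y0 p1 q1 -> diff2 k2 x0 y0 p2 q2 ->
  (forall x y, h1 (g1 x y) (g2 x y) = k1 x y) ->
  (forall x y, h2 (g1 x y) (g2 x y) = k2 x y) ->
  diff2 g1 x0 y0 p1 q1 /\ diff2 g2 x0 y0 p2 q2.
Proof.
move=> cg1 cg2 dh1 dh2 dk1 dk2 e1 e2.
set K := Rmax (Rabs p1 + Rabs q1 + 1) (Rabs p2 + Rabs q2 + 1).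
have Kpos : 0 < K.
  apply: Rlt_le_trans (Rmax_l _ _).
  by have := Rabs_pos p1; have := Rabs_pos q1; lra.
suff main : forall eps : posreal, locally_2d (fun x y =>
   Rabs (g1 x y - g1 x0 y0 - (p1 * (x - x0) + q1 * (y - y0))) <=
     eps * Rmax (Rabs (x - x0)) (Rabs (y - y0)) /\
   Rabs (g2 x y - g2 x0 y0 - (p2 * (x - x0) + q2 * (y - y0))) <=
     eps * Rmax (Rabs (x - x0)) (Rabs (y - y0))) x0 y0.
  by split=> eps; have [d hd] := main eps; exists d => x y hx hy; case: (hd x y hx hy).
move=> eps.
(* The bound 1/2 lets [D] <= K m + D / 2 be solved to [D] <= 2 K m. The other bound then makes the
   error e' D at most (eps / 2) m, the remaining half being left for [k1] and [k2]. *)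
pose e' := Rmin (/ 2) (eps / (4 * K)).
have he'pos : 0 < e'.
  apply: Rmin_pos; first lra.
  by apply: Rdiv_lt_0_compat; [apply: cond_pos | lra].
have he'1 : e' <= / 2 := Rmin_l _ _.
have he'2 : e' * (2 * K) <= eps / 2.
  have h : e' <= eps / (4 * K) := Rmin_r _ _.
  have -> : eps / 2 = eps / (4 * K) * (2 * K) by field; lra.
  by apply: Rmult_le_compat_r => //; lra.
have [d1 H1] := dh1 (mkposreal _ he'pos).
have [d2 H2] := dh2 (mkposreal _ he'pos).
have he2 : 0 < eps / 2 by have := cond_pos eps; lra.
have L1 := dk1 (mkposreal _ he2); have L2 := dk2 (mkposreal _ he2).
have M1 := diff2_lipschitz dk1; have M2 := diff2_lipschitz dk2.
have hd : 0 < Rmin d1 d2 by apply: Rmin_pos; apply: cond_pos.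
have := locally_2d_and _ _ _ _ (locally_2d_and _ _ _ _ L1 L2)
  (locally_2d_and _ _ _ _ (locally_2d_and _ _ _ _ M1 M2)
    (locally_2d_and _ _ _ _ (cg1 (mkposreal _ hd)) (cg2 (mkposreal _ hd)))).
apply: locally_2d_impl; apply: locally_2d_forall => x y.
move=> [[/= A1 A2] [[B1 B2] [C1 C2]]].
have G1 := H1 _ _ (Rlt_le_trans _ _ _ C1 (Rmin_l _ _)) (Rlt_le_trans _ _ _ C2 (Rmin_l _ _)).
have G2 := H2 _ _ (Rlt_le_trans _ _ _ C1 (Rmin_r _ _)) (Rlt_le_trans _ _ _ C2 (Rmin_r _ _)).
move: G1 G2 => /=; rewrite !e1 !e2 => G1 G2 {H1 H2 C1 C2}.
move: A1 A2 B1 B2 G1 G2.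
set m := Rmax (Rabs (x - x0)) _; set D := Rmax (Rabs (g1 x y - _)) _.
move=> A1 A2 B1 B2 G1 G2.
have m0 : 0 <= m by apply: Rmax_abs_ge0.
have D0 : 0 <= D by apply: Rmax_abs_ge0.
have N1 : Rabs (k1 x y - k1 x0 y0) <= K * m.
  by apply: Rle_trans B1 _; apply: Rmult_le_compat_r => //; apply: Rmax_l.
have N2 : Rabs (k2 x y - k2 x0 y0) <= K * m.
  by apply: Rle_trans B2 _; apply: Rmult_le_compat_r => //; apply: Rmax_r.
have hD : e' * D <= / 2 * D by apply: Rmult_le_compat_r.
have P1 : Rabs (g1 x y - g1 x0 y0) <= K * m + / 2 * D.
  by move: N1 G1; do 2![case/Rabs_le_between => ? ?]; apply/Rabs_le_between; lra.
have P2 : Rabs (g2 x y - g2 x0 y0) <= K * m + / 2 * D.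
  by move: N2 G2; do 2![case/Rabs_le_between => ? ?]; apply/Rabs_le_between; lra.
have DK : D <= 2 * K * m by have : D <= K * m + / 2 * D; [apply: Rmax_lub | lra].
have eD : e' * D <= eps / 2 * m.
  apply: (Rle_trans _ (e' * (2 * K * m))); first by apply: Rmult_le_compat_l; lra.
  have -> : e' * (2 * K * m) = e' * (2 * K) * m by ring.
  exact: Rmult_le_compat_r.
split.
- by move: A1 G1; do 2![case/Rabs_le_between => ? ?]; apply/Rabs_le_between; lra.
- by move: A2 G2; do 2![case/Rabs_le_between => ? ?]; apply/Rabs_le_between; lra.
Qed.

Lemma nearest_int (s : R) : {m : Z | - / 2 <= s - IZR m <= / 2}.
Proof. by exists (up (s - / 2)); have := archimed (s - / 2); lra. Qed.

(** * Rigidity of doubly periodic conformal immersions *)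

Lemma rsum_quad n (p q : nat -> R) a b c d :
  rsum n (fun i => (p i * a + q i * b) * (p i * c + q i * d)) =
  a * c * rsum n (fun i => p i * p i) + (a * d + b * c) * rsum n (fun i => p i * q i)
  + b * d * rsum n (fun i => q i * q i).
Proof. by elim: n => /= [|n ->]; ring. Qed.

(* [(a b; c d)] is the Jacobian of a conformal map.  Differentiating the conformality
   relations gives the Cauchy-Riemann equations without choosing an orientation. *)
Lemma conformal_div_free (a b c d : R -> R -> R) :
  smooth a -> smooth b -> smooth c -> smooth d ->
  (forall x y, a x y * a x y + c x y * c x y = b x y * b x y + d x y * d x y) ->
  (forall x y, a x y * b x y + c x y * d x y = 0) ->
  (forall x y, 0 < a x y * a x y + c x y * c x y) ->
  (forall x y, Dy a x y = Dx b x y) -> (forall x y, Dy c x y = Dx d x y) ->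
  forall x y, Dx a x y = - Dy b x y /\ Dx c x y = - Dy d x y.
Proof.
move=> sa sb sc sd e1 e2 pos ea ec x y.
have da := smooth_diff x y sa; have db := smooth_diff x y sb.
have dc := smooth_diff x y sc; have dd := smooth_diff x y sd.
have l1 := diff2_add (diff2_mul da da) (diff2_mul dc dc).
have l2 := diff2_add (diff2_mul db db) (diff2_mul dd dd).
have l3 := diff2_add (diff2_mul da db) (diff2_mul dc dd).
have E1 : (fun x y => a x y * a x y + c x y * c x y) =
          (fun x y => b x y * b x y + d x y * d x y).
  by apply: functional_extensionality => u; apply: functional_extensionality => v.
have E2 : (fun x y => a x y * b x y + c x y * d x y) = (fun _ _ => 0).
  by apply: functional_extensionality => u; apply: functional_extensionality => v.
rewrite E1 in l1; rewrite E2 in l3.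
have l0 := diff2_const 0 x y.
have := diff2_Dx l1; rewrite (diff2_Dx l2) => r1.
have := diff2_Dy l1; rewrite (diff2_Dy l2) => r2.
have := diff2_Dx l3; rewrite (diff2_Dx l0) => r3.
have := diff2_Dy l3; rewrite (diff2_Dy l0) => r4.
move: r1 r2 r3 r4 (e1 x y) (e2 x y) (pos x y); rewrite ea ec.
move: (a x y) (b x y) (c x y) (d x y) => A B C D.
move: (Dx a x y) (Dx b x y) (Dy b x y) (Dx c x y) (Dx d x y) (Dy d x y).
move=> ax bx By cx dx dy r1 r2 r3 r4 f1 f2 f3.
(* The vector of divergences (a_x + b_y, c_x + d_y) is orthogonal to both columns of the Jacobian,
   which span the plane. Each orthogonality combines a derivative of the norm relation with one of
   the orthogonality relation. *)
have h1 : (ax + By) * A + (cx + dy) * C = 0 by lra.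
have h2 : (ax + By) * B + (cx + dy) * D = 0 by lra.
have det : A * D - B * C <> 0.
  move=> h; have : (A * D - B * C) ^ 2 = (A * A + C * C) * (B * B + D * D) - (A * B + C * D) ^ 2 by ring.
  by rewrite h f2 -f1; nra.
have k1 : (ax + By) * (A * D - B * C) = 0.
  have -> : (ax + By) * (A * D - B * C) = D * ((ax + By) * A + (cx + dy) * C) -
     C * ((ax + By) * B + (cx + dy) * D) by ring.
  by rewrite h1 h2; ring.
have k2 : (cx + dy) * (A * D - B * C) = 0.
  have -> : (cx + dy) * (A * D - B * C) = A * ((ax + By) * B + (cx + dy) * D) -
     B * ((ax + By) * A + (cx + dy) * C) by ring.
  by rewrite h1 h2; ring.
case: (Rmult_integral _ _ k1) => // {}k1; case: (Rmult_integral _ _ k2) => // {}k2.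
by split; lra.
Qed.

Section Rigidity.
Variables a1 a2 b1 b2 a1' a2' b1' b2' : R.
Hypothesis nz : a1 * b2 - a2 * b1 <> 0.
Hypothesis nz' : a1' * b2' - a2' * b1' <> 0.
Let Lam := lattice a1 a2 b1 b2.
Let per := periodic a1 a2 b1 b2.
Let per' := periodic a1' a2' b1' b2'.

Variable N : nat.
Variables P Q : nat -> R -> R -> R.
Hypothesis sP : forall i, smooth (P i).
Hypothesis sQ : forall i, smooth (Q i).
Hypothesis pP : forall i, per (P i).
Hypothesis pQ : forall i, per' (Q i).
Let Px i := Dx (P i).
Let Py i := Dy (P i).
Let Qx i := Dx (Q i).
Let Qy i := Dy (Q i).
Let E x y := rsum N (fun i => Px i x y * Px i x y).
Let F x y := rsum N (fun i => Qx i x y * Qx i x y).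
Hypothesis Epos : forall x y, 0 < E x y.
Hypothesis Fpos : forall x y, 0 < F x y.
Hypothesis EP : forall x y, rsum N (fun i => Py i x y * Py i x y) = E x y.
Hypothesis OP : forall x y, rsum N (fun i => Px i x y * Py i x y) = 0.
Hypothesis FQ : forall x y, rsum N (fun i => Qy i x y * Qy i x y) = F x y.
Hypothesis OQ : forall x y, rsum N (fun i => Qx i x y * Qy i x y) = 0.
Hypothesis inj : forall x y x' y',
  (forall i, (i < N)%N -> P i x y = P i x' y') -> Lam (x - x') (y - y').

Let dist2 x y x' y' :=
  rsum N (fun i => (P i x y - P i x' y') * (P i x y - P i x' y')).

Lemma lattice_coords s t : Lam (s * a1 + t * b1) (s * a2 + t * b2) ->
  exists m n : Z, s = IZR m /\ t = IZR n.
Proof.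
move=> [m [n [h1 h2]]]; exists m, n; split; apply: (Rmult_eq_reg_r _ _ _ _ nz).
- have -> : s * (a1 * b2 - a2 * b1) = (s * a1 + t * b1) * b2 - (s * a2 + t * b2) * b1 by ring.
  by rewrite h1 h2; ring.
- have -> : t * (a1 * b2 - a2 * b1) = (s * a2 + t * b2) * a1 - (s * a1 + t * b1) * a2 by ring.
  by rewrite h1 h2; ring.
Qed.

(** Injectivity modulo the lattice made quantitative. On the square |s|, |t| <= 1/2 the distance
    vanishes only at integral (s, t), hence only at 0; away from 0 it is bounded below by
    compactness. *)
Lemma embedding_modulus u v eps : 0 < eps -> exists d, 0 < d /\
  forall s t, - / 2 <= s <= / 2 -> - / 2 <= t <= / 2 ->
    dist2 (u + (s * a1 + t * b1)) (v + (s * a2 + t * b2)) u v < d ->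
    Rabs s < eps /\ Rabs t < eps.
Proof.
move=> heps.
pose D s t := dist2 (u + (s * a1 + t * b1)) (v + (s * a2 + t * b2)) u v.
have sD : smooth D.
  have aff c d e : smooth (fun s t => c + (s * d + t * e)).
    apply: smooth_add; first exact: smooth_const.
    by apply: smooth_add; apply: smooth_mul; try exact: smooth_const;
      [exact: smooth_fst|exact: smooth_snd].
  apply: (@smooth_rsum N (fun i s t =>
     (P i (u + (s * a1 + t * b1)) (v + (s * a2 + t * b2)) - P i u v) *
     (P i (u + (s * a1 + t * b1)) (v + (s * a2 + t * b2)) - P i u v))) => i.
  have sPi : smooth (fun s t => P i (u + (s * a1 + t * b1)) (v + (s * a2 + t * b2)) - P i u v).
    apply: smooth_sub; last exact: smooth_const.
    exact: smooth_comp (sP i) (aff _ _ _) (aff _ _ _).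
  exact: smooth_mul.
have D0 s t : 0 <= D s t by apply: rsum_ge0 => i; apply: Rle_0_sqr.
pose G d s t := (Rabs s < eps /\ Rabs t < eps) \/ d <= D s t.
have [d [hd H]] : exists d, 0 < d /\
    forall s t, - / 2 <= s <= / 2 -> - / 2 <= t <= / 2 -> G d s t.
  apply: compact_uniform; first by move=> d d' s t le [?|?]; [left | right; lra].
  move=> s t hs ht; case: (Rle_lt_or_eq_dec _ _ (D0 s t)) => [pos|zero].
  - have hD2 : 0 < D s t / 2 by lra.
    have [d hd] := smooth_cont s t sD (mkposreal _ hD2).
    exists (Rmin d (D s t / 2)); split; first by apply: Rmin_pos => //; apply: cond_pos.
    move=> x y hx hy; right; apply: (Rle_trans _ _ _ (Rmin_r _ _)).
    have := hd x y (Rlt_le_trans _ _ _ hx (Rmin_l _ _)) (Rlt_le_trans _ _ _ hy (Rmin_l _ _)).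
    by move=> /= /Rabs_lt_between; lra.
  - exists eps; split=> //.
    have hP i : (i < N)%N -> P i (u + (s * a1 + t * b1)) (v + (s * a2 + t * b2)) = P i u v.
      move=> hi; have := @rsum_eq0 N _ (fun j => Rle_0_sqr _) (esym zero) i hi.
      by move/Rsqr_0_uniq => h; lra.
    have := inj hP.
    have -> : u + (s * a1 + t * b1) - u = s * a1 + t * b1 by ring.
    have -> : v + (s * a2 + t * b2) - v = s * a2 + t * b2 by ring.
    move/lattice_coords => [m [n [em en]]].
    have m0 : m = Z0 by apply: one_IZR_lt1; lra.
    have n0 : n = Z0 by apply: one_IZR_lt1; lra.
    by rewrite em en m0 n0 => x y; rewrite !Rminus_0_r => ? ?; left.
by exists d; split=> // s t hs ht lt; case: (H s t hs ht) => // ge; rewrite /D in ge; lra.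
Qed.

(** No regularity is assumed: the pair comes from choice and may jump by lattice vectors from point
    to point. The jumps disappear in lattice-periodic functions. *)
Variables W1 W2 : R -> R -> R.
Hypothesis PW : forall i x y, P i (W1 x y) (W2 x y) = Q i x y.

(** The expected Jacobian of [W]: in dQ = dP A the two columns of dP are orthogonal with squared
    norm [E], so A is found by pairing with them. Since [Px], [Py] and [E] are periodic, the result
    does not see the jumps of [W]. *)
Let A11 x y := rsum N (fun i => Px i (W1 x y) (W2 x y) * Qx i x y) * / E (W1 x y) (W2 x y).
Let A12 x y := rsum N (fun i => Px i (W1 x y) (W2 x y) * Qy i x y) * / E (W1 x y) (W2 x y).
Let A21 x y := rsum N (fun i => Py i (W1 x y) (W2 x y) * Qx i x y) * / E (W1 x y) (W2 x y).
Let A22 x y := rsum N (fun i => Py i (W1 x y) (W2 x y) * Qy i x y) * / E (W1 x y) (W2 x y).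

(** Rounding the lattice coordinates of [W] - (u0, v0) to nearest integers and subtracting them
    keeps the parameter in one period cell around (u0, v0). There [embedding_modulus] gives
    continuity at (x0, y0), and [diff2_of_inverse] gives differentiability. *)
Lemma local_lift x0 y0 : exists g1 g2 : R -> R -> R,
  [/\ forall x y, Lam (W1 x y - g1 x y) (W2 x y - g2 x y),
      g1 x0 y0 = W1 x0 y0 /\ g2 x0 y0 = W2 x0 y0,
      diff2 g1 x0 y0 (A11 x0 y0) (A12 x0 y0)
    & diff2 g2 x0 y0 (A21 x0 y0) (A22 x0 y0)].
Proof.
set u0 := W1 x0 y0; set v0 := W2 x0 y0.
pose D := a1 * b2 - a2 * b1.
have nzD : D <> 0 := nz.
pose s x y := ((W1 x y - u0) * b2 - (W2 x y - v0) * b1) / D.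
pose t x y := (a1 * (W2 x y - v0) - a2 * (W1 x y - u0)) / D.
pose m x y := proj1_sig (nearest_int (s x y)).
pose n x y := proj1_sig (nearest_int (t x y)).
pose s' x y := s x y - IZR (m x y).
pose t' x y := t x y - IZR (n x y).
pose g1 x y := u0 + (s' x y * a1 + t' x y * b1).
pose g2 x y := v0 + (s' x y * a2 + t' x y * b2).
have W1E x y : W1 x y = u0 + (s x y * a1 + t x y * b1) by rewrite /s /t /D; field.
have W2E x y : W2 x y = v0 + (s x y * a2 + t x y * b2) by rewrite /s /t /D; field.
have hs' x y : - / 2 <= s' x y <= / 2 := proj2_sig (nearest_int (s x y)).
have ht' x y : - / 2 <= t' x y <= / 2 := proj2_sig (nearest_int (t x y)).
have gW x y : Lam (W1 x y - g1 x y) (W2 x y - g2 x y).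
  exists (m x y), (n x y); rewrite W1E W2E /g1 /g2 /s' /t'; split; ring.
have Pg i x y : P i (g1 x y) (g2 x y) = Q i x y.
  rewrite -PW -(pP i (gW x y) (g1 x y) (g2 x y)); congr P; ring.
have s0 : s' x0 y0 = 0.
  have := hs' x0 y0; rewrite /s'; have -> : s x0 y0 = 0 by rewrite /s /u0 /v0; field.
  by move=> h; rewrite (one_IZR_lt1 (m x0 y0)); lra.
have t0 : t' x0 y0 = 0.
  have := ht' x0 y0; rewrite /t'; have -> : t x0 y0 = 0 by rewrite /t /u0 /v0; field.
  by move=> h; rewrite (one_IZR_lt1 (n x0 y0)); lra.
have g10 : g1 x0 y0 = u0 by rewrite /g1 s0 t0; ring.
have g20 : g2 x0 y0 = v0 by rewrite /g2 s0 t0; ring.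
have cst eps : 0 < eps -> locally_2d (fun x y => Rabs (s' x y) < eps /\ Rabs (t' x y) < eps) x0 y0.
  move=> he; have [d [hd H]] := embedding_modulus u0 v0 he.
  pose R0 x y := rsum N (fun i => (Q i x y - Q i x0 y0) * (Q i x y - Q i x0 y0)).
  have sR : smooth R0.
    apply: (@smooth_rsum N (fun i x y => (Q i x y - Q i x0 y0) * (Q i x y - Q i x0 y0))) => i.
    by apply: smooth_mul; apply: smooth_sub => //; apply: smooth_const.
  have R00 : R0 x0 y0 = 0.
    have -> : R0 x0 y0 = rsum N (fun i => 0 * 0) by apply: rsum_ext => i; ring.
    by rewrite rsum_scal; ring.
  have := smooth_cont x0 y0 sR (mkposreal _ hd).
  apply: locally_2d_impl; apply: locally_2d_forall => x y /=; rewrite R00 => /Rabs_lt_between hR.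
  apply: H => //; rewrite -/(g1 x y) -/(g2 x y) /dist2.
  rewrite (@rsum_ext N _ (fun i => (Q i x y - Q i x0 y0) * (Q i x y - Q i x0 y0))) => [|i].
    by rewrite /R0 in hR; lra.
  by rewrite Pg -g10 -g20 Pg.
have cs : continuity_2d_pt s' x0 y0.
  move=> eps; have := cst eps (cond_pos eps).
  by apply: locally_2d_impl; apply: locally_2d_forall => x y [h _]; rewrite s0 Rminus_0_r.
have ct : continuity_2d_pt t' x0 y0.
  move=> eps; have := cst eps (cond_pos eps).
  by apply: locally_2d_impl; apply: locally_2d_forall => x y [_ h]; rewrite t0 Rminus_0_r.
have cg1 : continuity_2d_pt g1 x0 y0.
  apply: continuity_2d_pt_plus; first exact: continuity_2d_pt_const.
  by apply: continuity_2d_pt_plus; apply: continuity_2d_pt_mult => //; apply: continuity_2d_pt_const.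
have cg2 : continuity_2d_pt g2 x0 y0.
  apply: continuity_2d_pt_plus; first exact: continuity_2d_pt_const.
  by apply: continuity_2d_pt_plus; apply: continuity_2d_pt_mult => //; apply: continuity_2d_pt_const.
(* Coordinates of the orthogonal projection onto the tangent plane of [P] at (u0, v0). Applied to
   [P] they have the identity as differential there; applied to [Q] they have the matrix A as
   differential at (x0, y0). *)
pose H c (S : nat -> R -> R -> R) (x y : R) := rsum N (fun i => c i * S i x y) * / E u0 v0.
have dH c S x y : (forall i, smooth (S i)) -> diff2 (H c S) x y
    (rsum N (fun i => c i * Dx (S i) x y) * / E u0 v0) (rsum N (fun i => c i * Dy (S i) x y) * / E u0 v0).
  move=> hS.
  have h := diff2_mul (@diff2_rsum N (fun i x y => c i * S i x y) (fun i x y => c i * Dx (S i) x y)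
    (fun i x y => c i * Dy (S i) x y) x y _) (diff2_const (/ E u0 v0) x y).
  have e f : forall r, f * / E u0 v0 + r * 0 = f * / E u0 v0 by move=> r; ring.
  rewrite -[X in diff2 _ _ _ X _](e _ (rsum N (fun i => c i * S i x y))).
  rewrite -[X in diff2 _ _ _ _ X](e _ (rsum N (fun i => c i * S i x y))).
  apply: h => i.
  have -> : c i * Dx (S i) x y = 0 * S i x y + c i * Dx (S i) x y by ring.
  have -> : c i * Dy (S i) x y = 0 * S i x y + c i * Dy (S i) x y by ring.
  apply: diff2_mul; first exact: diff2_const.
  exact: smooth_diff.
have Enz : E u0 v0 <> 0 by have := Epos u0 v0; lra.
have [d1 d2] : diff2 g1 x0 y0 (A11 x0 y0) (A12 x0 y0) /\ diff2 g2 x0 y0 (A21 x0 y0) (A22 x0 y0).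
  apply: (@diff2_of_inverse g1 g2 (H (fun i => Px i u0 v0) P) (H (fun i => Py i u0 v0) P)
    (H (fun i => Px i u0 v0) Q) (H (fun i => Py i u0 v0) Q)) => //.
  - rewrite g10 g20; have := dH (fun i => Px i u0 v0) P u0 v0 sP.
    rewrite -/(E u0 v0) -/(Py _) OP.
    by rewrite Rmult_0_l Rinv_r.
  - rewrite g10 g20; have := dH (fun i => Py i u0 v0) P u0 v0 sP.
    rewrite EP (@rsum_ext N (fun i => Py i u0 v0 * Dx (P i) u0 v0) (fun i => Px i u0 v0 * Py i u0 v0)) ?OP.
      by rewrite Rmult_0_l Rinv_r.
    by move=> i; rewrite /Px; ring.
  - exact: dH.
  - exact: dH.
  - by move=> x y; rewrite /H; congr (_ * _); apply: rsum_ext => i; rewrite Pg.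
  - by move=> x y; rewrite /H; congr (_ * _); apply: rsum_ext => i; rewrite Pg.
by exists g1, g2.
Qed.

(** A periodic [f] cannot distinguish [W] from the branch of [local_lift] based at (x, y), so the
    chain rule for that branch applies. *)
Lemma diff2_lift f x y : smooth f -> per f ->
  diff2 (fun x y => f (W1 x y) (W2 x y)) x y
    (Dx f (W1 x y) (W2 x y) * A11 x y + Dy f (W1 x y) (W2 x y) * A21 x y)
    (Dx f (W1 x y) (W2 x y) * A12 x y + Dy f (W1 x y) (W2 x y) * A22 x y).
Proof.
move=> hf pf; have [g1 [g2 [gW [e1 e2] d1 d2]]] := local_lift x y.
apply: (@differentiable_pt_lim_ext (fun x y => f (g1 x y) (g2 x y))).
  apply: locally_2d_forall => u v.
  by rewrite -(pf _ _ (gW u v) (g1 u v) (g2 u v)); congr f; ring.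
rewrite -e1 -e2; apply: differentiable_pt_lim_comp d1 d2.
exact: smooth_diff.
Qed.

Lemma smooth_E : smooth E.
Proof.
apply: (@smooth_rsum N (fun i x y => Px i x y * Px i x y)) => i.
by apply: smooth_mul; apply: smooth_Dx.
Qed.

Lemma per_E : per E.
Proof.
move=> a b hab x y; apply: rsum_ext => i.
by have -> : Px i (x + a) (y + b) = Px i x y by exact: (periodic_Dx (sP i) (pP i) hab).
Qed.

Let Einv x y := / E x y.

Lemma smooth_Einv : smooth Einv.
Proof. by apply: smooth_inv; [move=> x y; have := Epos x y; lra | exact: smooth_E]. Qed.

Lemma per_Einv : per Einv.
Proof. by move=> a b hab x y; rewrite /Einv per_E. Qed.

Lemma Ck_lift_coef k (p : nat -> R -> R -> R) (q : nat -> R -> R -> R) :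
  (forall f, smooth f -> per f -> Ck k (fun x y => f (W1 x y) (W2 x y))) ->
  (forall i, smooth (p i)) -> (forall i, per (p i)) -> (forall i, smooth (q i)) ->
  Ck k (fun x y => rsum N (fun i => p i (W1 x y) (W2 x y) * q i x y) * Einv (W1 x y) (W2 x y)).
Proof.
move=> IH hp pp hq; apply: Ck_mul; last by apply: IH; [exact: smooth_Einv|exact: per_Einv].
apply: (@Ck_rsum k N (fun i x y => p i (W1 x y) (W2 x y) * q i x y)) => i.
by apply: Ck_mul; [apply: IH | apply: hq].
Qed.

(** Bootstrap on the order, for all [f] at once: the derivatives given by [diff2_lift] are again
    built from periodic smooth functions composed with [W] and from derivatives of [Q]. *)
Lemma smooth_lift f : smooth f -> per f -> smooth (fun x y => f (W1 x y) (W2 x y)).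
Proof.
move=> hf pf k; elim: k f hf pf => [|k IH] f hf pf.
  by split=> // x y; apply: diff2_cont (diff2_lift x y hf pf).
have h p q := @Ck_lift_coef k p q IH.
have sx i := smooth_Dx (sP i); have sy i := smooth_Dy (sP i).
have ppx i := periodic_Dx (sP i) (pP i); have ppy i := periodic_Dy (sP i) (pP i).
have qx i := smooth_Dx (sQ i); have qy i := smooth_Dy (sQ i).
apply: (Ck_succ (fun x y => diff2_lift x y hf pf)).
- apply: Ck_add; apply: Ck_mul; try exact: h.
  + by apply: IH; [apply: smooth_Dx | apply: periodic_Dx].
  + by apply: IH; [apply: smooth_Dy | apply: periodic_Dy].
- apply: Ck_add; apply: Ck_mul; try exact: h.
  + by apply: IH; [apply: smooth_Dx | apply: periodic_Dx].
  + by apply: IH; [apply: smooth_Dy | apply: periodic_Dy].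
Qed.

Let sx i : smooth (Px i) := smooth_Dx (sP i).
Let sy i : smooth (Py i) := smooth_Dy (sP i).
Let ppx i : per (Px i) := periodic_Dx (sP i) (pP i).
Let ppy i : per (Py i) := periodic_Dy (sP i) (pP i).
Let qx i : smooth (Qx i) := smooth_Dx (sQ i).
Let qy i : smooth (Qy i) := smooth_Dy (sQ i).

Let sA p q : (forall i, smooth (p i)) -> (forall i, per (p i)) -> (forall i, smooth (q i)) ->
  smooth (fun x y => rsum N (fun i => p i (W1 x y) (W2 x y) * q i x y) * Einv (W1 x y) (W2 x y)).
Proof. by move=> hp pp hq k; apply: Ck_lift_coef => // f sf pf; apply: smooth_lift. Qed.

Let sA11 : smooth A11 := sA sx ppx qx.
Let sA12 : smooth A12 := sA sx ppx qy.
Let sA21 : smooth A21 := sA sy ppy qx.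
Let sA22 : smooth A22 := sA sy ppy qy.

Let Qdiff i x y : diff2 (Q i) x y
    (Px i (W1 x y) (W2 x y) * A11 x y + Py i (W1 x y) (W2 x y) * A21 x y)
    (Px i (W1 x y) (W2 x y) * A12 x y + Py i (W1 x y) (W2 x y) * A22 x y).
Proof.
have -> : Q i = (fun x y => P i (W1 x y) (W2 x y)).
  by apply: functional_extensionality => u; apply: functional_extensionality => v; rewrite PW.
exact: diff2_lift.
Qed.

Let QxE i x y : Qx i x y = Px i (W1 x y) (W2 x y) * A11 x y + Py i (W1 x y) (W2 x y) * A21 x y.
Proof. exact: diff2_Dx (Qdiff i x y). Qed.

Let QyE i x y : Qy i x y = Px i (W1 x y) (W2 x y) * A12 x y + Py i (W1 x y) (W2 x y) * A22 x y.
Proof. exact: diff2_Dy (Qdiff i x y). Qed.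

Lemma conf_factor x y :
  F x y = E (W1 x y) (W2 x y) * (A11 x y * A11 x y + A21 x y * A21 x y) /\
  F x y = E (W1 x y) (W2 x y) * (A12 x y * A12 x y + A22 x y * A22 x y) /\
  0 = E (W1 x y) (W2 x y) * (A11 x y * A12 x y + A21 x y * A22 x y).
Proof.
have eq a b c d := @rsum_quad N (fun i => Px i (W1 x y) (W2 x y)) (fun i => Py i (W1 x y) (W2 x y)) a b c d.
split; [|split].
- rewrite /F; under rsum_ext do rewrite QxE; rewrite eq EP OP -/(E _ _); ring.
- rewrite -FQ; under rsum_ext do rewrite QyE; rewrite eq EP OP -/(E _ _); ring.
- rewrite -(OQ x y); under rsum_ext do rewrite QxE QyE; rewrite eq EP OP -/(E _ _); ring.
Qed.

(** Equality of the mixed derivatives of [Q i], expanded by the chain rule, cancels all second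
    derivatives of [P i] by their own symmetry. What remains is a combination of [Px i] and [Py i]
    that vanishes for every i, and these two vectors are independent. *)
Lemma curl_free x y : Dy A11 x y = Dx A12 x y /\ Dy A21 x y = Dx A22 x y.
Proof.
set w1 := W1 x y; set w2 := W2 x y.
have key i : Px i w1 w2 * (Dy A11 x y - Dx A12 x y) + Py i w1 w2 * (Dy A21 x y - Dx A22 x y) = 0.
  have lx := diff2_lift x y (sx i) (ppx i); have ly := diff2_lift x y (sy i) (ppy i).
  have d1 := diff2_add (diff2_mul lx (smooth_diff x y sA11)) (diff2_mul ly (smooth_diff x y sA21)).
  have d2 := diff2_add (diff2_mul lx (smooth_diff x y sA12)) (diff2_mul ly (smooth_diff x y sA22)).
  have e1 : Qx i = (fun x y => Px i (W1 x y) (W2 x y) * A11 x y + Py i (W1 x y) (W2 x y) * A21 x y).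
    by apply: functional_extensionality => u; apply: functional_extensionality => v; rewrite QxE.
  have e2 : Qy i = (fun x y => Px i (W1 x y) (W2 x y) * A12 x y + Py i (W1 x y) (W2 x y) * A22 x y).
    by apply: functional_extensionality => u; apply: functional_extensionality => v; rewrite QyE.
  have := smooth_DxDy x y (sQ i); rewrite -/(Qx i) -/(Qy i).
  rewrite e1 (diff2_Dy d1) e2 (diff2_Dx d2) -/w1 -/w2.
  have := smooth_DxDy w1 w2 (sP i); rewrite -/(Px i) -/(Py i) => -> h.
  lra.
have Ep : 0 < E w1 w2 := Epos _ _.
have quad a b c d := @rsum_quad N (fun i => Px i w1 w2) (fun i => Py i w1 w2) a b c d.
split.
- have : rsum N (fun i => (Px i w1 w2 * 1 + Py i w1 w2 * 0) *
     (Px i w1 w2 * (Dy A11 x y - Dx A12 x y) + Py i w1 w2 * (Dy A21 x y - Dx A22 x y))) = 0.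
    by apply: rsum_0 => i; rewrite key; ring.
  by rewrite quad EP OP -/(E _ _) => h; nra.
- have : rsum N (fun i => (Px i w1 w2 * 0 + Py i w1 w2 * 1) *
     (Px i w1 w2 * (Dy A11 x y - Dx A12 x y) + Py i w1 w2 * (Dy A21 x y - Dx A22 x y))) = 0.
    by apply: rsum_0 => i; rewrite key; ring.
  by rewrite quad EP OP -/(E _ _) => h; nra.
Qed.

(** A period of [Q] leaves the image point fixed, so by injectivity it moves [W] by a period of
    [P]. *)
Lemma per'_lift_coef (p q : nat -> R -> R -> R) :
  (forall i, per (p i)) -> (forall i, per' (q i)) ->
  per' (fun x y => rsum N (fun i => p i (W1 x y) (W2 x y) * q i x y) * / E (W1 x y) (W2 x y)).
Proof.
move=> pp pq a b hab x y.
have hW : Lam (W1 (x + a) (y + b) - W1 x y) (W2 (x + a) (y + b) - W2 x y).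
  by apply: inj => i _; rewrite !PW pQ.
have shift f : per f -> f (W1 (x + a) (y + b)) (W2 (x + a) (y + b)) = f (W1 x y) (W2 x y).
  by move=> pf; rewrite -(pf _ _ hW (W1 x y) (W2 x y)); congr f; ring.
rewrite (shift E per_E); congr (_ * _); apply: rsum_ext => i.
by rewrite (shift _ (pp i)) pq.
Qed.

Lemma lift_linear : exists a b c d : R, forall x y,
  [/\ A11 x y = a, A12 x y = b, A21 x y = c & A22 x y = d].
Proof.
have qpx i : per' (Qx i) := periodic_Dx (sQ i) (pQ i).
have qpy i : per' (Qy i) := periodic_Dy (sQ i) (pQ i).
have cf x y : A11 x y * A11 x y + A21 x y * A21 x y = A12 x y * A12 x y + A22 x y * A22 x y.
  have [h1 [h2 _]] := conf_factor x y; have := Epos (W1 x y) (W2 x y).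
  by move=> h; apply: (Rmult_eq_reg_l (E (W1 x y) (W2 x y))); lra.
have co x y : A11 x y * A12 x y + A21 x y * A22 x y = 0.
  have [_ [_ h]] := conf_factor x y; have := Epos (W1 x y) (W2 x y).
  by move=> h'; apply: (Rmult_eq_reg_l (E (W1 x y) (W2 x y))); lra.
have cp x y : 0 < A11 x y * A11 x y + A21 x y * A21 x y.
  have [h1 _] := conf_factor x y; have h2 := Epos (W1 x y) (W2 x y); have := Fpos x y.
  by rewrite h1 => h; nra.
have c1 x y : Dy A11 x y = Dx A12 x y by case: (curl_free x y).
have c2 x y : Dy A21 x y = Dx A22 x y by case: (curl_free x y).
have df := conformal_div_free sA11 sA12 sA21 sA22 cf co cp c1 c2.
have L1 := periodic_liouville nz' sA11 sA12 (per'_lift_coef ppx qpx) (per'_lift_coef ppx qpy)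
  c1 (fun x y => (df x y).1).
have L2 := periodic_liouville nz' sA21 sA22 (per'_lift_coef ppy qpx) (per'_lift_coef ppy qpy)
  c2 (fun x y => (df x y).2).
have const f : smooth f -> (forall x y, Dx f x y = 0 /\ Dy f x y = 0) -> forall x y, f x y = f 0 0.
  move=> sf h x y; apply: diff2_0_const => u v.
  by have := smooth_diff u v sf; case: (h u v) => -> ->.
exists (A11 0 0), (A12 0 0), (A21 0 0), (A22 0 0) => x y; split; apply: const => // u v.
- have [h1 h2] := L1 u v; have [h3 _] := df u v; rewrite -c1 h2; split=> //; lra.
- have [h1 h2] := L2 u v; have [_ h3] := df u v; rewrite -c2 h2; split=> //; lra.
Qed.

Lemma lift_affine u0 v0 : (forall i, (i < N)%N -> P i u0 v0 = Q i 0 0) ->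
  exists a b c d : R, [/\ a * a + c * c = b * b + d * d, a * b + c * d = 0,
    forall x y, F x y = E (a * x + b * y + u0) (c * x + d * y + v0) * (a * a + c * c)
  & forall x y i, P i (a * x + b * y + u0) (c * x + d * y + v0) = Q i x y].
Proof.
move=> base; have [a [b [c [d hA]]]] := lift_linear.
have hL x y : Lam (W1 x y - (a * x + b * y + u0)) (W2 x y - (c * x + d * y + v0)).
  have -> : W1 x y - (a * x + b * y + u0) = (W1 x y - (a * x + b * y)) - u0 by ring.
  have -> : W2 x y - (c * x + d * y + v0) = (W2 x y - (c * x + d * y)) - v0 by ring.
  apply: inj => i hi; rewrite (base i hi) -PW.
  (* [W] minus its linear part need not be continuous. Seen through the periodic [P i] it is
     differentiable with zero derivative, hence constant, and injectivity turns this back into an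
     equality modulo the lattice. *)
  pose Psi x y := P i (W1 x y - (a * x + b * y)) (W2 x y - (c * x + d * y)).
  rewrite -/(Psi x y) (@diff2_0_const Psi _ x y 0 0).
    by rewrite /Psi; congr P; ring.
  move=> {hi}x {}y; have [g1 [g2 [gW [e1 e2] d1 d2]]] := local_lift x y.
  case: (hA x y) d1 d2 => -> -> -> -> d1 d2.
  apply: (@differentiable_pt_lim_ext
    (fun x y => P i (g1 x y - (a * x + b * y)) (g2 x y - (c * x + d * y)))).
    apply: locally_2d_forall => u v; rewrite /Psi.
    by rewrite -(pP i (gW u v) (g1 u v - (a * u + b * v))); congr P; ring.
  have lin p q : diff2 (fun x y => - 1 * (p * x + q * y)) x y (- 1 * p) (- 1 * q).
    apply: (@diff2_of_partials _ (fun _ _ => - 1 * p) (fun _ _ => - 1 * q)) => [u v|u v|].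
    - by auto_derive => //; ring.
    - by auto_derive => //; ring.
    - exact: continuity_2d_pt_const.
  have k1 := diff2_add d1 (lin a b); have k2 := diff2_add d2 (lin c d).
  have := differentiable_pt_lim_comp _ _ _ _ _ _ _ _ _ _ _ (smooth_diff _ _ (sP i)) k1 k2.
  match goal with |- diff2 _ _ _ ?u ?v -> _ =>
    have -> : u = 0 by ring end.
  match goal with |- diff2 _ _ _ _ ?v -> _ => have -> : v = 0 by ring end.
  apply: differentiable_pt_lim_ext; apply: locally_2d_forall => u v; congr P; ring.
have shift f x y : per f -> f (W1 x y) (W2 x y) = f (a * x + b * y + u0) (c * x + d * y + v0).
  move=> pf; rewrite -(pf _ _ (hL x y) (a * x + b * y + u0) (c * x + d * y + v0)).
  by congr f; ring.
exists a, b, c, d; split.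
- have [h1 [h2 _]] := conf_factor 0 0; have := Epos (W1 0 0) (W2 0 0).
  case: (hA 0 0) h1 h2 => -> -> -> -> h1 h2 h.
  by apply: (Rmult_eq_reg_l (E (W1 0 0) (W2 0 0))); lra.
- have [_ [_ h]] := conf_factor 0 0; have := Epos (W1 0 0) (W2 0 0).
  case: (hA 0 0) h => -> -> -> -> h1 h.
  by apply: (Rmult_eq_reg_l (E (W1 0 0) (W2 0 0))); lra.
- move=> x y; have [h _] := conf_factor x y; rewrite h (shift E) //; last exact: per_E.
  by case: (hA x y) => -> _ -> _.
- by move=> x y i; rewrite -PW shift.
Qed.
End Rigidity.

(** * Complex-valued functions and the Hermitian product *)

Lemma cReD (z w : Cplx) : complex.Re (z + w)%R = complex.Re z + complex.Re w.
Proof. by case: z => ? ?; case: w. Qed.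
Lemma cImD (z w : Cplx) : complex.Im (z + w)%R = complex.Im z + complex.Im w.
Proof. by case: z => ? ?; case: w. Qed.
Lemma cReM (z w : Cplx) : complex.Re (z * w)%R =
  complex.Re z * complex.Re w - complex.Im z * complex.Im w.
Proof. by case: z => ? ?; case: w. Qed.
Lemma cImM (z w : Cplx) : complex.Im (z * w)%R =
  complex.Re z * complex.Im w + complex.Im z * complex.Re w.
Proof. by case: z => ? ?; case: w. Qed.
Lemma cReC (z : Cplx) : complex.Re (conjC z) = complex.Re z.
Proof. by case: z. Qed.
Lemma cImC (z : Cplx) : complex.Im (conjC z) = - complex.Im z.
Proof. by case: z. Qed.
Lemma cRe1 : complex.Re (1%R : Cplx) = 1. Proof. by []. Qed.
Lemma cIm1 : complex.Im (1%R : Cplx) = 0. Proof. by []. Qed.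
Lemma cRe0 : complex.Re (0%R : Cplx) = 0. Proof. by []. Qed.
Lemma cIm0 : complex.Im (0%R : Cplx) = 0. Proof. by []. Qed.
Lemma cR_mul (s t : R) : cR (s * t) = (cR s * cR t)%R.
Proof. by rewrite /GRing.mul /= /mulc; congr Complex; rewrite /GRing.mul /GRing.add /GRing.opp /=; ring. Qed.
Lemma cplx_ext (z w : Cplx) :
  complex.Re z = complex.Re w -> complex.Im z = complex.Im w -> z = w.
Proof. by case: z => ? ?; case: w => ? ? /= -> ->. Qed.

Definition cdiff (f : R -> R -> Cplx) x y (a b : Cplx) :=
  diff2 (fun u v => complex.Re (f u v)) x y (complex.Re a) (complex.Re b) /\
  diff2 (fun u v => complex.Im (f u v)) x y (complex.Im a) (complex.Im b).

Definition csmooth (f : R -> R -> Cplx) :=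
  smooth (fun u v => complex.Re (f u v)) /\ smooth (fun u v => complex.Im (f u v)).

Lemma cdiff_unique f x y a b a' b' : cdiff f x y a b -> cdiff f x y a' b' ->
  a = a' /\ b = b'.
Proof.
move=> [h1 h2] [h3 h4]; split; apply: cplx_ext.
- by rewrite -(diff2_Dx h1) (diff2_Dx h3).
- by rewrite -(diff2_Dx h2) (diff2_Dx h4).
- by rewrite -(diff2_Dy h1) (diff2_Dy h3).
- by rewrite -(diff2_Dy h2) (diff2_Dy h4).
Qed.

Lemma cdiff_ext f g x y a b : (forall u v, f u v = g u v) -> cdiff f x y a b -> cdiff g x y a b.
Proof.
move=> e; suff -> : f = g by [].
by apply: functional_extensionality => u; apply: functional_extensionality => v.
Qed.

Lemma csmooth_ext f g : (forall u v, f u v = g u v) -> csmooth f -> csmooth g.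
Proof.
move=> e; suff -> : f = g by [].
by apply: functional_extensionality => u; apply: functional_extensionality => v.
Qed.

Lemma diff2_ext f g x y a b a' b' : (forall u v, f u v = g u v) -> a = a' -> b = b' ->
  diff2 f x y a b -> diff2 g x y a' b'.
Proof.
move=> e <- <-; suff -> : f = g by [].
by apply: functional_extensionality => u; apply: functional_extensionality => v.
Qed.

Lemma diff2_sub f g x y a b c d : diff2 f x y a b -> diff2 g x y c d ->
  diff2 (fun u v => f u v - g u v) x y (a - c) (b - d).
Proof.
move=> hf hg; have := diff2_add hf (diff2_mul (diff2_const (- 1) x y) hg).
by apply: diff2_ext => *; ring.
Qed.

Lemma cdiff_const c x y : cdiff (fun _ _ => c) x y 0%R 0%R.
Proof. by split; apply: diff2_const. Qed.

Lemma cdiff_add f g x y a b c d : cdiff f x y a b -> cdiff g x y c d ->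
  cdiff (fun u v => (f u v + g u v)%R) x y (a + c)%R (b + d)%R.
Proof.
move=> [h1 h2] [h3 h4]; split; rewrite ?cReD ?cImD.
- by apply: diff2_ext (diff2_add h1 h3) => // u v; rewrite cReD.
- by apply: diff2_ext (diff2_add h2 h4) => // u v; rewrite cImD.
Qed.

Lemma cdiff_mul f g x y a b c d : cdiff f x y a b -> cdiff g x y c d ->
  cdiff (fun u v => (f u v * g u v)%R) x y (a * g x y + f x y * c)%R
     (b * g x y + f x y * d)%R.
Proof.
move=> [h1 h2] [h3 h4]; split; rewrite ?(cReD, cImD, cReM, cImM).
- by apply: diff2_ext (diff2_sub (diff2_mul h1 h3) (diff2_mul h2 h4)) => [u v||]; rewrite ?cReM //; ring.
- by apply: diff2_ext (diff2_add (diff2_mul h1 h4) (diff2_mul h2 h3)) => [u v||]; rewrite ?cImM //; ring.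
Qed.

Lemma cdiff_conj f x y a b : cdiff f x y a b ->
  cdiff (fun u v => conjC (f u v)) x y (conjC a) (conjC b).
Proof.
move=> [h1 h2]; split; rewrite ?(cReC, cImC).
- by apply: diff2_ext h1 => // u v; rewrite cReC.
- by apply: diff2_ext (diff2_mul (diff2_const (- 1) x y) h2) => [u v||]; rewrite ?cImC; ring.
Qed.

Lemma cdiff_sum (I : Type) (s : seq I) (f : I -> R -> R -> Cplx) x y a b :
  (forall i, cdiff (f i) x y (a i) (b i)) ->
  cdiff (fun u v => \sum_(i <- s) f i u v)%R x y (\sum_(i <- s) a i)%R (\sum_(i <- s) b i)%R.
Proof.
move=> h; elim: s => [|i s IH].
  by rewrite !big_nil; apply: cdiff_ext (cdiff_const 0%R x y) => u v; rewrite big_nil.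
by rewrite !big_cons; apply: cdiff_ext (cdiff_add (h i) IH) => u v; rewrite big_cons.
Qed.

Lemma csmooth_const c : csmooth (fun _ _ => c).
Proof. by split; apply: smooth_const. Qed.

Lemma csmooth_add f g : csmooth f -> csmooth g -> csmooth (fun u v => (f u v + g u v)%R).
Proof.
move=> [h1 h2] [h3 h4]; split.
- by apply: smooth_ext (smooth_add h1 h3) => u v; rewrite cReD.
- by apply: smooth_ext (smooth_add h2 h4) => u v; rewrite cImD.
Qed.

Lemma csmooth_mul f g : csmooth f -> csmooth g -> csmooth (fun u v => (f u v * g u v)%R).
Proof.
move=> [h1 h2] [h3 h4]; split.
- by apply: smooth_ext (smooth_sub (smooth_mul h1 h3) (smooth_mul h2 h4)) => u v; rewrite cReM.
- by apply: smooth_ext (smooth_add (smooth_mul h1 h4) (smooth_mul h2 h3)) => u v; rewrite cImM.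
Qed.

Lemma csmooth_sum (I : Type) (s : seq I) (f : I -> R -> R -> Cplx) :
  (forall i, csmooth (f i)) -> csmooth (fun u v => \sum_(i <- s) f i u v)%R.
Proof.
move=> h; elim: s => [|i s IH].
  by apply: csmooth_ext (csmooth_const 0%R) => u v; rewrite big_nil.
by apply: csmooth_ext (csmooth_add (h i) IH) => u v; rewrite big_cons.
Qed.

Lemma cdiff_comp f g h x y a b g1 g2 h1 h2 :
  cdiff f (g x y) (h x y) a b -> diff2 g x y g1 g2 -> diff2 h x y h1 h2 ->
  cdiff (fun u v => f (g u v) (h u v)) x y (cR g1 * a + cR h1 * b)%R (cR g2 * a + cR h2 * b)%R.
Proof.
move=> [ha hb] hg hh; split.
- by apply: diff2_ext (differentiable_pt_lim_comp _ _ _ _ _ _ _ _ _ _ _ ha hg hh) => // ;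
    rewrite cReD !cReM /=; ring.
- by apply: diff2_ext (differentiable_pt_lim_comp _ _ _ _ _ _ _ _ _ _ _ hb hg hh) => // ;
    rewrite cImD !cImM /=; ring.
Qed.

Lemma csmooth_comp f g h : csmooth f -> smooth g -> smooth h ->
  csmooth (fun u v => f (g u v) (h u v)).
Proof.
by move=> [h1 h2] hg hh; split; [apply: (smooth_comp h1) | apply: (smooth_comp h2)].
Qed.

Lemma cdiff_0_const f : (forall x y, cdiff f x y 0%R 0%R) -> forall x y x' y', f x y = f x' y'.
Proof.
move=> h x y x' y'; apply: cplx_ext.
- by apply: (@diff2_0_const (fun x y => complex.Re (f x y))) => u v; case: (h u v).
- by apply: (@diff2_0_const (fun x y => complex.Im (f x y))) => u v; case: (h u v).
Qed.

Definition vdiff (r : R -> R -> C3) x y (a b : C3) :=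
  forall j, cdiff (fun u v => r u v 0%R j) x y (a 0%R j) (b 0%R j).

Lemma vdiff_D3 r x y a b : vdiff r x y a b -> D3 Dx r x y = a /\ D3 Dy r x y = b.
Proof.
move=> h; split; apply/rowP => j; rewrite mxE; case: (h j) => h1 h2.
- by apply: cplx_ext; rewrite /= ?(diff2_Dx h1) ?(diff2_Dx h2).
- by apply: cplx_ext; rewrite /= ?(diff2_Dy h1) ?(diff2_Dy h2).
Qed.

Lemma smooth3_vdiff r x y : smooth3 r -> vdiff r x y (D3 Dx r x y) (D3 Dy r x y).
Proof. by move=> h j; have [h1 h2] := h j; split; rewrite !mxE /=; apply: smooth_diff. Qed.

Lemma vdiff_mulmx r x y a b (U : 'M[Cplx]_3) : vdiff r x y a b ->
  vdiff (fun u v => r u v *m U) x y (a *m U) (b *m U).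
Proof.
move=> h j; rewrite !mxE.
apply: (@cdiff_ext (fun u v => \sum_k r u v 0 k * U k j)%R) => [u v|]; first by rewrite mxE.
apply: cdiff_sum => k; have := cdiff_mul (h k) (cdiff_const (U k j) x y).
by rewrite !mulr0 !addr0.
Qed.

Lemma smooth3_mulmx r (U : 'M[Cplx]_3) : smooth3 r -> smooth3 (fun u v => r u v *m U).
Proof.
move=> h j; apply: (@csmooth_ext (fun u v => \sum_k r u v 0 k * U k j)%R) => [u v|].
  by rewrite mxE.
by apply: csmooth_sum => k; apply: csmooth_mul; [apply: h | apply: csmooth_const].
Qed.

Lemma vdiff_comp r g h x y a b g1 g2 h1 h2 :
  vdiff r (g x y) (h x y) a b -> diff2 g x y g1 g2 -> diff2 h x y h1 h2 ->
  vdiff (fun u v => r (g u v) (h u v)) x y (cR g1 *: a + cR h1 *: b)%R (cR g2 *: a + cR h2 *: b)%R.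
Proof. by move=> hr hg hh j; rewrite !mxE; apply: (cdiff_comp (hr j) hg hh). Qed.

Lemma smooth3_comp r g h : smooth3 r -> smooth g -> smooth h ->
  smooth3 (fun u v => r (g u v) (h u v)).
Proof. by move=> hr hg hh j; apply: (csmooth_comp (hr j) hg hh). Qed.

Lemma dotmx_sum (u v : C3) : dotmx u v = (\sum_j u 0 j * conjC (v 0 j))%R.
Proof. by rewrite dotmxE mxE; apply: eq_bigr => j _; rewrite !mxE. Qed.

Lemma cdiff_dotmx r s x y a b c d : vdiff r x y a b -> vdiff s x y c d ->
  cdiff (fun u v => dotmx (r u v) (s u v)) x y (dotmx a (s x y) + dotmx (r x y) c)%R
    (dotmx b (s x y) + dotmx (r x y) d)%R.
Proof.
move=> hr hs; rewrite !dotmx_sum -!big_split /=.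
apply: (@cdiff_ext (fun u v => \sum_j r u v 0 j * conjC (s u v 0 j))%R) => [u v|].
  by rewrite dotmx_sum.
by apply: cdiff_sum => j; apply: (cdiff_mul (hr j) (cdiff_conj (hs j))).
Qed.

Lemma dotmx_mulmx (u v : C3) (U : 'M[Cplx]_3) : U \is unitarymx ->
  dotmx (u *m U) (v *m U) = dotmx u v.
Proof.
move=> hU; rewrite !dotmxE trmx_mul map_mxM mulmxA -(mulmxA u).
by rewrite (unitarymxP hU) mulmx1.
Qed.

Lemma dotmxZZ (c d : Cplx) (u v : C3) :
  dotmx (c *: u)%R (d *: v)%R = (c * conjC d * dotmx u v)%R.
Proof.
rewrite !dotmx_sum mulr_sumr; apply: eq_bigr => j _.
by rewrite !mxE rmorphM /= mulrACA.
Qed.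

Lemma dotmx_linl (p q : Cplx) (u v w : C3) :
  dotmx (p *: u + q *: v)%R w = (p * dotmx u w + q * dotmx v w)%R.
Proof.
rewrite !dotmx_sum !mulr_sumr -big_split /=; apply: eq_bigr => j _.
by rewrite !mxE mulrDl !mulrA.
Qed.

Lemma dotmx_lin0 (p q : Cplx) (u v w : C3) : dotmx u w = 0%R -> dotmx v w = 0%R ->
  dotmx (p *: u + q *: v)%R w = 0%R.
Proof. by move=> hu hv; rewrite dotmx_linl hu hv !mulr0 addr0. Qed.

(** * Lines of C^3 as projections *)

Lemma sum3E (V : nmodType) (f : 'I_3 -> V) :
  (\sum_(j < 3) f j = f (inord 0) + f (inord 1) + f (inord 2))%R.
Proof.
rewrite !big_ord_recl big_ord0 addr0 addrA.
by congr (_ + _ + _)%R; congr f; apply: val_inj; rewrite /= inordK.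
Qed.

Lemma ord3P (P : 'I_3 -> Prop) : P (inord 0) -> P (inord 1) -> P (inord 2) -> forall j, P j.
Proof.
move=> h0 h1 h2 j; rewrite -(inord_val j).
by case: j => [[|[|[|k]]] hk].
Qed.

Lemma dotmx3E (u v : C3) : dotmx u v = (u 0 (inord 0) * conjC (v 0 (inord 0)) +
  u 0 (inord 1) * conjC (v 0 (inord 1)) + u 0 (inord 2) * conjC (v 0 (inord 2)))%R.
Proof. by rewrite dotmx_sum sum3E. Qed.

Lemma cRe_dotmx (u v : C3) : complex.Re (dotmx u v) =
  complex.Re (u 0%R (inord 0)) * complex.Re (v 0%R (inord 0)) +
  complex.Im (u 0%R (inord 0)) * complex.Im (v 0%R (inord 0)) +
  (complex.Re (u 0%R (inord 1)) * complex.Re (v 0%R (inord 1)) +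
   complex.Im (u 0%R (inord 1)) * complex.Im (v 0%R (inord 1))) +
  (complex.Re (u 0%R (inord 2)) * complex.Re (v 0%R (inord 2)) +
   complex.Im (u 0%R (inord 2)) * complex.Im (v 0%R (inord 2))) :> R.
Proof. by rewrite dotmx3E 2!cReD 3!cReM 3!cReC 3!cImC; ring. Qed.

Lemma cIm_dotmx (u v : C3) : complex.Im (dotmx u v) =
  complex.Im (u 0%R (inord 0)) * complex.Re (v 0%R (inord 0)) -
  complex.Re (u 0%R (inord 0)) * complex.Im (v 0%R (inord 0)) +
  (complex.Im (u 0%R (inord 1)) * complex.Re (v 0%R (inord 1)) -
   complex.Re (u 0%R (inord 1)) * complex.Im (v 0%R (inord 1))) +
  (complex.Im (u 0%R (inord 2)) * complex.Re (v 0%R (inord 2)) -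
   complex.Re (u 0%R (inord 2)) * complex.Im (v 0%R (inord 2))) :> R.
Proof. by rewrite dotmx3E 2!cImD 3!cImM 3!cReC 3!cImC; ring. Qed.

Lemma cnorm1P (c : Cplx) : (c * conjC c = 1)%R <-> complex.Re c ^ 2 + complex.Im c ^ 2 = 1.
Proof.
split=> [h|h].
- have := congr1 (@complex.Re R) h; rewrite cReM cReC cImC cRe1 => h'.
  by rewrite -[RHS]h'; ring.
- apply: cplx_ext; rewrite ?(cReM, cImM) cReC cImC ?cRe1 ?cIm1; last by ring.
  by rewrite -[RHS]h; ring.
Qed.

Lemma hopf_scale (c : Cplx) (u : C3) : c != 0%R -> hopf (c *: u)%R = hopf u.
Proof.
move=> c0; apply/eqP; rewrite eqEsubv; apply/andP; split.
- by rewrite -memvE memvZ ?memv_line.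
- by rewrite -memvE -[X in X \in _](scalerK c0) memvZ ?memv_line.
Qed.

Lemma hopf_eqP (u v : C3) : dotmx u u = 1%R -> dotmx v v = 1%R ->
  hopf u = hopf v <-> exists2 c : Cplx, (c * conjC c = 1)%R & v = (c *: u)%R.
Proof.
move=> hu hv; split=> [e|[c hc ->]].
- have /vlineP [c vc] : v \in hopf u by rewrite e memv_line.
  by exists c => //; move: hv; rewrite vc dotmxZZ hu mulr1.
- rewrite hopf_scale //; apply/eqP => c0.
  by move: hc; rewrite c0 mul0r => /esym/eqP; rewrite oner_eq0.
Qed.

Lemma move_hopf (U : 'M[Cplx]_3) u : move U (hopf u) = hopf (u *m U).
Proof. by rewrite /move /hopf limg_line lfunE. Qed.

(* The 18 real coordinates of the projection matrix u^* u, constant on each line: entry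
   (i / 6, i / 2 mod 3), its imaginary part for odd i. *)
Definition hcoord (u : C3) (i : nat) : R :=
  let z := (u 0%R (inord (i %/ 6)) * conjC (u 0%R (inord (i %/ 2 %% 3))))%R in
  if odd i then complex.Im z else complex.Re z.

Definition dhcoord (u a : C3) (i : nat) : R :=
  let z := (a 0%R (inord (i %/ 6)) * conjC (u 0%R (inord (i %/ 2 %% 3))) +
            u 0%R (inord (i %/ 6)) * conjC (a 0%R (inord (i %/ 2 %% 3))))%R in
  if odd i then complex.Im z else complex.Re z.

Lemma hcoord_prod u v : (forall i, (i < 18)%N -> hcoord u i = hcoord v i) ->
  forall j k, (u 0 j * conjC (u 0 k) = v 0 j * conjC (v 0 k))%R.
Proof.
move=> h j k; have hj := ltn_ord j; have hk := ltn_ord k.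
have e1 : ((6 * j + 2 * k) %/ 6 = j)%N by lia.
have e2 : ((6 * j + 2 * k) %/ 2 %% 3 = k)%N by lia.
have e3 : ((6 * j + 2 * k).+1 %/ 6 = j)%N by lia.
have e4 : ((6 * j + 2 * k).+1 %/ 2 %% 3 = k)%N by lia.
have o1 : odd (6 * j + 2 * k) = false by lia.
apply: cplx_ext.
- have := h (6 * j + 2 * k)%N; rewrite /hcoord e1 e2 o1 !inord_val; apply; lia.
- have := h (6 * j + 2 * k).+1; rewrite /hcoord e3 e4 /= o1 !inord_val; apply; lia.
Qed.

Lemma hcoord_hopf u v : dotmx u u = 1%R -> dotmx v v = 1%R ->
  hopf u = hopf v <-> forall i, (i < 18)%N -> hcoord u i = hcoord v i.
Proof.
move=> hu hv; split.
- move/(hopf_eqP hu hv) => [c hc ->] i _; rewrite /hcoord !mxE rmorphM /=.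
  by rewrite mulrACA hc mul1r.
- move/hcoord_prod => h; apply/(hopf_eqP hu hv).
  (* A unit vector is fixed by its own projection; the two projections agree, so [v] is fixed by the
     projection onto [u]. *)
  have e : v = (dotmx v u *: u)%R.
    apply/rowP => k; rewrite mxE dotmx_sum mulr_suml.
    rewrite -[LHS]mul1r -hv dotmx_sum mulr_suml; apply: eq_bigr => j _.
    by rewrite -!mulrA !(mulrC (conjC _)) h.
  exists (dotmx v u) => //.
  by move: hv; rewrite {1 2}e dotmxZZ hu mulr1.
Qed.

Lemma hcoord_scale (c : Cplx) u i : (c * conjC c = 1)%R -> hcoord (c *: u) i = hcoord u i.
Proof. by move=> hc; rewrite /hcoord !mxE rmorphM /= mulrACA hc mul1r. Qed.

Lemma smooth_hcoord r i : smooth3 r -> smooth (fun x y => hcoord (r x y) i).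
Proof.
move=> h.
have sm j k : csmooth (fun x y => r x y 0 j * conjC (r x y 0 k))%R.
  apply: csmooth_mul; first exact: h.
  have [h1 h2] := h k; split.
  - by apply: smooth_ext h1 => x y; rewrite cReC.
  - by apply: smooth_ext (smooth_opp h2) => x y; rewrite cImC.
by rewrite /hcoord; case: (odd i); case: (sm (inord (i %/ 6)) (inord (i %/ 2 %% 3))).
Qed.

Lemma diff2_hcoord r x y a b i : vdiff r x y a b ->
  diff2 (fun x y => hcoord (r x y) i) x y (dhcoord (r x y) a i) (dhcoord (r x y) b i).
Proof.
move=> h; have := cdiff_mul (h (inord (i %/ 6))) (cdiff_conj (h (inord (i %/ 2 %% 3)))).
by rewrite /hcoord /dhcoord; case: (odd i) => -[].
Qed.

(** For a unit vector [u] and [a], [b] orthogonal to it, the right side is 2 Re <a, b>: the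
    embedding by projection matrices doubles the Fubini-Study metric. This is the origin of 4 e^v in
    [hcoord_metric]. *)
Lemma rsum_dhcoord u a b : rsum 18 (fun i => dhcoord u a i * dhcoord u b i) =
  2 * (complex.Re (dotmx a b) * complex.Re (dotmx u u) +
       (complex.Re (dotmx a u) * complex.Re (dotmx b u) -
        complex.Im (dotmx a u) * complex.Im (dotmx b u))) +
  2 * complex.Im (dotmx a b) * complex.Im (dotmx u u).
Proof.
set L := rsum _ _.
(* The real and imaginary parts of the four products are traded for polynomials in the coordinates,
   leaving an identity in 18 real variables for [ring]. *)
have := cRe_dotmx a b; generalize (complex.Re (dotmx a b)) => ? ->.
have := cIm_dotmx a b; generalize (complex.Im (dotmx a b)) => ? ->.
have := cRe_dotmx u u; generalize (complex.Re (dotmx u u)) => ? ->.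
have := cIm_dotmx u u; generalize (complex.Im (dotmx u u)) => ? ->.
have := cRe_dotmx a u; generalize (complex.Re (dotmx a u)) => ? ->.
have := cIm_dotmx a u; generalize (complex.Im (dotmx a u)) => ? ->.
have := cRe_dotmx b u; generalize (complex.Re (dotmx b u)) => ? ->.
have := cIm_dotmx b u; generalize (complex.Im (dotmx b u)) => ? ->.
rewrite {}/L.
pose X (c : C3) j k := complex.Re (c 0%R (inord j)) * complex.Re (u 0%R (inord k)) +
  complex.Im (c 0%R (inord j)) * complex.Im (u 0%R (inord k)) +
  complex.Re (u 0%R (inord j)) * complex.Re (c 0%R (inord k)) +
  complex.Im (u 0%R (inord j)) * complex.Im (c 0%R (inord k)).
pose Y (c : C3) j k := complex.Im (c 0%R (inord j)) * complex.Re (u 0%R (inord k)) -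
  complex.Re (c 0%R (inord j)) * complex.Im (u 0%R (inord k)) +
  complex.Im (u 0%R (inord j)) * complex.Re (c 0%R (inord k)) -
  complex.Re (u 0%R (inord j)) * complex.Im (c 0%R (inord k)).
pose G j k (e : bool) := if e then Y a j k * Y b j k else X a j k * X b j k.
have -> : rsum 18 (fun i => dhcoord u a i * dhcoord u b i) =
  rsum 18 (fun i => G (i %/ 6)%N (i %/ 2 %% 3)%N (odd i)).
  apply: rsum_ext => i; rewrite /dhcoord /G; case: (odd i).
    by rewrite /Y !cImD !cImM !cReC !cImC; ring.
  by rewrite /X !cReD !cReM !cReC !cImC; ring.
have -> : rsum 18 (fun i => G (i %/ 6)%N (i %/ 2 %% 3)%N (odd i)) =
   0 + G 0%N 0%N false + G 0%N 0%N true + G 0%N 1%N false + G 0%N 1%N true + G 0%N 2%N false + G 0%N 2%N true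
   + G 1%N 0%N false + G 1%N 0%N true + G 1%N 1%N false + G 1%N 1%N true + G 1%N 2%N false + G 1%N 2%N true
   + G 2%N 0%N false + G 2%N 0%N true + G 2%N 1%N false + G 2%N 1%N true + G 2%N 2%N false + G 2%N 2%N true.
  reflexivity.
rewrite /G /X /Y.
move: (inord 0) (inord 1) (inord 2) => j0 j1 j2.
set A0 := complex.Re (a 0%R j0); set A1 := complex.Re (a 0%R j1); set A2 := complex.Re (a 0%R j2).
set B0 := complex.Re (b 0%R j0); set B1 := complex.Re (b 0%R j1); set B2 := complex.Re (b 0%R j2).
set U0 := complex.Re (u 0%R j0); set U1 := complex.Re (u 0%R j1); set U2 := complex.Re (u 0%R j2).
set A0' := complex.Im (a 0%R j0); set A1' := complex.Im (a 0%R j1); set A2' := complex.Im (a 0%R j2).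
set B0' := complex.Im (b 0%R j0); set B1' := complex.Im (b 0%R j1); set B2' := complex.Im (b 0%R j2).
set U0' := complex.Im (u 0%R j0); set U1' := complex.Im (u 0%R j1); set U2' := complex.Im (u 0%R j2).
ring.
Qed.

Lemma dotmx_conj (u v : C3) : dotmx u v = conjC (dotmx v u).
Proof.
rewrite !dotmx_sum rmorph_sum; apply: eq_bigr => j _.
by rewrite rmorphM /= conjCK mulrC.
Qed.

Lemma hopf_hcoord u v : dotmx u u = 1%R -> dotmx v v = 1%R -> hopf u = hopf v ->
  forall i, hcoord u i = hcoord v i.
Proof. by move=> hu hv /(hopf_eqP hu hv) [c hc ->] i; rewrite hcoord_scale. Qed.

(** * Horizontal lifts, and rigidity applied to Lagrangian tori *)

Definition horizontal (r : R -> R -> C3) : Prop :=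
  smooth3 r /\ forall x y, [/\ dotmx (r x y) (r x y) = 1%R,
    dotmx (D3 Dx r x y) (r x y) = 0%R & dotmx (D3 Dy r x y) (r x y) = 0%R].

(** The phase is <s, r>. Both terms of its derivative, <s_x, r> and <s, r_x>, vanish because [s] and
    [r] are proportional and each is orthogonal to its own derivatives. *)
Lemma horizontal_lift_unique r s : horizontal r -> horizontal s ->
  (forall x y, hopf (r x y) = hopf (s x y)) ->
  exists2 c : Cplx, (c * conjC c = 1)%R & forall x y, s x y = (c *: r x y)%R.
Proof.
move=> [sr hr] [ss hs] e.
have sc x y : exists2 c : Cplx, (c * conjC c = 1)%R & s x y = (c *: r x y)%R.
  by apply/hopf_eqP => //; [case: (hr x y) | case: (hs x y)].
have rE x y (c : Cplx) : s x y = (c *: r x y)%R -> dotmx (s x y) (r x y) = c.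
  move=> ->; case: (hr x y) => h _ _.
  by rewrite -[X in dotmx _ X]scale1r dotmxZZ h conjC1 !mulr1.
have cst : forall x y x' y', dotmx (s x y) (r x y) = dotmx (s x' y') (r x' y').
  apply: cdiff_0_const => x y.
  have := cdiff_dotmx (smooth3_vdiff x y ss) (smooth3_vdiff x y sr).
  have [c hc hsr] := sc x y; case: (hr x y) => h1 h2 h3; case: (hs x y) => k1 k2 k3.
  have z1 d : dotmx d (r x y) = 0%R -> dotmx (s x y) d = 0%R.
    move=> h; rewrite hsr -[X in dotmx _ X]scale1r dotmxZZ dotmx_conj h conjC0.
    by rewrite mulr0.
  have rs : r x y = (conjC c *: s x y)%R.
    by rewrite hsr scalerA mulrC hc scale1r.
  have z2 d : dotmx d (s x y) = 0%R -> dotmx d (r x y) = 0%R.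
    by move=> h; rewrite rs -[X in dotmx X _]scale1r dotmxZZ h mulr0.
  by rewrite (z1 _ h2) (z1 _ h3) (z2 _ k2) (z2 _ k3) addr0.
have [c hc h0] := sc 0 0; exists c => // x y.
have [c' _ h] := sc x y.
rewrite {1}h; congr (_ *: _)%R.
exact: etrans (esym (rE x y c' h)) (etrans (cst x y 0 0) (rE 0 0 c h0)).
Qed.

Lemma lagrangian_horizontal T : lagrangian_torus T -> horizontal (lift T).
Proof.
case=> [[sr _]] _ _ h _; split=> // x y.
by case: (h x y) => h1 [h2 h3 _] _ _.
Qed.

Section TorusMetric.
Variable T : torus_data.
Hypothesis hT : lagrangian_torus T.
Let r := lift T.
Let P i x y := hcoord (r x y) i.

Let sr : smooth3 r. Proof. by case: hT => [[]]. Qed.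

Let dP i x y : diff2 (P i) x y (dhcoord (r x y) (D3 Dx r x y) i) (dhcoord (r x y) (D3 Dy r x y) i).
Proof. exact: (diff2_hcoord i (smooth3_vdiff x y sr)). Qed.

Lemma hcoord_periodic i : periodic (w11 T) (w12 T) (w21 T) (w22 T) (P i).
Proof.
move=> a b hab x y; case: hT => _ _ hp hm _.
apply: hopf_hcoord; last exact: hp.
- by case: (hm (x + a) (y + b)).
- by case: (hm x y).
Qed.

Lemma hcoord_metric x y :
  [/\ rsum 18 (fun i => Dx (P i) x y * Dx (P i) x y) = 4 * exp (conf T x y),
      rsum 18 (fun i => Dy (P i) x y * Dy (P i) x y) = 4 * exp (conf T x y)
    & rsum 18 (fun i => Dx (P i) x y * Dy (P i) x y) = 0].
Proof.
case: hT => _ _ _ /(_ x y) [h0 [h1 h2 h3] h4 h5] _.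
have ex i := diff2_Dx (dP i x y); have ey i := diff2_Dy (dP i x y).
split.
- under rsum_ext do rewrite ex.
  by rewrite rsum_dhcoord -/r h0 h1 h4 cRe1 cIm1 cRe0 cIm0 /=; ring.
- under rsum_ext do rewrite ey.
  by rewrite rsum_dhcoord -/r h0 h2 h5 cRe1 cIm1 cRe0 cIm0 /=; ring.
- under rsum_ext do rewrite ex ey.
  by rewrite rsum_dhcoord -/r h0 h1 h2 h3 cRe1 cIm1 cRe0 cIm0; ring.
Qed.
End TorusMetric.

(** [T'] only has to take values in [S], so the result covers both a second parametrization of [S]
    and the image of [T] under an isometry preserving [S]. The base point (u0, v0) fixes the
    translation part. *)
Lemma torus_rigidity T T' S u0 v0 : parametrizes T S -> lagrangian_torus T' ->
  (forall x y, S (hopf (lift T' x y))) -> hopf (lift T u0 v0) = hopf (lift T' 0 0) ->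
  exists a b c d : R, [/\ a * a + c * c = b * b + d * d, a * b + c * d = 0,
    forall x y, exp (conf T' x y) =
      exp (conf T (a * x + b * y + u0) (c * x + d * y + v0)) * (a * a + c * c)
  & forall x y, hopf (lift T (a * x + b * y + u0) (c * x + d * y + v0)) = hopf (lift T' x y)].
Proof.
move=> [hT hS hinj] hT' sub base.
have unit x y : dotmx (lift T x y) (lift T x y) = 1%R by case: (lagrangian_horizontal hT) => _ /(_ x y) [].
have unit' x y : dotmx (lift T' x y) (lift T' x y) = 1%R by case: (lagrangian_horizontal hT') => _ /(_ x y) [].
have hW : forall x y, exists w : R * R, hopf (lift T w.1 w.2) = hopf (lift T' x y).
  by move=> x y; have /hS [u [v e]] := sub x y; exists (u, v).
pose W x y := proj1_sig (constructive_indefinite_description _ (hW x y)).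
have WE x y : hopf (lift T (W x y).1 (W x y).2) = hopf (lift T' x y).
  exact: (proj2_sig (constructive_indefinite_description _ (hW x y))).
have nz w1 w2 w3 w4 : Rabs (w1 * w4 - w2 * w3) <> 0 -> w1 * w4 - w2 * w3 <> 0.
  by move=> h h'; apply: h; rewrite h' Rabs_R0.
have nzT : w11 T * w22 T - w12 T * w21 T <> 0 by case: hT => _ h *; apply: nz h.
have nzT' : w11 T' * w22 T' - w12 T' * w21 T' <> 0 by case: hT' => _ h *; apply: nz h.
have sr : smooth3 (lift T) by case: hT => [[]].
have sr' : smooth3 (lift T') by case: hT' => [[]].
have m := hcoord_metric hT; have m' := hcoord_metric hT'.
have pos x y : 0 < 4 * exp (conf T x y) by have := exp_pos (conf T x y); lra.
have pos' x y : 0 < 4 * exp (conf T' x y) by have := exp_pos (conf T' x y); lra.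
have [a [b [c [d [h1 h2 h3 h4]]]]] := @lift_affine (w11 T) (w12 T) (w21 T) (w22 T)
   (w11 T') (w12 T') (w21 T') (w22 T') nzT
   nzT' 18
   (fun i x y => hcoord (lift T x y) i) (fun i x y => hcoord (lift T' x y) i)
   (fun i => smooth_hcoord i sr) (fun i => smooth_hcoord i sr')
   (hcoord_periodic hT) (hcoord_periodic hT')
   ltac:(by move=> x y; case: (m x y) => -> _ _)
   ltac:(by move=> x y; case: (m' x y) => -> _ _)
   ltac:(by move=> x y; case: (m x y) => -> ->)
   ltac:(by move=> x y; case: (m x y))
   ltac:(by move=> x y; case: (m' x y) => -> ->)
   ltac:(by move=> x y; case: (m' x y))
   ltac:(by move=> x y x' y' h; apply: hinj; apply/hcoord_hopf)
   (fun x y => (W x y).1) (fun x y => (W x y).2)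
   ltac:(by move=> i x y; apply: hopf_hcoord)
   u0 v0
   ltac:(by move=> i _; apply: hopf_hcoord).
exists a, b, c, d; split=> //.
- move=> x y; have := h3 x y.
  by case: (m' x y) => -> _ _; case: (m (a * x + b * y + u0) (c * x + d * y + v0)) => -> _ _; lra.
- by move=> x y; apply/hcoord_hopf => // i _; apply: h4.
Qed.

(** The linear map and its inverse have integer matrices in the lattice bases. Their determinants
    are integers with product 1, hence both are 1 or both -1. *)
Lemma lattice_index_one a1 a2 b1 b2 a1' a2' b1' b2' a b c d :
  a1 * b2 - a2 * b1 <> 0 -> a * d - b * c <> 0 ->
  (forall x y, lattice a1' a2' b1' b2' x y -> lattice a1 a2 b1 b2 (a * x + b * y) (c * x + d * y)) ->
  (forall x y, lattice a1 a2 b1 b2 (a * x + b * y) (c * x + d * y) -> lattice a1' a2' b1' b2' x y) ->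
  Rabs (a1 * b2 - a2 * b1) = Rabs (a1' * b2' - a2' * b1') * Rabs (a * d - b * c).
Proof.
set D := a1 * b2 - a2 * b1; set D' := a1' * b2' - a2' * b1'; set J := a * d - b * c.
move=> nzD nzJ to from.
have [m [n [e1 e2]]] := to _ _ (lattice_fst a1' a2' b1' b2').
have [p [q [e3 e4]]] := to _ _ (lattice_snd a1' a2' b1' b2').
have inv x y : lattice a1 a2 b1 b2 x y -> lattice a1' a2' b1' b2' ((d * x - b * y) / J) ((a * y - c * x) / J).
  move=> h; apply: from.
  have -> : a * ((d * x - b * y) / J) + b * ((a * y - c * x) / J) = x by rewrite /J; field.
  by have -> : c * ((d * x - b * y) / J) + d * ((a * y - c * x) / J) = y by rewrite /J; field.
have [m' [n' [f1 f2]]] := inv _ _ (lattice_fst a1 a2 b1 b2).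
have [p' [q' [f3 f4]]] := inv _ _ (lattice_snd a1 a2 b1 b2).
have g1 : J * D' = D * IZR (m * q - n * p)%ZZ.
  rewrite minus_IZR !mult_IZR.
  have -> : J * D' = (a * a1' + b * a2') * (c * b1' + d * b2') - (c * a1' + d * a2') * (a * b1' + b * b2').
    by rewrite /J /D'; ring.
  by rewrite e1 e2 e3 e4 /D; ring.
have g2 : D = J * D' * IZR (m' * q' - n' * p')%ZZ.
  rewrite minus_IZR !mult_IZR.
  have -> : J * D' * (IZR m' * IZR q' - IZR n' * IZR p') =
    J * ((IZR m' * a1' + IZR n' * b1') * (IZR p' * a2' + IZR q' * b2') -
    (IZR m' * a2' + IZR n' * b2') * (IZR p' * a1' + IZR q' * b1')) by rewrite /D'; ring.
  by rewrite -f1 -f2 -f3 -f4 /D /J; field.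
have h : IZR (m * q - n * p)%ZZ * IZR (m' * q' - n' * p')%ZZ = 1.
  by apply: (Rmult_eq_reg_l D) => //; rewrite -Rmult_assoc -g1 -g2; ring.
have hz : (m * q - n * p = 1 \/ m * q - n * p = - (1))%ZZ.
  by apply: Z.eq_mul_1; apply: eq_IZR; rewrite mult_IZR; exact: h.
rewrite (Rmult_comm (Rabs D')) -Rabs_mult g1 Rabs_mult.
by case: hz => ->; rewrite ?Ropp_Ropp_IZR ?Rabs_Ropp ?Rabs_R1 Rmult_1_r.
Qed.

(** * Parametrizations of the same torus *)

Lemma expi_norm t : (expi t * conjC (expi t) = 1)%R.
Proof. by apply/cnorm1P; rewrite /=; have := sin2_cos2 t; rewrite /Rsqr; lra. Qed.

Lemma expiD s t : expi (s + t) = (expi s * expi t)%R.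
Proof. by apply: cplx_ext; rewrite ?cReM ?cImM /= ?cos_plus ?sin_plus; ring. Qed.

Lemma expi_neq0 t : expi t != 0%R.
Proof.
by apply/eqP => h; have := expi_norm t; rewrite h mul0r => /esym/eqP; rewrite oner_eq0.
Qed.

(** Differentiating the constants cos f and sin f shows that sin f and cos f both annihilate the
    partials of [f]. This avoids any argument about values modulo 2 pi. *)
Lemma expi_locally_const f K : smooth f -> (forall x y, expi (f x y) = K) ->
  forall x y, diff2 f x y 0 0.
Proof.
move=> sf h x y.
have df := smooth_diff x y sf.
have dc := diff2_comp1 (is_derive_cos (f x y)) df.
have ds := diff2_comp1 (is_derive_sin (f x y)) df.
have ec : (fun u v => cos (f u v)) = (fun _ _ => complex.Re K).
  by apply: functional_extensionality => u; apply: functional_extensionality => v; rewrite -(h u v).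
have es : (fun u v => sin (f u v)) = (fun _ _ => complex.Im K).
  by apply: functional_extensionality => u; apply: functional_extensionality => v; rewrite -(h u v).
rewrite ec in dc; rewrite es in ds.
have [c1 c2] := differentiable_pt_lim_unique _ _ _ _ _ dc.
have [s1 s2] := differentiable_pt_lim_unique _ _ _ _ _ ds.
rewrite !Derive_const in c1 c2 s1 s2.
have sc := sin2_cos2 (f x y); rewrite /Rsqr in sc.
have z l : 0 = - sin (f x y) * l -> 0 = cos (f x y) * l -> l = 0.
  move=> h1 h2; have -> : l = (sin (f x y) * sin (f x y) + cos (f x y) * cos (f x y)) * l by rewrite sc; ring.
  have -> : (sin (f x y) * sin (f x y) + cos (f x y) * cos (f x y)) * l = - sin (f x y) * (- sin (f x y) * l) + cos (f x y) * (cos (f x y) * l) by ring.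
  by rewrite -h1 -h2; ring.
by have := df; rewrite (z _ c1 s1) (z _ c2 s2).
Qed.

Lemma expi_diff_const f g K : smooth f -> smooth g ->
  (forall x y, expi (f x y) = (K * expi (g x y))%R) ->
  forall x y, Dx f x y = Dx g x y /\ Dy f x y = Dy g x y.
Proof.
move=> sf sg h x y.
have e : forall x y, expi (f x y - g x y) = K.
  move=> u v; apply: (mulIf (expi_neq0 (g u v))); rewrite -h -expiD; congr expi; ring.
have d0 := expi_locally_const (smooth_sub sf sg) e x y.
have d1 := diff2_sub (smooth_diff x y sf) (smooth_diff x y sg).
have [e1 e2] := differentiable_pt_lim_unique _ _ _ _ _ d0.
have [e3 e4] := differentiable_pt_lim_unique _ _ _ _ _ d1.
by rewrite e1 in e3; rewrite e2 in e4; split; lra.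
Qed.

Lemma diff2_affine a b e x y : diff2 (fun x y => a * x + b * y + e) x y a b.
Proof.
apply: (@diff2_of_partials _ (fun _ _ => a) (fun _ _ => b)) => [u v|u v|].
- by auto_derive => //; ring.
- by auto_derive => //; ring.
- exact: continuity_2d_pt_const.
Qed.

Lemma smooth_affine a b e : smooth (fun x y => a * x + b * y + e).
Proof.
apply: smooth_add; last exact: smooth_const.
by apply: smooth_add; apply: smooth_mul; try exact: smooth_const;
  [exact: smooth_fst | exact: smooth_snd].
Qed.

Lemma integral_const T f c : (forall x y, f x y = c) -> integral T f = covol T * c.
Proof.
move=> h; rewrite /integral; congr (_ * _).
have -> : (fun s => RInt (fun t => f (s * w11 T + t * w21 T) (s * w12 T + t * w22 T)) 0 1) = (fun _ => c).
  apply: functional_extensionality => s.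
  rewrite (RInt_ext _ (fun=> c)) => [|t _]; last exact: h.
  by rewrite RInt_const /scal /= /mult /=; ring.
by rewrite RInt_const /scal /= /mult /=; ring.
Qed.

(** If M^T M = k then M M^T = k. The rows are needed because the gradient of the angle transforms by
    the transpose of the Jacobian. *)
Lemma conformal_rows a b c d : 0 < a * a + c * c -> a * a + c * c = b * b + d * d ->
  a * b + c * d = 0 ->
  a * a + b * b = a * a + c * c /\ c * c + d * d = a * a + c * c /\ a * c + b * d = 0.
Proof.
move=> kpos c1 c2; set k := a * a + c * c in kpos *; set J := a * d - b * c.
have h1 : k * d = J * a.
  have -> : J * a = k * d - c * (a * b + c * d) by rewrite /J /k; ring.
  by rewrite c2; ring.
have h2 : k * c = - J * b.
  have -> : - J * b = (b * b + d * d) * c - d * (a * b + c * d) by rewrite /J; ring.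
  by rewrite c2 -c1 /k; ring.
have h3 : J * J = k * k.
  have -> : J * J = k * (b * b + d * d) - (a * b + c * d) * (a * b + c * d) by rewrite /J /k; ring.
  by rewrite c2 -c1 -/k; ring.
have k2 : k * k <> 0 by nra.
have h4 : c * c = b * b.
  apply: (Rmult_eq_reg_l (k * k)) => //.
  have -> : k * k * (c * c) = (k * c) * (k * c) by ring.
  by rewrite h2 -h3; ring.
have h5 : d * d = a * a.
  apply: (Rmult_eq_reg_l (k * k)) => //.
  have -> : k * k * (d * d) = (k * d) * (k * d) by ring.
  by rewrite h1 -h3; ring.
split; [by rewrite /k h4 | split; first by rewrite h5 /k Rplus_comm].
apply: (Rmult_eq_reg_l k); last lra.
have -> : k * (a * c + b * d) = a * (k * c) + b * (k * d) by ring.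
by rewrite h1 h2; ring.
Qed.

Section Compare.
Variables (T T' : torus_data) (S : {vspace C3} -> Prop).
Hypothesis pT : parametrizes T S.
Hypothesis pT' : parametrizes T' S.
Variables a b c d u0 v0 : R.
Hypothesis conf1 : a * a + c * c = b * b + d * d.
Hypothesis conf2 : a * b + c * d = 0.
Let gx x y := a * x + b * y + u0.
Let gy x y := c * x + d * y + v0.
Hypothesis metric : forall x y, exp (conf T' x y) = exp (conf T (gx x y) (gy x y)) * (a * a + c * c).
Hypothesis gT : forall x y, hopf (lift T (gx x y) (gy x y)) = hopf (lift T' x y).

Let hT : lagrangian_torus T. Proof. by case: pT. Qed.
Let hT' : lagrangian_torus T'. Proof. by case: pT'. Qed.

Let k := a * a + c * c.
Let kpos : 0 < k.
Proof.
have h := metric 0 0; have h1 := exp_pos (conf T' 0 0).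
have h2 := exp_pos (conf T (gx 0 0) (gy 0 0)).
by rewrite h in h1; apply: (Rmult_lt_reg_l (exp (conf T (gx 0 0) (gy 0 0)))) => //; rewrite Rmult_0_r.
Qed.

Let det2 : (a * d - b * c) ^ 2 = k ^ 2.
Proof.
have -> : (a * d - b * c) ^ 2 = (a * a + c * c) * (b * b + d * d) - (a * b + c * d) ^ 2 by ring.
by rewrite -conf1 conf2 /k; ring.
Qed.

(** Both immersions are injective modulo their lattices, so the linear part carries one lattice onto
    the other; conformality gives |ad - bc| = a^2 + c^2. *)
Lemma covol_compare : covol T = covol T' * (a * a + c * c).
Proof.
have nz0 : a * d - b * c <> 0 by move=> h; move: det2; rewrite h; nra.
have nz w1 w2 w3 w4 : Rabs (w1 * w4 - w2 * w3) <> 0 -> w1 * w4 - w2 * w3 <> 0.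
  by move=> h h'; apply: h; rewrite h' Rabs_R0.
have nzT : w11 T * w22 T - w12 T * w21 T <> 0 by case: hT => _ h *; apply: nz h.
have [_ _ injT] := pT; have [_ _ injT'] := pT'.
have [_ _ perT _ _] := hT; have [_ _ perT' _ _] := hT'.
have ek : k = Rabs (a * d - b * c).
  by apply: Rsqr_inj; [lra | exact: Rabs_pos | rewrite -Rsqr_abs /Rsqr; lra].
rewrite -/k ek; apply: lattice_index_one => // x y h.
- have := injT (gx x y) (gy x y) (gx 0 0) (gy 0 0).
  have -> : gx x y - gx 0 0 = a * x + b * y by rewrite /gx; ring.
  have -> : gy x y - gy 0 0 = c * x + d * y by rewrite /gy; ring.
  apply; rewrite !gT; have := perT' 0 0 x y h; by rewrite !Rplus_0_l.
- have := injT' x y 0 0; rewrite !Rminus_0_r; apply.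
  rewrite -!gT; have := perT (gx 0 0) (gy 0 0) _ _ h.
  by move=> <-; congr (hopf (lift _ _ _)); rewrite /gx /gy; ring.
Qed.

Let dg (x y : R) : diff2 gx x y a b /\ diff2 gy x y c d.
Proof. by split; apply: diff2_affine. Qed.

Lemma lift_compare : exists2 K : Cplx, (K * conjC K = 1)%R &
  forall x y, lift T' x y = (K *: lift T (gx x y) (gy x y))%R.
Proof.
apply: horizontal_lift_unique; last exact: gT; last exact: lagrangian_horizontal.
have [sr hr] := lagrangian_horizontal hT.
split; first by apply: smooth3_comp => //; apply: smooth_affine.
move=> x y; have [h1 h2] := dg x y.
have [-> ->] := vdiff_D3 (vdiff_comp (smooth3_vdiff (gx x y) (gy x y) sr) h1 h2).
case: (hr (gx x y) (gy x y)) => e1 e2 e3; split.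
- exact: e1.
- exact: dotmx_lin0.
- exact: dotmx_lin0.
Qed.

Let norm_rx (T0 : torus_data) x y : lagrangian_torus T0 ->
  norm3 (D3 Dx (lift T0) x y) = sqrt (2 * exp (conf T0 x y)) /\
  norm3 (D3 Dy (lift T0) x y) = sqrt (2 * exp (conf T0 x y)).
Proof. by case=> _ _ _ /(_ x y) [_ _ h1 h2] _; rewrite /norm3 h1 h2. Qed.

(** [M] is the same at all points: up to the constant phase [K] it fixes the first row and acts on
    the two normalized tangent rows by the transposed Jacobian divided by sqrt k. Hence the two
    values of e^(i beta) differ by the constant factor det M. *)
Lemma frame_compare : exists M : 'M[Cplx]_3, forall x y,
  frame T' x y = M *m frame T (gx x y) (gy x y).
Proof.
have [K hK e] := lift_compare.
pose t := / sqrt k.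
exists (\matrix_(i < 3, j < 3) nth 0%R (nth [::] [:: [:: K; 0%R; 0%R];
  [:: 0%R; (K * (cR a * cR t))%R; (K * (cR c * cR t))%R];
  [:: 0%R; (K * (cR b * cR t))%R; (K * (cR d * cR t))%R]] i) j) => x y.
have [sr _] := lagrangian_horizontal hT.
have [dx dy] := dg x y.
have e' : lift T' = (fun x y => lift T (gx x y) (gy x y) *m K%:M).
  by apply: functional_extensionality => u; apply: functional_extensionality => v; rewrite e mul_mx_scalar.
have [DX DY] := vdiff_D3 (vdiff_mulmx K%:M (vdiff_comp (smooth3_vdiff (gx x y) (gy x y) sr) dx dy)).
rewrite -e' in DX DY.
have [n1 n2] := norm_rx x y hT'; have [n3 n4] := norm_rx (gx x y) (gy x y) hT.
have nE : / sqrt (2 * exp (conf T' x y)) = t * / sqrt (2 * exp (conf T (gx x y) (gy x y))).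
  have h := exp_pos (conf T (gx x y) (gy x y)).
  rewrite metric -/k -Rmult_assoc sqrt_mult; try lra.
  by rewrite Rinv_mult Rmult_comm.
rewrite /frame n1 n2 n3 n4 nE cR_mul DX DY !mul_mx_scalar e.
have aux (p q r s u : Cplx) : (p * q * (r * (s * u)) = r * (s * p) * (q * u))%R.
  by rewrite !mulrA; congr (_ * _)%R; rewrite -(mulrA (p * q)%R) (mulrC (p * q)%R) !mulrA.
move: (cR a) (cR b) (cR c) (cR d) (cR t) (cR (/ sqrt _)) => A B C D t' N.
move: (lift T _ _) (D3 Dx _ _ _) (D3 Dy _ _ _) => r X Y.
apply/matrixP => i j; rewrite !mxE sum3E !mxE !inordK // {DX DY n1 n2 n3 n4 nE}.
elim/ord3P: i; rewrite !inordK //= !mxE; rewrite ?mul0r ?add0r ?addr0 //.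
- by rewrite !mulrDr !aux.
- by rewrite !mulrDr !aux.
Qed.

Lemma angle_compare x y :
  Dx (angle T') x y = a * Dx (angle T) (gx x y) (gy x y) + c * Dy (angle T) (gx x y) (gy x y) /\
  Dy (angle T') x y = b * Dx (angle T) (gx x y) (gy x y) + d * Dy (angle T) (gx x y) (gy x y).
Proof.
have [M hM] := frame_compare.
have [[_ sb] _ _ _ eb] := hT; have [[_ sb'] _ _ _ eb'] := hT'.
have sg : smooth (fun x y => angle T (gx x y) (gy x y)).
  by apply: (smooth_comp sb); apply: smooth_affine.
have h u v : expi (angle T' u v) = (\det M * expi (angle T (gx u v) (gy u v)))%R.
  by rewrite eb' hM det_mulmx -eb.
have [-> ->] := expi_diff_const sb' sg h x y.
have [dx dy] := dg x y.
have dc := differentiable_pt_lim_comp _ _ _ _ _ _ _ _ _ _ _ (smooth_diff (gx x y) (gy x y) sb) dx dy.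
by rewrite (diff2_Dx dc) (diff2_Dy dc); split; ring.
Qed.

End Compare.

(** Passing to [T'] multiplies e^v and |grad beta|^2 by k and divides the covolume by k. As the
    densities stay constant, the integrals need no change of variables; the imaginary part vanishes
    because the gradient of the angle is constant. *)
Lemma has_energy_of_const T S v p q : parametrizes T S ->
  (forall x y, conf T x y = v) ->
  (forall x y, Dx (angle T) x y = p) -> (forall x y, Dy (angle T) x y = q) ->
  has_energy S (cR (/ 2 * (covol T * (4 * exp v + / 4 * (p ^ 2 + q ^ 2))))) /\
  has_area S (covol T * (2 * exp v)).
Proof.
move=> pT hv hp hq.
suff H T' : parametrizes T' S ->
    energy T' = cR (/ 2 * (covol T * (4 * exp v + / 4 * (p ^ 2 + q ^ 2)))) /\
    area T' = covol T * (2 * exp v).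
  by split; (split; first by exists T) => T' /H [].
move=> pT'; have [hT hS _] := pT; have [hT' hS' _] := pT'.
have sub x y : S (hopf (lift T' x y)) by apply/hS'; exists x, y.
have /hS [u0 [v0 e0]] := sub 0 0.
have [a [b [c [d [c1 c2 m g]]]]] := torus_rigidity pT hT' sub (esym e0).
have ang := angle_compare pT pT' m g.
have cov := covol_compare pT pT' c1 c2 m g.
set k := a * a + c * c in m cov.
have kpos : 0 < k.
  have h := exp_pos (conf T' 0 0); rewrite m hv in h.
  by apply: (Rmult_lt_reg_l (exp v)); [exact: exp_pos | rewrite Rmult_0_r].
have ax : Dx (angle T') = (fun _ _ => a * p + c * q).
  apply: functional_extensionality => x; apply: functional_extensionality => y.
  by rewrite (ang x y).1 hp hq.
have ay : Dy (angle T') = (fun _ _ => b * p + d * q).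
  apply: functional_extensionality => x; apply: functional_extensionality => y.
  by rewrite (ang x y).2 hp hq.
have re x y : complex.Re (potential T' x y) = k * (4 * exp v + / 4 * (p ^ 2 + q ^ 2)).
  rewrite /potential /= ax ay m hv.
  have [r1 [r2 r3]] := conformal_rows kpos c1 c2.
  have -> : (a * p + c * q) ^ 2 + (b * p + d * q) ^ 2 =
    (a * a + b * b) * p ^ 2 + (c * c + d * d) * q ^ 2 + 2 * p * q * (a * c + b * d) by ring.
  by rewrite r1 r2 r3 -/k; ring.
have im x y : complex.Im (potential T' x y) = 0.
  by rewrite /potential /= ax ay (diff2_Dx (diff2_const _ x y)) (diff2_Dy (diff2_const _ x y)); ring.
split.
- rewrite /energy (integral_const _ re) (integral_const _ im) cov.
  by congr Complex; ring.
- rewrite /area (@integral_const T' _ (2 * (exp v * k))) => [|x y]; first by rewrite cov; ring.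
  by rewrite m hv.
Qed.

(** * Moving a torus by a unitary matrix *)

Lemma expi_surj (z : Cplx) : (z * conjC z = 1)%R -> exists t, expi t = z.
Proof.
move/cnorm1P; case: z => a b /= h.
have hb0 := Rle_0_sqr b; rewrite /Rsqr in hb0.
have ha1 : a * a <= 1 by lra.
have ha : -1 <= a <= 1.
  split.
  - case: (Rle_or_lt (-1) a) => // lt.
    have : 0 < (-1 - a) * (-1 - a) by apply: Rmult_lt_0_compat; lra.
    lra.
  - case: (Rle_or_lt a 1) => // lt.
    have : 0 < (a - 1) * (a - 1) by apply: Rmult_lt_0_compat; lra.
    lra.
have hb : b * b = 1 - a ^ 2 by lra.
case: (Rle_dec 0 b) => b0.
- exists (acos a); rewrite /expi cos_acos // sin_acos // /Rsqr; congr Complex.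
  have -> : 1 - a * a = b * b by lra.
  exact: sqrt_square.
- exists (- acos a); rewrite /expi cos_neg sin_neg cos_acos // sin_acos // /Rsqr; congr Complex.
  have -> : 1 - a * a = (- b) * (- b) by lra.
  by rewrite sqrt_square; lra.
Qed.

Lemma unitary_det (U : 'M[Cplx]_3) : U \is unitarymx -> (\det U * conjC (\det U) = 1)%R.
Proof. by move/unitarymxP/(congr1 determinant); rewrite det_mulmx det_map_mx det_tr det1. Qed.

Lemma unitary_mulCV (U : 'M[Cplx]_3) : U \is unitarymx ->
  (U *m (U^T ^ conjC)%sesqui = 1%:M)%R.
Proof. by move/unitarymxP. Qed.

Lemma unitary_adj (A : 'M[Cplx]_3) : A \is unitarymx -> (A^T ^ conjC)%sesqui \is unitarymx.
Proof. by rewrite trmxC_unitary. Qed.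

(** Rotating the lift multiplies every frame by [U] on the right, hence e^(i beta) by det U; [t] is
    meant to be an argument of det U. *)
Definition rotate (U : 'M[Cplx]_3) (t : R) (T : torus_data) : torus_data :=
  TorusData (fun x y => lift T x y *m U)%R (conf T) (fun x y => angle T x y + t)
    (w11 T) (w12 T) (w21 T) (w22 T).

Section Rotate.
Variables (U : 'M[Cplx]_3) (t : R) (T : torus_data).
Hypothesis hU : U \is unitarymx.
Hypothesis ht : expi t = \det U.
Hypothesis hT : lagrangian_torus T.
Let T' := rotate U t T.

Let D3U x y : D3 Dx (lift T') x y = (D3 Dx (lift T) x y *m U)%R /\
              D3 Dy (lift T') x y = (D3 Dy (lift T) x y *m U)%R.
Proof.
have [[sr _] _ _ _ _] := hT.
exact: (vdiff_D3 (vdiff_mulmx U (smooth3_vdiff x y sr))).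
Qed.

Lemma frame_rotate x y : frame T' x y = frame T x y *m U.
Proof.
have [ex ey] := D3U x y.
have nm (u : C3) : norm3 (u *m U)%R = norm3 u by rewrite /norm3 dotmx_mulmx.
rewrite /frame ex ey (nm (D3 Dx (lift T) x y)) (nm (D3 Dy (lift T) x y)).
generalize (cR (/ norm3 (D3 Dx (lift T) x y))) (cR (/ norm3 (D3 Dy (lift T) x y))) => p q.
rewrite [lift T' x y]/(lift T x y *m U)%R.
move: (lift T x y) (D3 Dx _ _ _) (D3 Dy _ _ _) => r X Y.
apply/row_matrixP => i; rewrite row_mul !rowK.
by elim/ord3P: i; rewrite !inordK //= -?scalemxAl.
Qed.

Lemma rotate_lagrangian : lagrangian_torus T'.
Proof.
case: hT => [[sr sb]] nz per met fr; split.
- split; first exact: smooth3_mulmx.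
  by apply: smooth_add => //; apply: smooth_const.
- exact: nz.
- by move=> x y a b h; rewrite /= -!move_hopf per.
- move=> x y; case: (met x y) => h0 [h1 h2 h3] h4 h5.
  have [ex ey] := D3U x y; rewrite ex ey.
  rewrite [lift T' x y]/(lift T x y *m U)%R !(dotmx_mulmx _ _ hU).
  by split; [exact: h0 | split; [exact: h1 | exact: h2 | exact: h3] | exact: h4 | exact: h5].
- by move=> x y; rewrite frame_rotate det_mulmx -fr -ht -expiD.
Qed.

Lemma rotate_parametrizes (S S' : {vspace C3} -> Prop) : parametrizes T S ->
  (forall L, S' L <-> exists2 L0, S L0 & L = move U L0) -> parametrizes T' S'.
Proof.
move=> [_ hS inj] hS'; split.
- exact: rotate_lagrangian.
- move=> L; split.
  + by move/hS' => [L0 /hS [x [y ->]] ->]; exists x, y; rewrite move_hopf.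
  + move=> [x [y ->]]; apply/hS'; exists (hopf (lift T x y)); last by rewrite move_hopf.
    by apply/hS; exists x, y.
- move=> x y x' y' h; apply: inj.
  have := congr1 (move (U^T ^ conjC)%sesqui) h.
  rewrite !move_hopf; rewrite /= -(mulmxA (lift T x y)) -(mulmxA (lift T x' y')).
  by rewrite (unitary_mulCV hU) !mulmx1.
Qed.

Lemma energy_rotate : energy T' = energy T.
Proof.
have [[_ sb] _ _ _ _] := hT.
have ax : Dx (angle T') = Dx (angle T).
  apply: functional_extensionality => x; apply: functional_extensionality => y.
  rewrite (diff2_Dx (diff2_add (smooth_diff x y sb) (diff2_const t x y))); ring.
have ay : Dy (angle T') = Dy (angle T).
  apply: functional_extensionality => x; apply: functional_extensionality => y.
  rewrite (diff2_Dy (diff2_add (smooth_diff x y sb) (diff2_const t x y))); ring.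
by rewrite /energy /potential ax ay.
Qed.

End Rotate.

Lemma has_energy_move (U : 'M[Cplx]_3) (S S' : {vspace C3} -> Prop) e :
  U \is unitarymx -> (forall L, S' L <-> exists2 L0, S L0 & L = move U L0) ->
  (exists T, parametrizes T S) -> has_energy S' e -> has_energy S e.
Proof.
move=> hU hS exT [_ h]; split=> // T pT.
have [t ht] := expi_surj (unitary_det hU).
have hT : lagrangian_torus T by case: pT.
rewrite -(@energy_rotate U t T hT); apply: h.
exact: (rotate_parametrizes hU ht hT pT hS).
Qed.

(** * Tori with linear phases *)

Definition sum3 (f : 'I_3 -> R) : R := f (inord 0) + f (inord 1) + f (inord 2).

Lemma expi_eq1 t : expi t = 1%R -> exists n : Z, t = 2 * PI * IZR n.
Proof.
move=> h; have hc : cos t = 1 by have := congr1 (@complex.Re R) h.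
have e : t = 2 * (t / 2) by field.
have : sin (t / 2) = 0.
  rewrite e cos_2a_sin in hc; apply: Rsqr_0_uniq; rewrite /Rsqr; lra.
by case/sin_eq_0_0 => n hn; exists n; rewrite e hn; ring.
Qed.

Lemma expi_2PI n : expi (2 * PI * IZR n) = 1%R.
Proof.
have e : 2 * PI * IZR n = 2 * (IZR n * PI) by ring.
have s0 : sin (IZR n * PI) = 0 by apply: sin_eq_0_1; exists n.
by apply: cplx_ext; rewrite ?cRe1 ?cIm1 /= e ?cos_2a_sin ?sin_2a s0; ring.
Qed.

Lemma cdiff_expi f x y a b : diff2 f x y a b ->
  cdiff (fun u v => expi (f u v)) x y (Complex 0%coqR a * expi (f x y))%R (Complex 0%coqR b * expi (f x y))%R.
Proof.
move=> h; split.
- apply: diff2_ext (diff2_comp1 (is_derive_cos (f x y)) h) => //; rewrite cReM /=; ring.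
- apply: diff2_ext (diff2_comp1 (is_derive_sin (f x y)) h) => //; rewrite cImM /=; ring.
Qed.

Lemma csmooth_expi f : smooth f -> csmooth (fun u v => expi (f u v)).
Proof. by move=> h; split; [apply: smooth_cos | apply: smooth_sin]. Qed.

Lemma frame_unitary T x y :
  [/\ dotmx (lift T x y) (lift T x y) = 1%R,
      [/\ dotmx (D3 Dx (lift T) x y) (lift T x y) = 0%R, dotmx (D3 Dy (lift T) x y) (lift T x y) = 0%R
        & dotmx (D3 Dx (lift T) x y) (D3 Dy (lift T) x y) = 0%R],
      dotmx (D3 Dx (lift T) x y) (D3 Dx (lift T) x y) = cR (2 * exp (conf T x y))
    & dotmx (D3 Dy (lift T) x y) (D3 Dy (lift T) x y) = cR (2 * exp (conf T x y))] ->
  frame T x y \is unitarymx.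
Proof.
move=> [h0 [h1 h2 h3] h4 h5]; apply/row_unitarymxP.
rewrite /frame /norm3 h4 h5 -[complex.Re (cR (2 * exp (conf T x y)))]/(2 * exp (conf T x y)).
set s := cR _.
have hs : (s * conjC s * cR (2 * exp (conf T x y)) = 1)%R.
  have h := exp_pos (conf T x y).
  have hq : 0 < sqrt (2 * exp (conf T x y)) by apply: sqrt_lt_R0; lra.
  apply: cplx_ext; rewrite ?cRe1 ?cIm1 ?cReM ?cImM ?cReM ?cImM ?cReC ?cImC /=; last by ring.
  have e : sqrt (2 * exp (conf T x y)) * sqrt (2 * exp (conf T x y)) = 2 * exp (conf T x y) by apply: sqrt_sqrt; lra.
  by rewrite -{3}e; field; lra.
generalize dependent s => s hs.
have sym (a b : C3) : dotmx a b = 0%R -> dotmx b a = 0%R by move=> h; rewrite dotmx_conj h conjC0.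
have sc (c d : Cplx) (a b : C3) : dotmx a b = 0%R -> dotmx (c *: a)%R (d *: b)%R = 0%R.
  by move=> h; rewrite dotmxZZ h mulr0.
have sc1 (c : Cplx) (a b : C3) : dotmx a b = 0%R -> dotmx (c *: a)%R b = 0%R.
  by move=> h; rewrite -[b]scale1r; apply: sc.
have sc2 (c : Cplx) (a b : C3) : dotmx a b = 0%R -> dotmx a (c *: b)%R = 0%R.
  by move=> h; rewrite -[a]scale1r; apply: sc.
move: (lift T x y) (D3 Dx (lift T) x y) (D3 Dy (lift T) x y) h0 h1 h2 h3 h4 h5 => r X Y h0 h1 h2 h3 h4 h5.
case=> [[|[|[|i]]] hi]; case=> [[|[|[|j]]] hj]; try discriminate;
  rewrite !rowK -val_eqE /=.
- exact: h0.
- by apply: sc2; apply: sym; exact: h1.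
- by apply: sc2; apply: sym; exact: h2.
- by apply: sc1; exact: h1.
- by rewrite dotmxZZ h4; exact: hs.
- by apply: sc; exact: h3.
- by apply: sc1; exact: h2.
- by apply: sc; apply: sym; exact: h3.
- by rewrite dotmxZZ h5; exact: hs.
Qed.

Section LinearTorus.
Variables rho p q theta : 'I_3 -> R.

Definition lvec (phi : 'I_3 -> R) : C3 := (\row_j (cR (rho j) * expi (phi j)))%R.
Definition lphase (x y : R) (j : 'I_3) : R := p j * x + q j * y + theta j.
Definition llift (x y : R) : C3 := lvec (lphase x y).

(** The common shape of [llift] (all c_j = 1) and of its derivatives (c_j = i p_j and c_j = i q_j).
    Phases cancel in Hermitian products of such vectors, leaving sums weighted by rho_j^2. *)
Definition gvec (c : 'I_3 -> Cplx) (phi : 'I_3 -> R) : C3 :=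
  (\row_j (c j * (cR (rho j) * expi (phi j))))%R.

Lemma lvec_gvec phi : lvec phi = gvec (fun=> cR 1) phi.
Proof. by apply/rowP => j; rewrite !mxE; symmetry; apply: mul1r. Qed.

Lemma dotmx_gvec c d phi : dotmx (gvec c phi) (gvec d phi) =
  Complex (sum3 (fun j => rho j ^ 2 * (complex.Re (c j) * complex.Re (d j) + complex.Im (c j) * complex.Im (d j))))
          (sum3 (fun j => rho j ^ 2 * (complex.Im (c j) * complex.Re (d j) - complex.Re (c j) * complex.Im (d j)))).
Proof.
rewrite dotmx_sum sum3E !mxE.
have e j : (c j * (cR (rho j) * expi (phi j)) * conjC (d j * (cR (rho j) * expi (phi j))) =
  Complex (rho j ^ 2 * (complex.Re (c j) * complex.Re (d j) + complex.Im (c j) * complex.Im (d j)))%coqR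
    (rho j ^ 2 * (complex.Im (c j) * complex.Re (d j) - complex.Re (c j) * complex.Im (d j)))%coqR)%R.
  rewrite !rmorphM /= mulrACA (mulrACA (cR _)) expi_norm mulr1.
  by apply: cplx_ext; rewrite ?cReM ?cImM ?cReM ?cImM ?cReC ?cImC /=; ring.
by rewrite !e.
Qed.

Lemma llift_vdiff x y : vdiff llift x y (gvec (fun j => Complex 0%coqR (p j)) (lphase x y))
  (gvec (fun j => Complex 0%coqR (q j)) (lphase x y)).
Proof.
move=> j; rewrite !mxE.
apply: (@cdiff_ext (fun u v => cR (rho j) * expi (lphase u v j))%R) => [u v|]; first by rewrite mxE.
have := cdiff_mul (cdiff_const (cR (rho j)) x y) (cdiff_expi (diff2_affine (p j) (q j) (theta j) x y)).
by rewrite !mul0r !add0r ![(cR _ * (Complex _ _ * _))%R]mulrCA.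
Qed.

Lemma llift_smooth : smooth3 llift.
Proof.
move=> j.
apply: (@csmooth_ext (fun u v => cR (rho j) * expi (lphase u v j))%R) => [u v|]; first by rewrite mxE.
apply: csmooth_mul; first exact: csmooth_const.
by apply: csmooth_expi; apply: smooth_affine.
Qed.

Hypothesis rpos : forall j, 0 < rho j.

Lemma hopf_lvec phi phi' : hopf (lvec phi) = hopf (lvec phi') <->
  forall j k, exists n : Z, (phi j - phi' j) - (phi k - phi' k) = 2 * PI * IZR n.
Proof.
have nz j : cR (rho j) != 0%R by apply/eqP => -[h]; have := rpos j; rewrite h; apply: Rlt_irrefl.
split.
- move=> e.
  have /vlineP [c hc] : lvec phi' \in hopf (lvec phi) by rewrite e memv_line.
  have hj j : (expi (phi j - phi' j)%coqR * c = 1)%R.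
    move/rowP: hc => /(_ j); rewrite !mxE mulrCA => /(mulfI (nz j)) h.
    apply: (mulIf (expi_neq0 (phi' j))); rewrite mul1r mulrAC -expiD.
    have -> : phi j - phi' j + phi' j = phi j by ring.
    by rewrite mulrC h.
  move=> j k; apply: expi_eq1.
  have hk : expi (- (phi k - phi' k)) = c.
    apply: (mulfI (expi_neq0 (phi k - phi' k))); rewrite hj -expiD Rplus_opp_r.
    by apply: cplx_ext; rewrite ?cRe1 ?cIm1 /= ?cos_0 ?sin_0.
  by rewrite /Rminus expiD hk hj.
- move=> h; have -> : lvec phi = (expi (phi (inord 0) - phi' (inord 0)) *: lvec phi')%R.
    apply/rowP => j; rewrite !mxE mulrCA; congr (_ * _)%R; rewrite -expiD.
    have [n hn] := h j (inord 0).
    rewrite -[RHS]mulr1 -(expi_2PI n) -expiD -hn; congr expi; ring.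
  exact: hopf_scale (expi_neq0 _).
Qed.

(** A common phase is invisible in CP^2, so only phase differences count. This matrix sends (x, y)
    to the differences against the last coordinate. *)
Let m11 := p (inord 0) - p (inord 2).
Let m12 := q (inord 0) - q (inord 2).
Let m21 := p (inord 1) - p (inord 2).
Let m22 := q (inord 1) - q (inord 2).
Let Delta := m11 * m22 - m12 * m21.

Definition lset (L : {vspace C3}) : Prop := exists phi, L = hopf (lvec phi).

Lemma llift_onto L : Delta <> 0 -> lset L <-> exists x y, L = hopf (llift x y).
Proof.
move=> nz; split; last by move=> [x [y ->]]; exists (lphase x y).
move=> [phi ->].
pose psi j := phi j - theta j - (phi (inord 2) - theta (inord 2)).
pose x := (psi (inord 0) * m22 - m12 * psi (inord 1)) / Delta.
pose y := (m11 * psi (inord 1) - psi (inord 0) * m21) / Delta.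
exists x, y; apply/hopf_lvec.
have h0 : m11 * x + m12 * y = psi (inord 0) by rewrite /x /y /Delta; field.
have h1 : m21 * x + m22 * y = psi (inord 1) by rewrite /x /y /Delta; field.
have h j : phi j - lphase x y j = phi (inord 2) - lphase x y (inord 2).
  elim/ord3P: j => //; rewrite /lphase.
  - by move: h0; rewrite /m11 /m12 /psi => h; lra.
  - by move: h1; rewrite /m21 /m22 /psi => h; lra.
by move=> j k; exists Z0; rewrite (h j) (h k); ring.
Qed.

(* The lattice is 2 pi times the dual of [(m11 m12; m21 m22)]: on it the phase differences
   are multiples of 2 pi. *)
Definition ltorus (v t : R) : torus_data :=
  TorusData llift (fun _ _ => v) (fun x y => sum3 (lphase x y) + t)
    (2 * PI * m22 / Delta) (- (2 * PI * m21 / Delta))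
    (- (2 * PI * m12 / Delta)) (2 * PI * m11 / Delta).

Lemma covol_ltorus v t : Delta <> 0 -> covol (ltorus v t) = 4 * PI ^ 2 / Rabs Delta.
Proof.
move=> nz; rewrite /covol /=.
have -> : 2 * PI * m22 / Delta * (2 * PI * m11 / Delta) - - (2 * PI * m21 / Delta) * - (2 * PI * m12 / Delta) =
  4 * PI ^ 2 * / Delta by rewrite /Delta; field.
rewrite Rabs_mult Rabs_inv Rabs_pos_eq //.
by have := pow2_ge_0 PI; lra.
Qed.

Lemma ltorus_lattice v t x y : Delta <> 0 -> in_lattice (ltorus v t) x y <->
  (exists m n : Z, m11 * x + m12 * y = 2 * PI * IZR m /\ m21 * x + m22 * y = 2 * PI * IZR n).
Proof.
move=> nz; split=> -[m [n [h1 h2]]]; exists m, n; rewrite /= in h1 h2 *.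
- by rewrite h1 h2; split; rewrite /Delta; field.
- have -> : 2 * PI * m22 / Delta = (2 * PI) * (m22 / Delta) by field.
  have ex : x = ((m11 * x + m12 * y) * m22 - m12 * (m21 * x + m22 * y)) / Delta by rewrite /Delta; field.
  have ey : y = (m11 * (m21 * x + m22 * y) - (m11 * x + m12 * y) * m21) / Delta by rewrite /Delta; field.
  by rewrite h1 h2 in ex ey; rewrite {1}ex {1}ey; split; field.
Qed.

Lemma llift_hopf_lattice v t x y x' y' : Delta <> 0 ->
  hopf (llift x y) = hopf (llift x' y') <-> in_lattice (ltorus v t) (x - x') (y - y').
Proof.
move=> nz; rewrite ltorus_lattice // hopf_lvec.
have e j k : lphase x y j - lphase x' y' j - (lphase x y k - lphase x' y' k) =
  (p j - p k) * (x - x') + (q j - q k) * (y - y') by rewrite /lphase; ring.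
split.
- move=> h; have [m hm] := h (inord 0) (inord 2); have [n hn] := h (inord 1) (inord 2).
  by exists m, n; rewrite -hm -hn !e.
- move=> [m [n [hm hn]]].
  have h j : exists n : Z, (p j - p (inord 2)) * (x - x') + (q j - q (inord 2)) * (y - y') = 2 * PI * IZR n.
    elim/ord3P: j; [by exists m | by exists n | exists Z0; ring].
  move=> j k; have [n1 h1] := h j; have [n2 h2] := h k.
  exists (n1 - n2)%ZZ; rewrite e minus_IZR; lra.
Qed.

Hypothesis rho1 : sum3 (fun j => rho j ^ 2) = 1.
Hypothesis rp : sum3 (fun j => rho j ^ 2 * p j) = 0.
Hypothesis rq : sum3 (fun j => rho j ^ 2 * q j) = 0.
Hypothesis rpq : sum3 (fun j => rho j ^ 2 * (p j * q j)) = 0.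
Variable v : R.
Hypothesis rpp : sum3 (fun j => rho j ^ 2 * (p j * p j)) = 2 * exp v.
Hypothesis rqq : sum3 (fun j => rho j ^ 2 * (q j * q j)) = 2 * exp v.

Let D3x x y : D3 Dx llift x y = gvec (fun j => Complex 0%coqR (p j)) (lphase x y).
Proof. by case: (vdiff_D3 (llift_vdiff x y)). Qed.
Let D3y x y : D3 Dy llift x y = gvec (fun j => Complex 0%coqR (q j)) (lphase x y).
Proof. by case: (vdiff_D3 (llift_vdiff x y)). Qed.

Lemma llift_metric x y :
        [/\ dotmx (llift x y) (llift x y) = 1%R,
            [/\ dotmx (D3 Dx llift x y) (llift x y) = 0%R, dotmx (D3 Dy llift x y) (llift x y) = 0%R
              & dotmx (D3 Dx llift x y) (D3 Dy llift x y) = 0%R],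
            dotmx (D3 Dx llift x y) (D3 Dx llift x y) = cR (2 * exp v)
          & dotmx (D3 Dy llift x y) (D3 Dy llift x y) = cR (2 * exp v)].
Proof.
have cE (A B s : R) : A = s -> B = 0 -> Complex A B = cR s by move=> -> ->.
rewrite D3x D3y /llift lvec_gvec !dotmx_gvec.
split; [apply: (cE _ _ 1) | split; apply: (cE _ _ 0) | apply: cE | apply: cE]; rewrite /sum3 /=.
- by apply: etrans rho1; rewrite /sum3; ring.
- by ring.
- by ring.
- by apply: etrans rp; rewrite /sum3; ring.
- by ring.
- by apply: etrans rq; rewrite /sum3; ring.
- by apply: etrans rpq; rewrite /sum3; ring.
- by ring.
- by apply: etrans rpp; rewrite /sum3; ring.
- by ring.
- by apply: etrans rqq; rewrite /sum3; ring.
- by ring.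
Qed.

(** The frame is a constant matrix times the diagonal matrix of the phases e^(i phi_j). Thus the
    Lagrangian angle is the sum of the phases up to a constant. *)
Lemma frame_llift t : exists z : Cplx, forall x y,
  \det (frame (ltorus v t) x y) = (z * expi (sum3 (lphase x y)))%R.
Proof.
exists (\det (\matrix_(i < 3, j < 3) (nth 0%R [:: cR (rho j);
   (cR (/ sqrt (2 * exp v)) * (Complex 0%coqR (p j) * cR (rho j)))%R;
   (cR (/ sqrt (2 * exp v)) * (Complex 0%coqR (q j) * cR (rho j)))%R] i))) => x y.
have [_ _ h1 h2] := llift_metric x y.
have -> : expi (sum3 (lphase x y)) = \det (diag_mx (\row_j expi (lphase x y j)))%R.
  rewrite det_diag !big_ord_recl big_ord0 !mxE mulr1 mulrA /sum3 2!expiD.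
  by congr (_ * _ * _)%R; congr expi; congr lphase; apply: val_inj; rewrite /= inordK.
rewrite -det_mulmx; congr (\det _)%R.
rewrite /frame /norm3 /= h1 h2 D3x D3y.
rewrite -[complex.Re (cR (2 * exp v))]/(2 * exp v).
generalize (cR (/ sqrt (2 * exp v))) => c.
apply/matrixP => i j; rewrite mul_mx_diag !mxE.
elim/ord3P: i; rewrite !inordK //= !mxE //.
- by rewrite !mulrA.
- by rewrite !mulrA.
Qed.

(** Gram determinant of the vectors (1, 1, 1), [p], [q] for the weights rho_j^2: their matrix has
    determinant [Delta], and by the hypotheses the Gram matrix is diagonal with entries 1, 2 e^v, 2
    e^v. *)
Lemma gram_det : rho (inord 0) ^ 2 * rho (inord 1) ^ 2 * rho (inord 2) ^ 2 * Delta ^ 2 = (2 * exp v) ^ 2.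
Proof.
have -> : rho (inord 0) ^ 2 * rho (inord 1) ^ 2 * rho (inord 2) ^ 2 * Delta ^ 2 =
  sum3 (fun j => rho j ^ 2) * (sum3 (fun j => rho j ^ 2 * (p j * p j)) * sum3 (fun j => rho j ^ 2 * (q j * q j))
    - sum3 (fun j => rho j ^ 2 * (p j * q j)) ^ 2)
  - sum3 (fun j => rho j ^ 2 * p j) * (sum3 (fun j => rho j ^ 2 * p j) * sum3 (fun j => rho j ^ 2 * (q j * q j))
    - sum3 (fun j => rho j ^ 2 * q j) * sum3 (fun j => rho j ^ 2 * (p j * q j)))
  + sum3 (fun j => rho j ^ 2 * q j) * (sum3 (fun j => rho j ^ 2 * p j) * sum3 (fun j => rho j ^ 2 * (p j * q j))
    - sum3 (fun j => rho j ^ 2 * q j) * sum3 (fun j => rho j ^ 2 * (p j * p j))).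
  by rewrite /Delta /m11 /m12 /m21 /m22 /sum3; ring.
by rewrite rho1 rp rq rpq rpp rqq; ring.
Qed.

Lemma Delta_neq0 : Delta <> 0.
Proof.
move=> h; have := gram_det; rewrite h; have := exp_pos v; nra.
Qed.

Lemma covol_ltorus_metric t : covol (ltorus v t) =
  4 * PI ^ 2 * (rho (inord 0) * rho (inord 1) * rho (inord 2)) / (2 * exp v).
Proof.
rewrite covol_ltorus; last exact: Delta_neq0.
have h0 := rpos (inord 0); have h1 := rpos (inord 1); have h2 := rpos (inord 2).
have hv := exp_pos v.
have dpos := Rabs_pos_lt _ Delta_neq0.
have e : rho (inord 0) * rho (inord 1) * rho (inord 2) * Rabs Delta = 2 * exp v.
  apply: Rsqr_inj.
  - by apply: Rmult_le_pos; [apply: Rmult_le_pos; [apply: Rmult_le_pos|]|]; lra.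
  - by lra.
  rewrite Rsqr_mult -Rsqr_abs /Rsqr; have := gram_det; lra.
by rewrite -e; field; lra.
Qed.

Lemma ltorus_parametrizes : exists t, parametrizes (ltorus v t) lset.
Proof.
(* The frame does not involve the angle, so the torus with t = 0 determines [z]. Unitarity of the
   frame at one point gives |z| = 1, and the actual t is an argument of [z]. *)
have [z hz] := frame_llift 0.
have uni : frame (ltorus v 0) 0 0 \is unitarymx by apply: frame_unitary; apply: llift_metric.
have hz1 : (z * conjC z = 1)%R.
  have := unitary_det uni; rewrite hz rmorphM /= mulrACA expi_norm mulr1; exact.
have [t ht] := expi_surj hz1.
have nz := Delta_neq0.
exists t; split.
- split.
  + split; first exact: llift_smooth.
    apply: smooth_add; last exact: smooth_const.
    by rewrite /sum3; apply: smooth_add; [apply: smooth_add|]; apply: smooth_affine.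
  + rewrite covol_ltorus //; apply: Rmult_integral_contrapositive_currified.
      by have := PI_RGT_0 => ?; apply: Rgt_not_eq; apply: Rmult_lt_0_compat; [lra | apply: pow_lt].
    by apply: Rinv_neq_0_compat; apply: Rabs_no_R0.
  + move=> x y a b h; apply/(llift_hopf_lattice v t) => //.
    have -> : x + a - x = a by ring.
    by have -> : y + b - y = b by ring.
  + by move=> x y; apply: llift_metric.
  + by move=> x y; rewrite -[frame _ x y]/(frame (ltorus v 0) x y) hz -ht -expiD Rplus_comm.
- by move=> L; apply: llift_onto.
- by move=> x y x' y' /(llift_hopf_lattice v t) h; apply: h.
Qed.

End LinearTorus.

(** * The tori Sigma: homogeneity, energy and area *)

Lemma move_move (U V : 'M[Cplx]_3) L : move V (move U L) = move (U *m V) L.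
Proof.
rewrite /move -limg_comp; congr (_ @: L)%VS; apply/lfunP => u.
by rewrite comp_lfunE !lfunE /= mulmxA.
Qed.

Lemma move1 L : move 1%:M L = L.
Proof.
rewrite /move -[RHS]lim1g; congr (_ @: L)%VS; apply/lfunP => u.
by rewrite id_lfunE lfunE /= mulmx1.
Qed.

Definition diag_phase (a : 'I_3 -> R) : 'M[Cplx]_3 := diag_mx (\row_j expi (a j))%R.

Lemma diag_phase_mul a b : diag_phase a *m diag_phase b = diag_phase (fun j => a j + b j).
Proof.
by rewrite /diag_phase mulmx_diag; congr diag_mx; apply/rowP => j; rewrite !mxE expiD.
Qed.

Lemma diag_phase0 : diag_phase (fun=> 0) = 1%:M.
Proof.
rewrite /diag_phase -diag_const_mx; congr diag_mx; apply/rowP => j; rewrite !mxE.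
by apply: cplx_ext; rewrite ?cRe1 ?cIm1 /= ?cos_0 ?sin_0.
Qed.

Lemma diag_phase_unitary a : diag_phase a \is unitarymx.
Proof.
apply/unitarymxP; apply/matrixP => i j; rewrite /diag_phase mul_diag_mx !mxE eq_sym.
case: eqP => [->|_]; first by rewrite mulr1n expi_norm.
by rewrite mulr0n conjC0 mulr0.
Qed.

Lemma lvec_diag rho phi a : lvec rho phi *m diag_phase a = lvec rho (fun j => phi j + a j).
Proof. by apply/rowP => j; rewrite mul_mx_diag !mxE expiD mulrA. Qed.

Lemma lset_homogeneous rho : homogeneous (lset rho).
Proof.
move=> P Q [phi ->] [phi' ->]; exists (diag_phase (fun j => phi' j - phi j)).
have to L a : lset rho L -> lset rho (move (diag_phase a) L).
  by move=> [psi ->]; rewrite move_hopf lvec_diag; eexists.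
split; first exact: diag_phase_unitary.
- move=> L; split; first exact: to.
  move/(to _ (fun j => - (phi' j - phi j))); rewrite move_move diag_phase_mul.
  have -> : (fun j => phi' j - phi j + - (phi' j - phi j)) = (fun=> 0).
    by apply: functional_extensionality => j; ring.
  by rewrite diag_phase0 move1.
- rewrite move_hopf lvec_diag; congr (hopf (lvec _ _)).
  by apply: functional_extensionality => j; ring.
Qed.

Definition triple (a b c : R) (j : 'I_3) : R := nth 0 [:: a; b; c] j.

Lemma triple0 a b c : triple a b c (inord 0) = a. Proof. by rewrite /triple inordK. Qed.
Lemma triple1 a b c : triple a b c (inord 1) = b. Proof. by rewrite /triple inordK. Qed.
Lemma triple2 a b c : triple a b c (inord 2) = c. Proof. by rewrite /triple inordK. Qed.

Lemma Sigma_lset r1 r2 r3 : Sigma r1 r2 r3 = lset (triple r1 r2 r3).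
Proof.
have e phi : lvec (triple r1 r2 r3) phi = (\row_j nth 0 [:: cR r1 * expi (phi (inord 0));
    cR r2 * expi (phi (inord 1)); cR r3 * expi (phi (inord 2))] j)%R.
  apply/rowP => j; rewrite !mxE; elim/ord3P: j; rewrite ?triple0 ?triple1 ?triple2 inordK //.
apply: functional_extensionality => L; apply: propositional_extensionality; split.
- move=> [p1 [p2 [p3 ->]]]; exists (triple p1 p2 p3); rewrite e.
  by rewrite triple0 triple1 triple2.
- by move=> [phi ->]; exists (phi (inord 0)), (phi (inord 1)), (phi (inord 2)); rewrite e.
Qed.

Section SigmaEnergy.
Variables r1 r2 r3 : R.
Hypothesis r1pos : 0 < r1.
Hypothesis r2pos : 0 < r2.
Hypothesis r3pos : 0 < r3.
Hypothesis sphere : r1 ^ 2 + r2 ^ 2 + r3 ^ 2 = 1.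

(* [p] and [q] are an orthonormal basis of the plane sum r_j^2 u_j = 0 for the inner
   product sum r_j^2 u_j v_j, so the induced metric is dx^2 + dy^2 and v = ln (1/2). *)
Let rho := triple r1 r2 r3.
Let s := sqrt (r1 ^ 2 + r2 ^ 2).
Let al := / (r1 * r2 * s).
Let de := / (r3 * s).
Let p := triple (al * r2 ^ 2) (- (al * r1 ^ 2)) 0.
Let q := triple (de * r3 ^ 2) (de * r3 ^ 2) (- (de * s ^ 2)).

Let s2 : s ^ 2 = r1 ^ 2 + r2 ^ 2.
Proof. by rewrite /s -Rsqr_pow2 Rsqr_sqrt; nra. Qed.

Let spos : 0 < s.
Proof. by apply: sqrt_lt_R0; nra. Qed.

Lemma Sigma_structure :
  [/\ homogeneous_lagrangian_torus (Sigma r1 r2 r3),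
      has_energy (Sigma r1 r2 r3)
       (cR (PI ^ 2 * (1 - r1 ^ 2) * (1 - r2 ^ 2) * (1 - r3 ^ 2) / (2 * r1 * r2 * r3)))
    & has_area (Sigma r1 r2 r3) (4 * PI ^ 2 * (r1 * r2 * r3))].
Proof.
have hv : 2 * exp (ln (/ 2)) = 1 by rewrite exp_ln; lra.
have rpos j : 0 < rho j by rewrite /rho; elim/ord3P: j; rewrite ?triple0 ?triple1 ?triple2.
have E (f : 'I_3 -> R) : sum3 f = f (inord 0) + f (inord 1) + f (inord 2) by [].
have al2 : al ^ 2 * (r1 ^ 2 * r2 ^ 2 * s ^ 2) = 1 by rewrite /al; field; lra.
have de2 : de ^ 2 * (r3 ^ 2 * s ^ 2) = 1 by rewrite /de; field; lra.
have ss : s ^ 2 + r3 ^ 2 = 1 by lra.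
have h1 : sum3 (fun j => rho j ^ 2) = 1 by rewrite E /rho triple0 triple1 triple2.
have h2 : sum3 (fun j => rho j ^ 2 * p j) = 0.
  by rewrite E /rho /p !triple0 !triple1 !triple2; ring.
have h3 : sum3 (fun j => rho j ^ 2 * q j) = 0.
  rewrite E /rho /q !triple0 !triple1 !triple2.
  by rewrite s2; ring.
have h4 : sum3 (fun j => rho j ^ 2 * (p j * q j)) = 0.
  by rewrite E /rho /p /q !triple0 !triple1 !triple2; ring.
have h5 : sum3 (fun j => rho j ^ 2 * (p j * p j)) = 2 * exp (ln (/ 2)).
  by rewrite E /rho /p !triple0 !triple1 !triple2 hv -al2 s2; ring.
have h6 : sum3 (fun j => rho j ^ 2 * (q j * q j)) = 2 * exp (ln (/ 2)).
  rewrite E /rho /q !triple0 !triple1 !triple2 hv.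
  apply: (@etrans _ _ (de ^ 2 * (r3 ^ 2 * s ^ 2) * (s ^ 2 + r3 ^ 2))); first by rewrite s2; ring.
  by rewrite de2 ss; ring.
have [t pT] := @ltorus_parametrizes rho p q (fun=> 0) rpos h1 h2 h3 h4 _ h5 h6.
rewrite -Sigma_lset in pT.
have cov := @covol_ltorus_metric rho p q (fun=> 0) rpos h1 h2 h3 h4 _ h5 h6 t.
have dang x y : diff2 (angle (ltorus rho p q (fun=> 0) (ln (/ 2)) t)) x y (sum3 p) (sum3 q).
  apply: diff2_ext (diff2_affine (sum3 p) (sum3 q) t x y) => // u v.
  by rewrite /= /sum3 /lphase; ring.
have [hE hA] := has_energy_of_const pT (fun _ _ => erefl)
  (fun x y => diff2_Dx (dang x y)) (fun x y => diff2_Dy (dang x y)).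
have cov' : covol (ltorus rho p q (fun=> 0) (ln (/ 2)) t) = 4 * PI ^ 2 * (r1 * r2 * r3).
  by rewrite cov hv /rho triple0 triple1 triple2; field.
split.
- by split; [eexists; exact: pT | rewrite Sigma_lset; exact: lset_homogeneous].
- have <- : / 2 * (covol (ltorus rho p q (fun=> 0) (ln (/ 2)) t) *
    (4 * exp (ln (/ 2)) + / 4 * (sum3 p ^ 2 + sum3 q ^ 2))) =
    PI ^ 2 * (1 - r1 ^ 2) * (1 - r2 ^ 2) * (1 - r3 ^ 2) / (2 * r1 * r2 * r3); last exact: hE.
  rewrite cov' !E /p /q !triple0 !triple1 !triple2.
  have -> : 4 * exp (ln (/ 2)) = 2 by lra.
  have e3 : r3 ^ 2 = 1 - r1 ^ 2 - r2 ^ 2 by lra.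
  have n0 : 2 * r1 * r2 * r3 <> 0 by apply: Rgt_not_eq; do !apply: Rmult_lt_0_compat; lra.
  apply: (Rmult_eq_reg_r (2 * r1 * r2 * r3)) => //.
  have -> : PI ^ 2 * (1 - r1 ^ 2) * (1 - r2 ^ 2) * (1 - r3 ^ 2) / (2 * r1 * r2 * r3) * (2 * r1 * r2 * r3) =
    PI ^ 2 * (1 - r1 ^ 2) * (1 - r2 ^ 2) * (1 - r3 ^ 2) by field; lra.
  (* The gradient of the angle has components al (r2^2 - r1^2) and de (2 r3^2 - s^2), the sums of
     the p_j and of the q_j. Only al^2 and de^2 enter, so the square root s drops out. *)
  have -> : / 2 * (4 * PI ^ 2 * (r1 * r2 * r3) * (2 + / 4 * ((al * r2 ^ 2 + - (al * r1 ^ 2) + 0) ^ 2 +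
      (de * r3 ^ 2 + de * r3 ^ 2 + - (de * s ^ 2)) ^ 2))) * (2 * r1 * r2 * r3) =
    PI ^ 2 * (8 * r1 ^ 2 * r2 ^ 2 * r3 ^ 2 + r3 ^ 2 * (r1 ^ 2 * r2 ^ 2 * al ^ 2) * (r2 ^ 2 - r1 ^ 2) ^ 2 +
      r1 ^ 2 * r2 ^ 2 * (r3 ^ 2 * de ^ 2) * (2 * r3 ^ 2 - s ^ 2) ^ 2) by field.
  have -> : r1 ^ 2 * r2 ^ 2 * al ^ 2 = / (s ^ 2) by rewrite /al; field; lra.
  have -> : r3 ^ 2 * de ^ 2 = / (s ^ 2) by rewrite /de; field; lra.
  rewrite s2 e3; field; nra.
- by have := hA; rewrite cov' hv Rmult_1_r.
Qed.
End SigmaEnergy.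

(** * Isometries of a homogeneous torus are translations up to finite index *)

(** Compactness of a period cell. The bound is encoded as d f <= 1, which for f >= 0 survives
    shrinking d, as [compact_uniform] requires. *)
Lemma periodic_bounded a1 a2 b1 b2 f : a1 * b2 - a2 * b1 <> 0 -> smooth f ->
  periodic a1 a2 b1 b2 f -> (forall x y, 0 <= f x y) ->
  exists M, 0 < M /\ forall x y, f x y <= M.
Proof.
move=> nz sf pf f0.
pose F s t := f (s * a1 + t * b1 + 0) (s * a2 + t * b2 + 0).
have sF : smooth F.
  apply: (smooth_comp sf).
  - apply: (@smooth_ext (fun s t => a1 * s + b1 * t + 0)); last exact: smooth_affine.
    by move=> x y; ring.
  - apply: (@smooth_ext (fun s t => a2 * s + b2 * t + 0)); last exact: smooth_affine.
    by move=> x y; ring.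
have F0 s t : 0 <= F s t by apply: f0.
have mono d d' x y : d' <= d -> d * F x y <= 1 -> d' * F x y <= 1.
  by move=> le; apply: Rle_trans; apply: Rmult_le_compat_r.
have loc u v : - / 2 <= u <= / 2 -> - / 2 <= v <= / 2 -> exists d, 0 < d /\
    forall x y, Rabs (x - u) < d -> Rabs (y - v) < d -> d * F x y <= 1.
  move=> _ _; have [e he] := smooth_cont u v sF (mkposreal 1 Rlt_0_1).
  have k0 : 0 < F u v + 1 by have := F0 u v; lra.
  have k1 := Rinv_0_lt_compat _ k0.
  have d0 : 0 < Rmin e (/ (F u v + 1)) by apply: Rmin_pos => //; apply: cond_pos.
  exists (Rmin e (/ (F u v + 1))); split=> // x y hx hy.
  have := he x y (Rlt_le_trans _ _ _ hx (Rmin_l _ _)) (Rlt_le_trans _ _ _ hy (Rmin_l _ _)).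
  move=> /= /Rabs_lt_between h.
  apply: (Rle_trans _ (/ (F u v + 1) * (F u v + 1))); last by rewrite Rinv_l; lra.
  by apply: Rmult_le_compat; [lra | exact: F0 | exact: Rmin_r | lra].
have [d [d0 hd]] := compact_uniform mono loc.
exists (/ d); split; first exact: Rinv_0_lt_compat.
move=> x y.
set D := a1 * b2 - a2 * b1 in nz *.
pose s := (x * b2 - y * b1) / D; pose t := (a1 * y - a2 * x) / D.
have [m hm] := nearest_int s; have [n hn] := nearest_int t.
have -> : f x y = F (s - IZR m) (t - IZR n).
  have hl : lattice a1 a2 b1 b2 (IZR m * a1 + IZR n * b1) (IZR m * a2 + IZR n * b2) by exists m, n.
  rewrite /F -[RHS](pf _ _ hl); congr f; rewrite /s /t /D; field; exact: nz.
have := hd (s - IZR m) (t - IZR n) hm hn => h.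
apply: (Rmult_le_reg_l d) => //; rewrite Rinv_r; lra.
Qed.

Lemma Z_code K m : Rabs (IZR m) <= INR K ->
  exists o : 'I_(K.*2.+1), m = (Z.of_nat o - Z.of_nat K)%ZZ.
Proof.
rewrite INR_IZR_INZ => /Rabs_le_between [h1 h2].
have l1 : (- Z.of_nat K <= m)%ZZ by apply: le_IZR; rewrite opp_IZR.
have l2 : (m <= Z.of_nat K)%ZZ by apply: le_IZR.
have lt : (Z.to_nat (m + Z.of_nat K) < K.*2.+1)%N by apply/ltP; rewrite -addnn -plusE; lia.
by exists (Ordinal lt) => /=; lia.
Qed.

Lemma coord_bound B s a b c d x y z w : 
  Rabs a <= B -> Rabs b <= B -> Rabs c <= B -> Rabs d <= B ->
  Rabs x <= s -> Rabs y <= s -> Rabs z <= s -> Rabs w <= s ->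
  Rabs ((a * x + b * y) * z - (c * x + d * y) * w) <= 4 * B * s * s.
Proof.
move=> ha hb hc hd hx hy hz hw.
have t (p q u : R) : Rabs p <= B -> Rabs q <= s -> Rabs u <= s -> Rabs (p * q * u) <= B * s * s.
  move=> h1 h2 h3; rewrite !Rabs_mult.
  by do ![apply: Rmult_le_compat => //]; try exact: Rabs_pos; apply: Rmult_le_pos; exact: Rabs_pos.
have := t _ _ _ ha hx hz; have := t _ _ _ hb hy hz; have := t _ _ _ hc hx hw; have := t _ _ _ hd hy hw.
do 4![case/Rabs_le_between => ? ?]; apply/Rabs_le_between; lra.
Qed.

Section Translations.
Variables (T : torus_data) (S : {vspace C3} -> Prop).
Hypothesis pT : parametrizes T S.
Hypothesis hS : homogeneous S.
Let r := lift T.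
Let hT : lagrangian_torus T. Proof. by case: pT. Qed.
Let nz : w11 T * w22 T - w12 T * w21 T <> 0.
Proof. by case: hT => _ h _ _ _ h'; apply: h; rewrite /covol h' Rabs_R0. Qed.

Definition translates (b1 b2 : R) : Prop := exists2 U : 'M[Cplx]_3, U \is unitarymx &
  forall x y, hopf (r (x + b1) (y + b2)) = hopf (r x y *m U).

Lemma translates_add b1 b2 c1 c2 : translates b1 b2 -> translates c1 c2 ->
  translates (b1 + c1) (b2 + c2).
Proof.
move=> [U hU eU] [V hV eV]; exists (U *m V); first exact: (mul_unitarymx hU hV).
move=> x y; rewrite -!Rplus_assoc eV -move_hopf eU.
by rewrite move_hopf mulmxA.
Qed.

Lemma translates_mul n b1 b2 : translates b1 b2 -> (0 < n)%N ->
  translates (INR n * b1) (INR n * b2).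
Proof.
move=> h; case: n => // n _; elim: n => [|n IH].
  by rewrite /= !Rmult_1_l.
rewrite S_INR !Rmult_plus_distr_r !Rmult_1_l; exact: translates_add.
Qed.

(** Nothing is assumed about the regularity of [conf T]. Continuity and periodicity of e^v come from
    its expression through the derivatives of [hcoord]. The ratio will bound the conformal factors
    of the isometries. *)
Lemma metric_ratio_bounded : exists M, 0 < M /\ forall x y x' y',
  exp (conf T x y) <= M * exp (conf T x' y').
Proof.
pose f x y := rsum 18 (fun i => Dx (fun x y => hcoord (r x y) i) x y * Dx (fun x y => hcoord (r x y) i) x y).
have fE x y : f x y = 4 * exp (conf T x y) by case: (hcoord_metric hT x y).
have sr : smooth3 r by case: hT => -[].
have sf : smooth f.
  apply: (@smooth_rsum 18 (fun i x y => Dx (fun x y => hcoord (r x y) i) x y * Dx (fun x y => hcoord (r x y) i) x y)) => i.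
  by apply: smooth_mul; apply: smooth_Dx; apply: smooth_hcoord.
have pf : periodic (w11 T) (w12 T) (w21 T) (w22 T) f.
  move=> a b hab x y; apply: rsum_ext => i.
  by rewrite (periodic_Dx (smooth_hcoord i sr) (hcoord_periodic hT i) hab).
have fpos x y : 0 < f x y by rewrite fE; have := exp_pos (conf T x y); lra.
have [M1 [hM1 h1]] := periodic_bounded nz sf pf (fun x y => Rlt_le _ _ (fpos x y)).
have [M2 [hM2 h2]] := @periodic_bounded (w11 T) (w12 T) (w21 T) (w22 T) (fun x y => / f x y) nz
  (smooth_inv (fun x y => Rgt_not_eq _ _ (fpos x y)) sf)
  ltac:(by move=> a b hab x y; rewrite pf)
  (fun x y => Rlt_le _ _ (Rinv_0_lt_compat _ (fpos x y))).
exists (M1 * M2); split; first exact: Rmult_lt_0_compat.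
move=> x y x' y'.
suff : f x y <= M1 * M2 * f x' y' by rewrite !fE; lra.
apply: Rle_trans (h1 x y) _; rewrite -[X in X <= _]Rmult_1_r Rmult_assoc.
apply: Rmult_le_compat_l; first lra.
have := h2 x' y' => h; have hp := fpos x' y'.
rewrite -(Rinv_l (f x' y')); last lra.
by apply: Rmult_le_compat_r => //; lra.
Qed.

(* The isometry moves the point of parameter 0 to the point of parameter (b1, b2). *)
Lemma affine_isometry b1 b2 : exists U : 'M[Cplx]_3, exists a b c d : R,
  [/\ U \is unitarymx, a * a + c * c = b * b + d * d /\ a * b + c * d = 0,
      forall x y, exp (conf T x y) = exp (conf T (a * x + b * y + b1) (c * x + d * y + b2)) * (a * a + c * c)
    & forall x y, hopf (r (a * x + b * y + b1) (c * x + d * y + b2)) = hopf (r x y *m U)].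
Proof.
have [_ memS _] := pT.
have inS x y : S (hopf (r x y)) by apply/memS; exists x, y.
have [U [hU iU eU]] := hS (inS 0 0) (inS b1 b2).
have [t ht] := expi_surj (unitary_det hU).
have hT' := rotate_lagrangian hU ht hT.
have sub x y : S (hopf (lift (rotate U t T) x y)).
  by rewrite -[lift _ _ _]/(r x y *m U)%R -move_hopf -iU.
have base : hopf (lift T b1 b2) = hopf (lift (rotate U t T) 0 0).
  by rewrite -[lift (rotate _ _ _) _ _]/(r 0 0 *m U)%R -move_hopf eU.
have [a [b [c [d [h1 h2 h3 h4]]]]] := torus_rigidity pT hT' sub base.
by exists U, a, b, c, d; split.
Qed.
Let dec K (o : 'I_(K.*2.+1)) : R := IZR (Z.of_nat o - Z.of_nat K)%ZZ.

(** The code [o] is the integer matrix of the linear part in the lattice basis, with entries between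
    -K and K shifted by K. Equal codes mean equal linear parts. *)
Let rel K b1 b2 (o : ('I_(K.*2.+1) * 'I_(K.*2.+1)) * ('I_(K.*2.+1) * 'I_(K.*2.+1))) : Prop :=
  exists U : 'M[Cplx]_3, exists a b c d : R,
  [/\ U \is unitarymx, a * d - b * c <> 0,
      forall x y, hopf (r (a * x + b * y + b1) (c * x + d * y + b2)) = hopf (r x y *m U),
      a * w11 T + b * w12 T = dec o.1.1 * w11 T + dec o.1.2 * w21 T /\
      c * w11 T + d * w12 T = dec o.1.1 * w12 T + dec o.1.2 * w22 T
    & a * w21 T + b * w22 T = dec o.2.1 * w11 T + dec o.2.2 * w21 T /\
      c * w21 T + d * w22 T = dec o.2.1 * w12 T + dec o.2.2 * w22 T].

Lemma isometry_code : exists K : nat, forall b1 b2, exists o, @rel K b1 b2 o.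
Proof.
have [M [M0 hM]] := metric_ratio_bounded.
pose s := Rabs (w11 T) + Rabs (w12 T) + Rabs (w21 T) + Rabs (w22 T).
have p1 := Rabs_pos (w11 T); have p2 := Rabs_pos (w12 T).
have p3 := Rabs_pos (w21 T); have p4 := Rabs_pos (w22 T).
set D := w11 T * w22 T - w12 T * w21 T.
have nzD : D <> 0 := nz.
have Dpos := Rabs_pos_lt _ nzD.
(* By Cramer's rule an entry of the integer matrix is, up to sign, a sum of four products divided by
   D. Each product has one entry of the linear part, at most M + 1 since its square is at most M,
   and two basis coordinates, at most s. *)
have [K hK] := INR_unbounded (4 * (M + 1) * s * s / Rabs D).
exists K => b1 b2.
have [U [a [b [c [d [hU [c1 c2] met hop]]]]]] := affine_isometry b1 b2.
have [_ _ inj] := pT; have [_ _ per _ _] := hT.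
have kM : a * a + c * c <= M.
  have e := exp_pos (conf T (a * 0 + b * 0 + b1) (c * 0 + d * 0 + b2)).
  apply: (Rmult_le_reg_l (exp (conf T (a * 0 + b * 0 + b1) (c * 0 + d * 0 + b2)))) => //.
  rewrite -met (Rmult_comm _ M); exact: hM.
have kpos : 0 < a * a + c * c.
  have := exp_pos (conf T 0 0); rewrite met => h.
  have e := exp_pos (conf T (a * 0 + b * 0 + b1) (c * 0 + d * 0 + b2)).
  by apply: (Rmult_lt_reg_l (exp (conf T (a * 0 + b * 0 + b1) (c * 0 + d * 0 + b2)))) => //; rewrite Rmult_0_r.
have bnd z : z * z <= M -> Rabs z <= M + 1.
  move=> h; apply/Rabs_le_between; split; [case: (Rle_or_lt (- (M + 1)) z)|case: (Rle_or_lt z (M + 1))] => // lt; nra.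
have ba : Rabs a <= M + 1 by apply: bnd; nra.
have bb : Rabs b <= M + 1 by apply: bnd; nra.
have bc : Rabs c <= M + 1 by apply: bnd; nra.
have bd : Rabs d <= M + 1 by apply: bnd; nra.
have img x y : in_lattice T x y -> in_lattice T (a * x + b * y) (c * x + d * y).
  move=> hl.
  have e1 : a * x + b * y = (a * x + b * y + b1) - (a * 0 + b * 0 + b1) by ring.
  have e2 : c * x + d * y = (c * x + d * y + b2) - (c * 0 + d * 0 + b2) by ring.
  rewrite e1 e2; apply: inj; rewrite !hop -!move_hopf; congr move.
  by have := per 0 0 x y hl; rewrite !Rplus_0_l.
have solve X Y m n : X = IZR m * w11 T + IZR n * w21 T -> Y = IZR m * w12 T + IZR n * w22 T ->
    IZR m = (X * w22 T - Y * w21 T) / D /\ IZR n = - ((X * w12 T - Y * w11 T) / D).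
  by move=> -> ->; split; rewrite /D; field.
have div z : Rabs z <= 4 * (M + 1) * s * s -> Rabs (z / D) <= INR K.
  move=> h; rewrite /Rdiv Rabs_mult Rabs_inv; apply: (Rle_trans _ (4 * (M + 1) * s * s / Rabs D)); last lra.
  by apply: Rmult_le_compat_r => //; apply: Rlt_le; apply: Rinv_0_lt_compat.
have [m [n [e1 e2]]] := img _ _ (lattice_fst (w11 T) (w12 T) (w21 T) (w22 T)).
have [p [q [e3 e4]]] := img _ _ (lattice_snd (w11 T) (w12 T) (w21 T) (w22 T)).
have [s1 s2] := solve _ _ _ _ e1 e2; have [s3 s4] := solve _ _ _ _ e3 e4.
have [om hm] : exists o : 'I_(K.*2.+1), m = (Z.of_nat o - Z.of_nat K)%ZZ.
  by apply: Z_code; rewrite s1; apply: div; apply: coord_bound => //; rewrite /s; lra.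
have [on hn] : exists o : 'I_(K.*2.+1), n = (Z.of_nat o - Z.of_nat K)%ZZ.
  by apply: Z_code; rewrite s2 Rabs_Ropp; apply: div; apply: coord_bound => //; rewrite /s; lra.
have [op hp] : exists o : 'I_(K.*2.+1), p = (Z.of_nat o - Z.of_nat K)%ZZ.
  by apply: Z_code; rewrite s3; apply: div; apply: coord_bound => //; rewrite /s; lra.
have [oq hq] : exists o : 'I_(K.*2.+1), q = (Z.of_nat o - Z.of_nat K)%ZZ.
  by apply: Z_code; rewrite s4 Rabs_Ropp; apply: div; apply: coord_bound => //; rewrite /s; lra.
exists ((om, on), (op, oq)); exists U, a, b, c, d; rewrite /dec /= -hm -hn -hp -hq; split=> //.
move=> h0; have h1 : (a * d - b * c) * (a * d - b * c) = (a * a + c * c) * (b * b + d * d) - (a * b + c * d) * (a * b + c * d) by ring.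
rewrite h0 c2 -c1 in h1; have := Rmult_lt_0_compat _ _ kpos kpos; lra.
Qed.

(* Finitely many linear parts occur, so two of the isometries moving 0 to the multiples of
   [b / N!] have the same one, and their quotient is a translation. *)
Lemma all_translates b1 b2 : translates b1 b2.
Proof.
have [K hK] := isometry_code.
pose X : finType := (('I_(K.*2.+1) * 'I_(K.*2.+1)) * ('I_(K.*2.+1) * 'I_(K.*2.+1)))%type.
(* Among the N + 1 multiples 0, ..., N two share a code, and their difference, at most N, divides
   N!. *)
pose N := #|X|.
have fpos : 0 < INR (N`!) by apply: lt_0_INR; apply/ltP; exact: fact_gt0.
pose c1 := b1 / INR (N`!); pose c2 := b2 / INR (N`!).
have [f hf] : exists f : 'I_N.+1 -> X, forall i : 'I_N.+1, rel (INR i * c1) (INR i * c2) (f i).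
  apply: (@fin_all_exists 'I_N.+1 (fun=> X) (fun i o => rel (INR i * c1) (INR i * c2) o)) => i.
  exact: hK.
have step (i j : 'I_N.+1) : (i < j)%N -> f i = f j -> translates b1 b2.
  move=> lt e.
  have [U [a [b [c [d [hU det hop [e1 e2] [e3 e4]]]]]]] := hf i.
  have [V [a' [b' [c' [d' [hV _ hop' [e1' e2'] [e3' e4']]]]]]] := hf j.
  rewrite -e in e1' e2' e3' e4'.
  have lin p q p' q' : p * w11 T + q * w12 T = p' * w11 T + q' * w12 T ->
      p * w21 T + q * w22 T = p' * w21 T + q' * w22 T -> p = p' /\ q = q'.
    move=> l1 l2; split; apply: (Rmult_eq_reg_r (w11 T * w22 T - w12 T * w21 T)) => //.
    - have -> : p * (w11 T * w22 T - w12 T * w21 T) = (p * w11 T + q * w12 T) * w22 T - (p * w21 T + q * w22 T) * w12 T by ring.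
      by rewrite l1 l2; ring.
    - have -> : q * (w11 T * w22 T - w12 T * w21 T) = (p * w21 T + q * w22 T) * w11 T - (p * w11 T + q * w12 T) * w21 T by ring.
      by rewrite l1 l2; ring.
  have [ea eb] := lin a b a' b' ltac:(lra) ltac:(lra).
  have [ec ed] := lin c d c' d' ltac:(lra) ltac:(lra).
  subst a' b' c' d'.
  have hU' := unitary_adj hU.
  (* Undoing the i-th isometry and then applying the j-th cancels the common linear part. Repeating
     this translation N! / (j - i) times gives (b1, b2). *)
  have tr : translates (INR (j - i) * c1) (INR (j - i) * c2).
    exists ((U^T ^ conjC)%sesqui *m V); first exact: (mul_unitarymx hU' hV).
    move=> x y.
    pose X0 := x - INR i * c1; pose Y0 := y - INR i * c2.
    pose u := (d * X0 - b * Y0) / (a * d - b * c); pose v := (a * Y0 - c * X0) / (a * d - b * c).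
    have eu : a * u + b * v = X0 by rewrite /u /v; field.
    have ev : c * u + d * v = Y0 by rewrite /u /v; field.
    rewrite minus_INR; last by apply/leP; apply: ltnW.
    have -> : x + (INR j - INR i) * c1 = a * u + b * v + INR j * c1 by rewrite eu /X0; ring.
    have -> : y + (INR j - INR i) * c2 = c * u + d * v + INR j * c2 by rewrite ev /Y0; ring.
    have ex : x = a * u + b * v + INR i * c1 by rewrite eu /X0; ring.
    have ey : y = c * u + d * v + INR i * c2 by rewrite ev /Y0; ring.
    rewrite hop' -(move_hopf (_ *m V)) [in RHS]ex [in RHS]ey hop.
    by rewrite move_hopf !mulmxA -(mulmxA (r u v)) (unitary_mulCV hU) mulmx1.
  have dv : (j - i %| N`!)%N by apply: dvdn_fact; rewrite subn_gt0 lt /=; have := ltn_ord j; rewrite ltnS; apply: leq_trans; apply: leq_subr.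
  have [k hk] := dvdnP dv.
  have k0 : (0 < k)%N by case: (k) hk => // h; have := fact_gt0 N; rewrite h.
  have := translates_mul tr k0.
  have e0 z : INR k * (INR (j - i) * (z / INR N`!)) = z.
    have -> : INR N`! = INR k * INR (j - i) by rewrite -mult_INR multE -hk.
    rewrite hk -multE mult_INR in fpos.
    have n1 : INR k <> 0 by apply: not_0_INR => h; move: k0; rewrite h.
    have n2 : INR (j - i) <> 0 by apply: not_0_INR => h; move: lt; rewrite -subn_gt0 h.
    by field.
  by rewrite /c1 /c2 !e0.
have /injectivePn [i [j ij e]] : ~~ injectiveb f.
  by apply/negP => /injectiveP inj; have := leq_card f inj; rewrite card_ord /N ltnn.
case: (ltngtP i j) => [lt|lt|eq].
- exact: step lt e.
- exact: step lt (esym e).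
- by move: ij; rewrite -val_eqE /= eq eqxx.
Qed.

End Translations.

(** * Simultaneous diagonalization *)

(** Otherwise independent subfamilies could be extended to any size. This reduces the infinite
    family of translations to a finite list, as [cotrigonalization] demands. *)
Lemma finite_generators (K : fieldType) (I : Type) n (f : I -> 'rV[K]_n) :
  exists m (g : 'I_m -> I), forall i, exists c : 'I_m -> K, f i = (\sum_k c k *: f (g k))%R.
Proof.
pose M m (g : 'I_m -> I) := (\matrix_k f (g k))%R : 'M_(m, n).
apply: NNPP => none.
have step m : exists g : 'I_m -> I, \rank (M m g) = m.
  elim: m => [|m [g hg]].
    by exists (fun i : 'I_0 => let: Ordinal _ lt := i in False_rect I (notF lt)); apply/eqP; rewrite -leqn0 rank_leq_row.
  case: (classic (exists i, ~~ (f i <= M m g)%MS)) => [[i hi]|all].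
    pose g' (k : 'I_(1 + m)) := match split k with inl _ => i | inr a => g a end.
    exists g'.
    have -> : M _ g' = col_mx (f i) (M m g).
      apply/row_matrixP => k; rewrite rowK /g' -[k in RHS]splitK.
      case: (split k) => a /=; first by rewrite rowKu; apply/rowP => j; rewrite mxE ord1.
      by rewrite rowKd rowK.
    have e : \rank (col_mx (f i) (M m g)) = \rank (f i + M m g)%MS by rewrite addsmxE.
    apply/eqP; rewrite eqn_leq rank_leq_row e -[X in (X < _)%N]hg.
    apply: rank_ltmx; rewrite ltmxE addsmxSr /=.
    by apply: contra hi => h; apply: submx_trans h; apply: addsmxSl.
  case: none; exists m, g => i.
  have : (f i <= M m g)%MS by apply/negPn/negP => h; apply: all; exists i.
  case/submxP => D ->; exists (D 0%R); rewrite mulmx_sum_row.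
  by apply: eq_bigr => k _; rewrite rowK.
have [g hg] := step n.+1.
by have := rank_leq_col (M _ g); rewrite hg ltnn.
Qed.

Lemma unitary_row_norm (A : 'M[Cplx]_3) i : A \is unitarymx ->
  sum3 (fun j => complex.Re (A i j) ^ 2 + complex.Im (A i j) ^ 2) = 1.
Proof.
move/unitarymxP/matrixP => /(_ i i); rewrite !mxE eqxx sum3E !mxE => h.
have e (z : Cplx) : (z * conjC z)%R = cR (complex.Re z ^ 2 + complex.Im z ^ 2).
  by apply: cplx_ext; rewrite ?cReM ?cImM cReC cImC /=; ring.
rewrite !e in h; exact: (congr1 (@complex.Re R) h).
Qed.

(** Rows and columns have norm 1. The first row has only its diagonal entry, of modulus 1, which
    exhausts the first column; the second row and column follow in the same way. *)
Lemma unitary_trig_diag (A : 'M[Cplx]_3) : A \is unitarymx -> is_trig_mx A -> is_diag_mx A.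
Proof.
move=> hA /is_trig_mxP tr.
have Rw i := unitary_row_norm i hA.
have C i := unitary_row_norm i (unitary_adj hA).
pose N i j := complex.Re (A i j) ^ 2 + complex.Im (A i j) ^ 2.
have N0 i j : 0 <= N i j by apply: Rplus_le_le_0_compat; apply: pow2_ge_0.
have NZ i j : N i j = 0 -> A i j = 0%R.
  move=> h; have h1 := pow2_ge_0 (complex.Re (A i j)); have h2 := pow2_ge_0 (complex.Im (A i j)).
  by rewrite /N in h; apply: cplx_ext; rewrite ?cRe0 ?cIm0; nra.
have Nt (i j : 'I_3) : (i < j)%N -> N i j = 0 by move=> lt; rewrite /N tr // cRe0 cIm0; ring.
have R' i : N i (inord 0) + N i (inord 1) + N i (inord 2) = 1 := Rw i.
have C' j : N (inord 0) j + N (inord 1) j + N (inord 2) j = 1.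
  by rewrite -(C j) /sum3 !mxE !cReC !cImC /N; ring.
have l01 : ((inord 0 : 'I_3) < (inord 1 : 'I_3))%N by rewrite !inordK.
have l02 : ((inord 0 : 'I_3) < (inord 2 : 'I_3))%N by rewrite !inordK.
have l12 : ((inord 1 : 'I_3) < (inord 2 : 'I_3))%N by rewrite !inordK.
have z01 := Nt _ _ l01; have z02 := Nt _ _ l02; have z12 := Nt _ _ l12.
have r0 := R' (inord 0); have r1 := R' (inord 1); have c0 := C' (inord 0); have c1 := C' (inord 1).
have p10 := N0 (inord 1) (inord 0); have p20 := N0 (inord 2) (inord 0); have p21 := N0 (inord 2) (inord 1).
have z10 : A (inord 1) (inord 0) = 0%R by apply: NZ; lra.
have z20 : A (inord 2) (inord 0) = 0%R by apply: NZ; lra.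
have z21 : A (inord 2) (inord 1) = 0%R by apply: NZ; lra.
apply/is_diag_mxP; elim/ord3P; elim/ord3P; rewrite ?eqxx // => _; exact: z10 || exact: z20 || exact: z21 || exact: (NZ _ _ z01) || exact: (NZ _ _ z02) || exact: (NZ _ _ z12).
Qed.

(** Finitely many spanning members are trigonalized together by a unitary matrix, hence
    diagonalized, and being diagonal in a fixed basis is inherited by linear combinations. *)
Lemma codiagonalize (I : Type) (U : I -> 'M[Cplx]_3) :
  (forall i, U i \is unitarymx) -> (forall i j, U i *m U j = U j *m U i) ->
  exists2 P : 'M[Cplx]_3, P \is unitarymx &
    forall i, is_diag_mx (P *m U i *m (P^T ^ conjC)%sesqui).
Proof.
move=> hU cU.
have [m [g hg]] := finite_generators (fun i => mxvec (U i)).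
have [|P hP /allP hall] := @cotrigonalization _ _ [seq U (g k) | k <- enum 'I_m].
  by move=> _ _ /mapP [k _ ->] /mapP [l _ ->]; exact: cU.
exists P => // i.
have [c hc] := hg i.
have -> : U i = (\sum_k c k *: U (g k))%R.
  apply: (can_inj mxvecK); rewrite hc linear_sum /=.
  by apply: eq_bigr => k _; rewrite linearZ.
have tr k : is_diag_mx (P *m U (g k) *m (P^T ^ conjC)%sesqui).
  apply: unitary_trig_diag.
    exact: (mul_unitarymx (mul_unitarymx hP (hU (g k))) (unitary_adj hP)).
  rewrite -(conjymx _ hP); apply: hall; apply/mapP; exists k => //; exact: mem_enum.
apply/is_diag_mxP => a b ab.
rewrite mulmx_sumr mulmx_suml summxE big1 // => k _.
rewrite -scalemxAr -scalemxAl mxE.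
by move/is_diag_mxP: (tr k) => ->; rewrite ?mulr0.
Qed.

(** The values of the lift span C^3: differentiating the hypothesis extends it to r_x and r_y, and
    with r these give the rows of an invertible frame. *)
Lemma lift_spans T (M N : 'M[Cplx]_3) : lagrangian_torus T ->
  (forall x y, lift T x y *m M = lift T x y *m N) -> M = N.
Proof.
move=> hT e.
have [[sr _] _ _ met fr] := hT.
have e' : (fun x y => lift T x y *m M) = (fun x y => lift T x y *m N).
  by apply: functional_extensionality => x; apply: functional_extensionality => y.
have [m1 m2] := vdiff_D3 (vdiff_mulmx M (smooth3_vdiff 0 0 sr)).
have [n1 n2] := vdiff_D3 (vdiff_mulmx N (smooth3_vdiff 0 0 sr)).
rewrite e' in m1 m2.
have u : frame T 0 0 \in unitmx by rewrite unitmxE -fr unitfE expi_neq0.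
apply: (can_inj (mulKmx u)); apply/row_matrixP => i; rewrite !row_mul /frame !rowK.
case: i => [[|[|[|i]]] hi]; try discriminate; rewrite /=.
- exact: e.
- by rewrite -!scalemxAl -m1 n1.
- by rewrite -!scalemxAl -m2 n2.
Qed.

(** * Classification of homogeneous Lagrangian tori *)

Section Homogeneous.
Variables (T : torus_data) (S : {vspace C3} -> Prop).
Hypothesis pT : parametrizes T S.
Hypothesis hS : homogeneous S.
Let r := lift T.
Let hT : lagrangian_torus T. Proof. by case: pT. Qed.

(** The translated lift and the rotated lift are horizontal lifts of the same map, so they differ by
    a constant phase, absorbed into the matrix. Working with vectors instead of lines makes the
    matrices commute exactly, not just up to scalars. *)
Lemma translation_matrix b1 b2 : exists2 U : 'M[Cplx]_3, U \is unitarymx &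
  forall x y, r (x + b1) (y + b2) = r x y *m U.
Proof.
have [U hU eU] := all_translates pT hS b1 b2.
have [sr hr] := lagrangian_horizontal hT.
have [t ht] := expi_surj (unitary_det hU).
have hor1 := lagrangian_horizontal (rotate_lagrangian hU ht hT).
have sx : smooth (fun x _ : R => x + b1) by apply: smooth_add; [exact: smooth_fst | exact: smooth_const].
have sy : smooth (fun _ y : R => y + b2) by apply: smooth_add; [exact: smooth_snd | exact: smooth_const].
have hor2 : horizontal (fun x y => r (x + b1) (y + b2)).
  split; first exact: (smooth3_comp sr sx sy).
  move=> x y.
  have dx : diff2 (fun x _ : R => x + b1) x y 1 0.
    by apply: diff2_ext (diff2_affine 1 0 b1 x y) => // *; ring.
  have dy : diff2 (fun _ y : R => y + b2) x y 0 1.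
    by apply: diff2_ext (diff2_affine 0 1 b2 x y) => // *; ring.
  have [-> ->] := vdiff_D3 (vdiff_comp (smooth3_vdiff (x + b1) (y + b2) sr) dx dy).
  case: (hr (x + b1) (y + b2)) => e1 e2 e3; split; first exact: e1.
  - exact: (dotmx_lin0 _ _ e2 e3).
  - exact: (dotmx_lin0 _ _ e2 e3).
have [c hc e] := horizontal_lift_unique hor1 hor2 (fun x y => esym (eU x y)).
exists (c *: U)%R; last by move=> x y; rewrite e -scalemxAr.
apply/unitarymxP; rewrite linearZ /= map_mxZ -scalemxAl -scalemxAr scalerA.
by rewrite hc (unitarymxP hU) scale1r.
Qed.

Lemma diagonal_frame : exists2 V : 'M[Cplx]_3, V \is unitarymx &
  forall b1 b2, exists chi : 'I_3 -> Cplx, forall x y j,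
    (r (x + b1) (y + b2) *m V) 0%R j = ((r x y *m V) 0%R j * chi j)%R /\
    (chi j * conjC (chi j) = 1)%R.
Proof.
pose hU (b : R * R) := constructive_indefinite_description _
  (match translation_matrix b.1 b.2 with ex_intro2 U u e => ex_intro
     (fun U : 'M[Cplx]_3 => U \is unitarymx /\ forall x y, r (x + b.1) (y + b.2) = r x y *m U) U (conj u e) end).
pose U b := proj1_sig (hU b).
have uU b : U b \is unitarymx := (proj2_sig (hU b)).1.
have eU b x y : r (x + b.1) (y + b.2) = r x y *m U b := (proj2_sig (hU b)).2 x y.
(* Both products translate the lift by b + c, and its values span C^3. *)
have cU b c : U b *m U c = U c *m U b.
  apply: (lift_spans hT) => x y; rewrite !mulmxA -/r -!eU; congr r; ring.
have [P hP dP] := codiagonalize uU cU.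
exists (P^T ^ conjC)%sesqui; first exact: unitary_adj.
move=> b1 b2; set V := (P^T ^ conjC)%sesqui.
have VP : V *m P = 1%:M by apply: mulmx1C; exact: unitary_mulCV.
pose A : 'M[Cplx]_3 := P *m U (b1, b2) *m V.
have uA : A \is unitarymx := mul_unitarymx (mul_unitarymx hP (uU _)) (unitary_adj hP).
have dA i j : i != j -> A i j = 0%R by move: (dP (b1, b2)) => /is_diag_mxP h; apply: h.
exists (fun j => A j j) => x y j; split.
- have -> : r (x + b1) (y + b2) *m V = r x y *m V *m A.
    by rewrite (eU (b1, b2)) /A !mulmxA -(mulmxA (r x y) V P) VP mulmx1.
  rewrite mxE (bigD1 j) //= big1 ?addr0 // => k kj.
  by rewrite (dA _ _ kj) mulr0.
- apply/cnorm1P; have := unitary_row_norm j uA; rewrite /sum3.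
  have ne (i k : nat) : (i < 3)%N -> (k < 3)%N -> i != k -> (inord i : 'I_3) != inord k.
    by move=> hi hk; rewrite -val_eqE /= !inordK.
  have z i k hi hk hik := dA _ _ (ne i k hi hk hik).
  move: j; apply: ord3P.
  - rewrite (z 0%N 1%N) // (z 0%N 2%N) // cRe0 cIm0; lra.
  - rewrite (z 1%N 0%N) // (z 1%N 2%N) // cRe0 cIm0; lra.
  - rewrite (z 2%N 0%N) // (z 2%N 1%N) // cRe0 cIm0; lra.
Qed.
End Homogeneous.

Lemma cdiff_shift f x y b1 b2 a b : cdiff f (x + b1) (y + b2) a b ->
  cdiff (fun u v => f (u + b1) (v + b2)) x y a b.
Proof.
move=> h.
have dx : diff2 (fun u _ : R => u + b1) x y 1 0.
  by apply: diff2_ext (diff2_affine 1 0 b1 x y) => // *; ring.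
have dy : diff2 (fun _ v : R => v + b2) x y 0 1.
  by apply: diff2_ext (diff2_affine 0 1 b2 x y) => // *; ring.
have e1 : a = (cR 1 * a + cR 0 * b)%R.
  by apply: cplx_ext; rewrite ?cReD ?cImD ?cReM ?cImM /=; ring.
have e2 : b = (cR 0 * a + cR 1 * b)%R.
  by apply: cplx_ext; rewrite ?cReD ?cImD ?cReM ?cImM /=; ring.
rewrite [X in cdiff _ _ _ _ X]e2 [X in cdiff _ _ _ X _]e1; exact: (cdiff_comp h dx dy).
Qed.

Lemma cnorm_pos (z : Cplx) : z != 0%R -> 0 < complex.Re z ^ 2 + complex.Im z ^ 2.
Proof.
case: z => a b nz.
have h1 := pow2_ge_0 a; have h2 := pow2_ge_0 b.
case: (Rle_lt_or_eq_dec _ _ (Rplus_le_le_0_compat _ _ h1 h2)) => // e.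
case/eqP: nz; apply: cplx_ext; rewrite ?cRe0 ?cIm0 /=; nra.
Qed.

Lemma cplx_polar (z : Cplx) : z != 0%R -> exists rho theta, 0 < rho /\ z = (cR rho * expi theta)%R.
Proof.
move=> nz; have pos := cnorm_pos nz.
set n := complex.Re z ^ 2 + complex.Im z ^ 2 in pos.
have spos := sqrt_lt_R0 _ pos.
have ss : sqrt n * sqrt n = n by apply: sqrt_sqrt; lra.
have [t ht] : exists t, expi t = (cR (/ sqrt n) * z)%R.
  apply: expi_surj; apply/cnorm1P; rewrite cReM cImM /=.
  have -> : (/ sqrt n * complex.Re z - 0 * complex.Im z) ^ 2 + (/ sqrt n * complex.Im z + 0 * complex.Re z) ^ 2 =
    / (sqrt n * sqrt n) * n.
    rewrite {5}/n; field; lra.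
  by rewrite ss Rinv_l //; lra.
exists (sqrt n), t; split=> //; rewrite ht mulrA -cR_mul Rinv_r; last lra.
by rewrite [cR 1](_ : _ = 1%R) // mul1r.
Qed.

(** Translation invariance up to a factor gives f_x = k f and f_y = l f with constant k, l. The
    factors have modulus 1, so |f| is constant and k, l are imaginary; dividing by the matching
    exponential leaves a constant. *)
Lemma character_exp (f : R -> R -> Cplx) : csmooth f -> f 0 0 != 0%R ->
  (forall b1 b2, exists2 c : Cplx, (c * conjC c = 1)%R &
     forall x y, f (x + b1) (y + b2) = (f x y * c)%R) ->
  exists rho p q theta, 0 < rho /\
    forall x y, f x y = (cR rho * expi (p * x + q * y + theta)%coqR)%R.
Proof.
move=> [s1 s2] nz0 trans.
pose X x y : Cplx := Complex (Dx (fun x y => complex.Re (f x y)) x y) (Dx (fun x y => complex.Im (f x y)) x y).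
pose Y x y : Cplx := Complex (Dy (fun x y => complex.Re (f x y)) x y) (Dy (fun x y => complex.Im (f x y)) x y).
have df x y : cdiff f x y (X x y) (Y x y) by split; apply: smooth_diff.
pose z0 := f 0 0; pose X0 := X 0 0; pose Y0 := Y 0 0.
have d00 : cdiff f 0 0 X0 Y0 := df 0 0.
pose k := (X0 / z0)%R; pose l := (Y0 / z0)%R.
have XY x y : X x y = (k * f x y)%R /\ Y x y = (l * f x y)%R.
  have [c hc ec] := trans x y.
  have d1 : cdiff (fun u v => f (u + x) (v + y)) 0 0 (X x y) (Y x y).
    by apply: cdiff_shift; rewrite !Rplus_0_l.
  have d2 := cdiff_mul d00 (cdiff_const c 0 0).
  have d3 := cdiff_ext (fun u v => esym (ec u v)) d2.
  have [-> ->] := cdiff_unique d1 d3.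
  have fx : f x y = (z0 * c)%R by rewrite -ec !Rplus_0_l.
  by rewrite !mulr0 !addr0 fx /k /l !mulrA !divfK.
have [nk nl] : complex.Re k = 0 /\ complex.Re l = 0.
  have d1 := cdiff_mul d00 (cdiff_conj d00).
  have cst : (fun x y => f x y * conjC (f x y))%R = (fun _ _ => z0 * conjC z0)%R.
    apply: functional_extensionality => x; apply: functional_extensionality => y.
    have [c hc ec] := trans x y.
    have -> : f x y = (z0 * c)%R by rewrite -ec !Rplus_0_l.
    by rewrite rmorphM /= mulrACA hc mulr1.
  rewrite cst in d1.
  have [e1 e2] := cdiff_unique d1 (cdiff_const _ 0 0).
  have [x1 y1] : X0 = (k * z0)%R /\ Y0 = (l * z0)%R := XY 0 0; rewrite x1 in e1; rewrite y1 in e2.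
  have pos : 0 < complex.Re z0 ^ 2 + complex.Im z0 ^ 2 := cnorm_pos nz0.
  have z (m : Cplx) : (m * z0 * conjC z0 + z0 * conjC (m * z0) = 0)%R -> complex.Re m = 0.
    move=> h; have := congr1 (@complex.Re R) h.
    rewrite cRe0 !(cReD, cReM, cImM, cReC, cImC) => h'.
    have : 2 * complex.Re m * (complex.Re z0 ^ 2 + complex.Im z0 ^ 2) = 0 by apply: etrans h'; ring.
    by case/Rmult_integral => ?; lra.
  by split; apply: z.
pose p := complex.Im k; pose q := complex.Im l.
have kE : k = Complex 0%coqR p by apply: cplx_ext.
have lE : l = Complex 0%coqR q by apply: cplx_ext.
pose g x y := (f x y * expi (- p * x + - q * y + 0)%coqR)%R.
have dg : forall x y, cdiff g x y 0%R 0%R.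
  move=> x y.
  have := cdiff_mul (df x y) (cdiff_expi (diff2_affine (- p) (- q) 0 x y)).
  have [-> ->] := XY x y.
  have neg (a : R) : Complex 0%coqR (- a)%coqR = (- Complex 0%coqR a)%R.
    by apply: cplx_ext => //=; rewrite /GRing.opp /=; ring.
  rewrite kE lE !neg !mulNr !mulrN.
  by rewrite !mulrA ![(f x y * Complex _ _)%R]mulrC !subrr.
have gc x y : g x y = z0.
  rewrite (cdiff_0_const dg x y 0 0) /g.
  have -> : - p * 0 + - q * 0 + 0 = 0 by ring.
  have -> : expi 0 = 1%R by apply: cplx_ext; rewrite ?cRe1 ?cIm1 /= ?cos_0 ?sin_0.
  by rewrite mulr1.
have [rho [theta [rpos hz]]] := cplx_polar nz0.
exists rho, p, q, theta; split=> // x y.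
have -> : p * x + q * y + theta = theta + (p * x + q * y) by ring.
rewrite expiD mulrA -hz -/z0 -(gc x y) /g -mulrA -expiD.
have -> : - p * x + - q * y + 0 + (p * x + q * y) = 0 by ring.
have -> : expi 0 = 1%R by apply: cplx_ext; rewrite ?cRe1 ?cIm1 /= ?cos_0 ?sin_0.
by rewrite mulr1.
Qed.

Theorem homogeneous_Sigma T S : parametrizes T S -> homogeneous S ->
  exists r1 r2 r3 : R, exists V : 'M[Cplx]_3,
  [/\ [/\ 0 < r1, 0 < r2 & 0 < r3], r1 ^ 2 + r2 ^ 2 + r3 ^ 2 = 1, V \is unitarymx
    & forall L, Sigma r1 r2 r3 L <-> exists2 L0, S L0 & L = move V L0].
Proof.
move=> pT hS.
have hT : lagrangian_torus T by case: pT.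
have [V hV chi] := diagonal_frame pT hS.
have [t ht] := expi_surj (unitary_det hV).
pose T' := rotate V t T.
have hT' : lagrangian_torus T' := rotate_lagrangian hV ht hT.
have pT' := rotate_parametrizes hV ht hT pT (fun L => iff_refl (exists2 L0, S L0 & L = move V L0)).
have [[sr _] _ _ met _] := hT'.
have ex j : exists c : R * R * R * R, 0 < c.1.1.1 /\ forall x y,
    lift T' x y 0%R j = (cR c.1.1.1 * expi (c.1.1.2 * x + c.1.2 * y + c.2)%coqR)%R.
  have [||b1 b2|rho [p [q [theta h]]]] := @character_exp (fun x y => lift T' x y 0%R j).
  - exact: sr.
  - apply/eqP => h0.
    have hz x y : lift T' x y 0%R j = 0%R.
      have [c hc] := chi x y; have [] := hc 0 0 j; rewrite !Rplus_0_l => e _.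
      by rewrite [LHS]e [X in (X * _)%R]h0 mul0r.
    (* A coordinate vanishing at 0 vanishes everywhere, so the lift would lie in a coordinate
       hyperplane, against [lift_spans]. *)
    have : (delta_mx j j : 'M[Cplx]_3) = 0%R.
      apply: (lift_spans hT') => x y; apply/rowP => k; rewrite mulmx0 !mxE big1 // => i _.
      rewrite [delta_mx _ _ _ _]mxE; case: eqP => [->|_]; last by rewrite mulr0.
      by rewrite [X in (X * _)%R]hz mul0r.
    by move/matrixP/(_ j j); rewrite !mxE !eqxx => /eqP; rewrite oner_eq0.
  - have [c hc] := chi b1 b2; exists (c j); first by case: (hc 0 0 j).
    by move=> x y; case: (hc x y j).
  - by exists (rho, p, q, theta).
have [c hc] := fin_all_exists ex.
pose rho j := (c j).1.1.1; pose p j := (c j).1.1.2; pose q j := (c j).1.2; pose theta j := (c j).2.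
have rpos j : 0 < rho j := (hc j).1.
have lE : lift T' = llift rho p q theta.
  apply: functional_extensionality => x; apply: functional_extensionality => y.
  by apply/rowP => j; rewrite [RHS]mxE; exact: ((hc j).2 x y).
have [dX dY] := vdiff_D3 (llift_vdiff rho p q theta 0 0).
(* For linear phases the metric relations at one point already are the weighted relations on [rho],
   [p], [q]. They force [Delta] to be nonzero, so the lift covers the whole torus. *)
have := met 0 0; rewrite lE dX dY /llift lvec_gvec !dotmx_gvec.
move=> [h0 [h1 h2 h3] h4 h5].
have re (a b : R) (z : Cplx) : Complex a b = z -> a = complex.Re z by move=> <-.
have im (a b : R) (z : Cplx) : Complex a b = z -> b = complex.Im z by move=> <-.
have r0 : sum3 (fun j => rho j ^ 2) = 1.
  by apply: etrans (re _ _ _ h0); rewrite /sum3 /=; ring.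
have r1 : sum3 (fun j => rho j ^ 2 * p j) = 0.
  by apply: etrans (im _ _ _ h1); rewrite /sum3 /=; ring.
have r2 : sum3 (fun j => rho j ^ 2 * q j) = 0.
  by apply: etrans (im _ _ _ h2); rewrite /sum3 /=; ring.
have r3 : sum3 (fun j => rho j ^ 2 * (p j * q j)) = 0.
  by apply: etrans (re _ _ _ h3); rewrite /sum3 /=; ring.
have r4 : sum3 (fun j => rho j ^ 2 * (p j * p j)) = 2 * exp (conf T' 0 0).
  by apply: etrans (re _ _ _ h4); rewrite /sum3 /=; ring.
have r5 : sum3 (fun j => rho j ^ 2 * (q j * q j)) = 2 * exp (conf T' 0 0).
  by apply: etrans (re _ _ _ h5); rewrite /sum3 /=; ring.
have nz := Delta_neq0 r0 r1 r2 r3 r4 r5.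
exists (rho (inord 0)), (rho (inord 1)), (rho (inord 2)), V; split=> //.
have -> : Sigma (rho (inord 0)) (rho (inord 1)) (rho (inord 2)) = lset rho.
  rewrite Sigma_lset; congr lset; apply: functional_extensionality; apply: ord3P.
  - exact: triple0.
  - exact: triple1.
  - exact: triple2.
move=> L; have [_ h _] := pT'; rewrite h.
have e := @llift_onto rho p q theta rpos L nz.
rewrite lE; exact: e.
Qed.

(** * The minimum of the energy *)

Lemma inv_sqrt3 : 0 < / sqrt 3 /\ (/ sqrt 3) ^ 2 = / 3.
Proof.
have h : 0 < sqrt 3 by apply: sqrt_lt_R0; lra.
split; first exact: Rinv_0_lt_compat.
by rewrite pow_inv -Rsqr_pow2 Rsqr_sqrt; lra.
Qed.

(* With u the product of the radii and e2 the second elementary symmetric function of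
   their squares, e2 >= sqrt 3 u and 3 e2 <= 1. *)
Lemma energy_lower_bound r1 r2 r3 : 0 < r1 -> 0 < r2 -> 0 < r3 ->
  r1 ^ 2 + r2 ^ 2 + r3 ^ 2 = 1 ->
  4 * PI ^ 2 / (3 * sqrt 3) <=
  PI ^ 2 * (1 - r1 ^ 2) * (1 - r2 ^ 2) * (1 - r3 ^ 2) / (2 * r1 * r2 * r3).
Proof.
move=> p1 p2 p3 sph.
have h3 : 0 < sqrt 3 by apply: sqrt_lt_R0; lra.
have s3 : sqrt 3 * sqrt 3 = 3 by apply: sqrt_sqrt; lra.
set t := sqrt 3 in h3 s3 *.
pose u := r1 * r2 * r3.
have u0 : 0 < u by apply: Rmult_lt_0_compat => //; apply: Rmult_lt_0_compat.
pose e2 := r1 ^ 2 * r2 ^ 2 + r2 ^ 2 * r3 ^ 2 + r3 ^ 2 * r1 ^ 2.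
have sq x y : 0 <= y -> x * x <= y * y -> x <= y.
  by move=> hy h; case: (Rle_or_lt x y) => // lt; nra.
have e20 : 0 <= e2 by rewrite /e2; nra.
have h1 : t * u <= e2.
  apply: sq => //.
  have -> : t * u * (t * u) = (t * t) * (u * u) by ring.
  have -> : e2 * e2 = 3 * (u * u) * (r1 ^ 2 + r2 ^ 2 + r3 ^ 2) +
    / 2 * ((r1 ^ 2 * r2 ^ 2 - r2 ^ 2 * r3 ^ 2) ^ 2 + (r2 ^ 2 * r3 ^ 2 - r3 ^ 2 * r1 ^ 2) ^ 2 +
           (r3 ^ 2 * r1 ^ 2 - r1 ^ 2 * r2 ^ 2) ^ 2) by rewrite /e2 /u; field.
  rewrite s3 sph.
  have k1 := pow2_ge_0 (r1 ^ 2 * r2 ^ 2 - r2 ^ 2 * r3 ^ 2).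
  have k2 := pow2_ge_0 (r2 ^ 2 * r3 ^ 2 - r3 ^ 2 * r1 ^ 2).
  have k3 := pow2_ge_0 (r3 ^ 2 * r1 ^ 2 - r1 ^ 2 * r2 ^ 2).
  lra.
have h2 : 3 * e2 <= 1.
  have k1 := pow2_ge_0 (r1 ^ 2 - r2 ^ 2); have k2 := pow2_ge_0 (r2 ^ 2 - r3 ^ 2).
  have k3 := pow2_ge_0 (r3 ^ 2 - r1 ^ 2).
  have : (r1 ^ 2 + r2 ^ 2 + r3 ^ 2) * (r1 ^ 2 + r2 ^ 2 + r3 ^ 2) = 1 by rewrite sph; ring.
  rewrite /e2; lra.
have h4 : 3 * (t * u) <= 1 by lra.
(* The expansion is 1 - e1 + e2 - e3 with e1 = 1 and e3 = u^2. *)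
have prod : (1 - r1 ^ 2) * (1 - r2 ^ 2) * (1 - r3 ^ 2) = e2 - u * u.
  have -> : r3 ^ 2 = 1 - r1 ^ 2 - r2 ^ 2 by lra.
  have -> : u * u = r1 ^ 2 * r2 ^ 2 * (1 - r1 ^ 2 - r2 ^ 2).
    have -> : 1 - r1 ^ 2 - r2 ^ 2 = r3 ^ 2 by lra.
    by rewrite /u; ring.
  have -> : e2 = r1 ^ 2 * r2 ^ 2 + (r1 ^ 2 + r2 ^ 2) * (1 - r1 ^ 2 - r2 ^ 2).
    have -> : 1 - r1 ^ 2 - r2 ^ 2 = r3 ^ 2 by lra.
    by rewrite /e2; ring.
  ring.
have -> : PI ^ 2 * (1 - r1 ^ 2) * (1 - r2 ^ 2) * (1 - r3 ^ 2) / (2 * r1 * r2 * r3) =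
    PI ^ 2 * ((e2 - u * u) / (2 * u)) by rewrite -prod /u; field; lra.
have -> : 4 * PI ^ 2 / (3 * t) = PI ^ 2 * (4 / (3 * t)) by field; lra.
apply: Rmult_le_compat_l; first exact: pow2_ge_0.
(* Clearing denominators leaves 8 u <= 3 t e2 - 3 t u^2, where the first term is at least 9 u and
   the second at most u. *)
apply: (Rmult_le_reg_r (6 * t * u)); first by apply: Rmult_lt_0_compat => //; lra.
have -> : 4 / (3 * t) * (6 * t * u) = 8 * u by field; lra.
have -> : (e2 - u * u) / (2 * u) * (6 * t * u) = 3 * t * (e2 - u * u) by field; lra.
have k1 : t * (t * u) <= t * e2 by apply: Rmult_le_compat_l; lra.
have k2 : u * (3 * (t * u)) <= u * 1 by apply: Rmult_le_compat_l; lra.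
have k3 : t * (t * u) = 3 * u by rewrite -Rmult_assoc s3.
lra.
Qed.

Theorem proposition1 :
  (forall r1 r2 r3 : R, 0 < r1 -> 0 < r2 -> 0 < r3 ->
     r1 ^ 2 + r2 ^ 2 + r3 ^ 2 = 1 ->
     homogeneous_lagrangian_torus (Sigma r1 r2 r3) /\
     has_energy (Sigma r1 r2 r3)
       (cR (PI ^ 2 * (1 - r1 ^ 2) * (1 - r2 ^ 2) * (1 - r3 ^ 2)
              / (2 * r1 * r2 * r3)))) /\
  (homogeneous_lagrangian_torus Clifford /\
   exists eCl : R, has_energy Clifford (cR eCl) /\
     forall S : {vspace C3} -> Prop, homogeneous_lagrangian_torus S ->
       exists e : R, has_energy S (cR e) /\ eCl <= e) /\
  has_energy Clifford (cR (4 * PI ^ 2 / (3 * sqrt 3))) /\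
  has_area Clifford (4 * PI ^ 2 / (3 * sqrt 3)).
Proof.
have [cpos c2] := inv_sqrt3.
have csph : (/ sqrt 3) ^ 2 + (/ sqrt 3) ^ 2 + (/ sqrt 3) ^ 2 = 1 by rewrite c2; field.
have [hC eC aC] := Sigma_structure cpos cpos cpos csph.
have s3 : 0 < sqrt 3 by apply: sqrt_lt_R0; lra.
have ss : sqrt 3 * sqrt 3 = 3 by apply: sqrt_sqrt; lra.
have eV : PI ^ 2 * (1 - (/ sqrt 3) ^ 2) * (1 - (/ sqrt 3) ^ 2) * (1 - (/ sqrt 3) ^ 2) /
    (2 * / sqrt 3 * / sqrt 3 * / sqrt 3) = 4 * PI ^ 2 / (3 * sqrt 3).
  rewrite c2.
  have -> : 2 * / sqrt 3 * / sqrt 3 * / sqrt 3 = 2 * / (sqrt 3 * sqrt 3) * / sqrt 3 by field; lra.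
  rewrite ss.
  apply: (Rmult_eq_reg_r (3 * sqrt 3)); last lra.
  have -> : 4 * PI ^ 2 / (3 * sqrt 3) * (3 * sqrt 3) = 4 * PI ^ 2 by field; lra.
  have -> : PI ^ 2 * (1 - / 3) * (1 - / 3) * (1 - / 3) / (2 * / 3 * / sqrt 3) * (3 * sqrt 3) =
    4 / 3 * PI ^ 2 * (sqrt 3 * sqrt 3) by field; lra.
  by rewrite ss; field.
have aV : 4 * PI ^ 2 * (/ sqrt 3 * / sqrt 3 * / sqrt 3) = 4 * PI ^ 2 / (3 * sqrt 3).
  have -> : / sqrt 3 * / sqrt 3 * / sqrt 3 = / (sqrt 3 * sqrt 3) * / sqrt 3 by field; lra.
  by rewrite ss; field; lra.
rewrite eV in eC; rewrite aV in aC.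
split; [|split; [split|split]].
- move=> r1 r2 r3 p1 p2 p3 sph.
  by have [h e _] := Sigma_structure p1 p2 p3 sph; split.
- exact: hC.
- exists (4 * PI ^ 2 / (3 * sqrt 3)); split; first exact: eC.
  move=> S [[T pT] hS].
  have [r1 [r2 [r3 [V [[p1 p2 p3] sph hV hSig]]]]] := homogeneous_Sigma pT hS.
  have [_ e _] := Sigma_structure p1 p2 p3 sph.
  eexists; split; last exact: (energy_lower_bound p1 p2 p3 sph).
  by apply: (has_energy_move hV hSig _ e); exists T.
- exact: eC.
- exact: aC.
Qed.
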